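(* Let $\mu$ be a non-atomic self-conformal measure associated to a $C^2$ iterated function system $\Phi=\{\varphi_a:a\in\mathbf A\}$ on $\mathbb R$ satisfying the UNI condition. Then there exists $\alpha>0$ such that $$|\widehat\mu(\xi)|\lesssim|\xi|^{-\alpha}$$ for all $\xi\in\mathbb R$ with $|\xi|>1$, where $\widehat\mu(\xi):=\int e^{-2\pi i\xi x}\,d\mu(x)$ and the implied constant is independent of $\xi$.
   Context: $I=[0,1]$, $\mathbf A$ is a finite set, and $\Phi=\{\varphi_a:I\to I\}_{a\in\mathbf A}$ consists of $C^2$ maps. For $\mathbf a=(a_1,\dots,a_n)\in\mathbf A^n$ write $\varphi_{\mathbf a}=\varphi_{a_1}\circ\cdots\circ\varphi_{a_n}$. Let $K$ be the attractor: the unique non-empty compact set with $K=\bigcup_{a\in\mathbf A}\varphi_a(K)$. Standing properties of the IFS: - Uniform contraction: there are $1<\gamma<\gamma_1$ such that $\gamma_1^{-n}\lesssim|\varphi_{\mathbf a}'(x)|\lesssim\gamma^{-n}$ for all $x\in I$, $n\in\mathbb N$, $\mathbf a\in\mathbf A^n$ (implied constants independent of $x,n,\mathbf a$). - Bounded distortions: there is $B>0$ with $|\varphi_a'(x)|/|\varphi_a'(y)|\le B$ for all $x,y\in I$, $a\in\mathbf A$. - Non-trivial: $K$ is not a singleton. - UNI (Uniform Non-Integrability): there exist $c_1,c_2>0$ such that for all $n$ sufficiently large there exist $\mathbf a,\mathbf b\in\mathbf A^n$ with $c_1\le\left|\frac{\varphi_{\mathbf a}''(x)}{\varphi_{\mathbf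 a}'(x)}-\frac{\varphi_{\mathbf b}''(x)}{\varphi_{\mathbf b}'(x)}\right|\le c_2$ for all $x\in K$. No separation is assumed (arbitrary overlaps). A self-conformal measure of $\Phi$ is the unique Borel probability measure $\mu$ satisfying $\mu=\sum_{a\in\mathbf A}p_a\,(\varphi_a)_*\mu$ for a given probability vector $(p_a)_{a\in\mathbf A}$ with $0<p_a<1$ and $\sum_a p_a=1$; here $(\varphi_a)_*\mu=\mu\circ\varphi_a^{-1}$. $f\lesssim g$ means $f\le cg$ for a constant $c>0$. *)

(* Defs.v *)
From mathcomp Require Import all_boot all_order all_algebra.
From mathcomp Require Import complex.
From mathcomp Require Import all_classical all_reals all_analysis.

Set Implicit Arguments.
Unset Strict Implicit.
Unset Printing Implicit Defensive.

Import Order.TTheory GRing.Theory Num.Theory.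
Import numFieldNormedType.Exports.

Local Open Scope classical_set_scope.
Local Open Scope ring_scope.

(** Maps [I -> I] are represented by functions [f : R -> R] that send [I] into
    [I]; nothing below depends on their values outside [I]. *)
Definition I01 (R : realType) : set R := `[0, 1].

Lemma measurable_I01 (R : realType) : measurable (@I01 R).
Proof. exact: measurable_itv. Qed.

(** Derivatives on the compact interval [I] are taken relative to [I], hence are
    one-sided at the two endpoints. *)
Definition diffquot (R : realType) (f : R -> R) (x y : R) : R :=
  (f y - f x) / (y - x).

Definition derivableI (R : realType) (f : R -> R) : Prop :=
  forall x, I01 x -> cvg (diffquot f x y @[y --> within (@I01 R) x^']).

Definition derivI (R : realType) (f : R -> R) (x : R) : R :=
  lim (diffquot f x y @[y --> within (@I01 R) x^']).

Definition C2onI (R : realType) (f : R -> R) : Prop :=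
  [/\ derivableI f, derivableI (derivI f) &
      {within @I01 R, continuous (derivI (derivI f))}].

Section IFS.
Variables (R : realType) (A : finType) (phi : A -> R -> R).

Definition C2_IFS : Prop :=
  forall a, C2onI (phi a) /\ phi a @` @I01 R `<=` @I01 R.

Definition compose (w : seq A) : R -> R :=
  foldr (fun a f => phi a \o f) idfun w.

Definition attractor (K : set R) : Prop :=
  [/\ K `<=` @I01 R, K !=set0, compact K &
      K = \bigcup_(a in [set: A]) (phi a @` K)].

Definition uniformly_contracting : Prop :=
  exists g g1 : R, [/\ 1 < g, g < g1 &
  exists C C1 : R, [/\ 0 < C, 0 < C1 &
    forall (n : nat) (w : n.-tuple A) (x : R), I01 x ->
      C1 * g1 ^- n <= `|derivI (compose w) x| <= C * g ^- n]].

Definition bounded_distortion : Prop :=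
  exists2 B : R, 0 < B & forall (a : A) (x y : R), I01 x -> I01 y ->
    `|derivI (phi a) x| / `|derivI (phi a) y| <= B.

Definition nonlinearity (f : R -> R) (x : R) : R :=
  derivI (derivI f) x / derivI f x.

Definition UNI (K : set R) : Prop :=
  exists c1 c2 : R, [/\ 0 < c1, 0 < c2 &
  exists N : nat, forall n, (N <= n)%N -> exists a b : n.-tuple A,
    forall x, K x ->
      c1 <= `|nonlinearity (compose a) x - nonlinearity (compose b) x| <= c2].

Definition probability_vector (p : A -> R) : Prop :=
  (forall a, 0 < p a < 1) /\ \sum_a p a = 1.

(** A measure on [I] is a measure on [R] giving full mass to [I]; restricting
    to [I] before pushing forward makes [phi a] matter on [I] only. *)
Definition self_conformal (p : A -> R) (mu : probability R R) : Prop :=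
  mu (@I01 R) = 1%E /\
  forall E : set R, measurable E ->
    mu E = (\sum_(a : A) (p a)%:E *
      pushforward (mrestr mu (@measurable_I01 R)) (phi a) E)%E.

End IFS.

Definition non_atomic (R : realType) (mu : probability R R) : Prop :=
  forall x : R, mu [set x] = 0%E.

Definition expi (R : realType) (t : R) : R[i] := Complex (cos t) (sin t).

Definition Cintegral (R : realType) (mu : probability R R) (f : R -> R[i])
    : R[i] :=
  Complex (\int[mu]_x complex.Re (f x)) (\int[mu]_x complex.Im (f x)).

Definition fourier (R : realType) (mu : probability R R) (xi : R) : R[i] :=
  Cintegral mu (fun x => expi (- (2 * pi * xi * x))).

(* Main.v *)
(** Write [theta w = ln |phi_w'|] and let [X = |xi|].  UNI makes
    [theta a - theta b] vary at a linear rate near [K] for two long words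
    [a], [b].  Dolgopyat's argument then shows that the operators
    [f |-> \sum_(|w| = N) p_w expi (b * theta w) (f \o phi_w)] contract, in
    [L^2(mu)] and uniformly in large [|b|], the majorants of pairs [(f, H)],
    [|f| <= H].  No doubling property of [mu] is available under overlaps: it is
    replaced by cut sets, i.e. finite families of words of comparable derivative
    along which [mu] is stationary.  Iterating, the law of [theta w] for a random
    word of length [n] has a characteristic function exponentially small in [n]
    at frequencies between a constant and a power of [exp n].

    For the decay of the Fourier transform, expand [mu] along words [u v], where
    [u] is a word of length [n ~ ln X] followed by a cut set word of derivative
    about [r], and [v] is again a cut set word of derivative about [r].
    Linearising [phi_u] and applying Cauchy-Schwarz in [x] leaves
    [\sum_u p_u cos (tau * exp z_u)], with [z_u] a centred [theta u] and
    [tau] proportional to the distance of two [mu]-random points.  Near pairs of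
    points are controlled by a Frostman bound.  For the others, [z_u] lies in a
    window [[-L, L]] with [L] a small multiple of [n] by large deviations, and a
    Fejer mean of [cos (tau * exp z)] on that window reduces the sum to the
    characteristic functions above.  All errors are exponentially small in [n],
    hence a negative power of [X]. *)

Require Import Defs.
From mathcomp Require Import all_boot all_order all_algebra.
From mathcomp Require Import complex.
From mathcomp Require Import all_classical all_reals all_analysis.
From mathcomp Require Import measurable_realfun ring lra.
Import Order.TTheory GRing.Theory Num.Theory.
Import numFieldNormedType.Exports.
Set Implicit Arguments.
Unset Strict Implicit.
Unset Printing Implicit Defensive.
Local Open Scope classical_set_scope.
Local Open Scope ring_scope.
Local Open Scope complex_scope.

(** * Calculus relative to the interval *)
Section CalculusOnI.
Variable R : realType.
Implicit Types (f g h : R -> R) (x y z l m e d : R).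

(** The delicate point is how the scales fit together. The linearised phase is
    [S * der phi u _ * (phi_v x - phi_v y)]; up to factors [exp (O(L))] it has size
    [|S| * r * exp c0], where [c0] is the centre of [theta u], and [r] is chosen to make this
    [exp (5 L)]. As [exp c0] is itself proportional to [r], this means [r] of order [|S|^(-1/2)] up
    to exponentials in [n]. The quadratic error, of order [|S| * r^3], is then smaller than
    [|S| * r^2] by a factor [r], which is why [u] and [v] end at the same scale. The Fejer mean
    involves about [exp (18 L)] frequencies, so the characteristic functions have to decay faster
    than that; their rate per letter is dictated by the contraction, and this fixes how small
    [L / n] must be. UNI speaks of points of [K] only. The points compared in the cancellation are
    therefore images of two fixed points of [K], and mean value points are kept close to [K]. Signs
    of derivatives never matter: after squaring, [phi_u'] enters through a cosine. *)

Lemma I01P x : I01 x <-> 0 <= x <= 1.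
Proof. by rewrite /I01/= in_itv. Qed.

(** Differentiability relative to [I] without a quotient: the point [y = x] needs no exclusion, so
    the chain rule holds even if the inner map takes the value [f x] again nearby. *)
Definition derI f x l := forall e : R, 0 < e -> exists2 d : R, 0 < d &
  forall y, I01 y -> `|y - x| < d -> `|f y - f x - l * (y - x)| <= e * `|y - x|.

Lemma proper_within_I01 x : I01 x -> ProperFilter (within (@I01 R) x^').
Proof.
move=> /I01P Ix; apply: Build_ProperFilter_ex => P.
rewrite /within/= => /nbhs_ballP [e /= e0 H].
pose t := Order.min (e / 2) (1 / 2).
have t0 : 0 < t by rewrite lt_min; apply/andP; split; lra.
have te : t <= e / 2 by rewrite ge_min lexx.
have th : t <= 1 / 2 by rewrite ge_min lexx orbT.
have [xh|xh] := leP x (1 / 2).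
- exists (x + t); apply: H.
  + by rewrite /ball/= ltr_norml; apply/andP; split; lra.
  + by apply/negP => /eqP; lra.
  + by apply/I01P; lra.
- exists (x - t); apply: H.
  + by rewrite /ball/= ltr_norml; apply/andP; split; lra.
  + by apply/negP => /eqP; lra.
  + by apply/I01P; lra.
Qed.

Lemma derI_cvg f x l : diffquot f x y @[y --> within (@I01 R) x^'] --> l <->
  derI f x l.
Proof.
split.
- move=> /cvgrPdist_le H e e0; have := H e e0.
  rewrite /= near_withinE => /nbhs_ballP[d /= d0 Hd]; exists d => // y Iy yx.
  have [->|neq] := eqVneq y x; first by rewrite !subrr mulr0 subr0 normr0 mulr0.
  have := Hd y; rewrite /ball/= distrC => /(_ yx neq Iy); rewrite /diffquot => Hy.
  have yx0 : y - x != 0 by rewrite subr_eq0.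
  rewrite -ler_pdivrMr ?normr_gt0// -normf_div mulrBl mulfK//.
  by rewrite distrC.
- move=> H; apply/cvgrPdist_le => e e0.
  have [d d0 Hd] := H e e0; rewrite near_withinE.
  apply/nbhs_ballP; exists d => //= y; rewrite /ball/= distrC => yx neq Iy.
  have yx0 : y - x != 0 by rewrite subr_eq0.
  rewrite /diffquot distrC -[l](mulfK yx0) -mulrBl normf_div ler_pdivrMr ?normr_gt0//.
  exact: Hd.
Qed.

Lemma derI_derivI f x l : I01 x -> derI f x l -> derivI f x = l.
Proof.
move=> Ix /derI_cvg H; have := proper_within_I01 Ix => ?.
exact: cvg_lim.
Qed.

Lemma derivable_derI f x : derivableI f -> I01 x -> derI f x (derivI f x).
Proof. by move=> df Ix; apply/derI_cvg; exact: df. Qed.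

Lemma eq_derI f g x l : {in @I01 R, f =1 g} -> I01 x -> derI f x l -> derI g x l.
Proof.
move=> fg Ix H e e0; have [d d0 Hd] := H e e0; exists d => // y Iy yx.
by rewrite -!fg ?inE//; exact: Hd.
Qed.

Lemma derI_lip f x l : derI f x l -> exists2 d, 0 < d &
  forall y, I01 y -> `|y - x| < d -> `|f y - f x| <= (`|l| + 1) * `|y - x|.
Proof.
move=> H; have [d d0 Hd] := H 1 ltr01; exists d => // y Iy yx.
have := Hd y Iy yx => H1.
rewrite -[f y - f x](subrK (l * (y - x))) (le_trans (ler_normD _ _))//.
by rewrite normrM mulrDl addrC lerD.
Qed.

Lemma derI_cont f x l : derI f x l -> forall e : R, 0 < e -> exists2 d : R, 0 < d &
  forall y, I01 y -> `|y - x| < d -> `|f y - f x| <= e.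
Proof.
move=> /derI_lip [d d0 H] e e0.
have l1 : 0 < `|l| + 1 by rewrite ltr_wpDl.
exists (Order.min d (e / (`|l| + 1))).
  by rewrite lt_min d0 divr_gt0.
move=> y Iy; rewrite lt_min => /andP[yd ye].
by rewrite (le_trans (H _ Iy yd))// mulrC -ler_pdivlMr// ltW.
Qed.

Lemma derI_id x : derI id x 1.
Proof. by move=> e e0; exists 1 => // y _ _; rewrite mul1r subrr normr0 mulr_ge0// ltW. Qed.

Lemma derI_cst (c : R) x : derI (fun=> c) x 0.
Proof. by move=> e e0; exists 1 => // y _ _;
  rewrite mul0r !subr0 subrr normr0 mulr_ge0// ltW. Qed.

Lemma derI_add f g x l m : derI f x l -> derI g x m ->
  derI (fun y => f y + g y) x (l + m).
Proof.
move=> Hf Hg e e0; have e20 : 0 < e / 2 by lra.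
have [d d0 Hd] := Hf _ e20; have [d' d'0 Hd'] := Hg _ e20.
exists (Order.min d d'); first by rewrite lt_min d0.
move=> y Iy; rewrite lt_min => /andP[yd yd'].
have -> : f y + g y - (f x + g x) - (l + m) * (y - x) =
  (f y - f x - l * (y - x)) + (g y - g x - m * (y - x)) by ring.
by rewrite (le_trans (ler_normD _ _))// [e]splitr mulrDl lerD// ?Hd ?Hd'.
Qed.

Lemma derI_scale (c : R) f x l : derI f x l -> derI (fun y => c * f y) x (c * l).
Proof.
move=> Hf e e0; have c1 : 0 < `|c| + 1 by rewrite ltr_wpDl.
have [d d0 Hd] := Hf (e / (`|c| + 1)) (divr_gt0 e0 c1).
exists d => // y Iy yd.
have -> : c * f y - c * f x - c * l * (y - x) = c * (f y - f x - l * (y - x)) by ring.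
rewrite normrM (@le_trans _ _ ((`|c| + 1) * (e / (`|c| + 1) * `|y - x|)))//.
  by rewrite ler_pM// ?Hd// lerDl.
by rewrite mulrA mulrCA mulfV ?mulr1// gt_eqF.
Qed.

(** The set [D] covers two kinds of outer map: those differentiable relative to [I] ([D = I01]), and
    those differentiable on the line, such as [ln] or squaring ([D = setT]). *)
Lemma derI_comp_gen (h f : R -> R) (D : set R) x l m :
  (forall y, I01 y -> D (f y)) ->
  (forall e : R, 0 < e -> exists2 d : R, 0 < d & forall z, D z -> `|z - f x| < d ->
     `|h z - h (f x) - m * (z - f x)| <= e * `|z - f x|) ->
  derI f x l -> derI (h \o f) x (m * l).
Proof.
move=> fD Hh Hf e e0 /=.
have l1 : 0 < `|l| + 1 by rewrite ltr_wpDl.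
have m1 : 0 < `|m| + 1 by rewrite ltr_wpDl.
have [d d0 Hd] := Hh (e / 2 / (`|l| + 1)) ltac:(by rewrite divr_gt0//; lra).
have [d1 d10 Hd1] := Hf (e / 2 / (`|m| + 1)) ltac:(by rewrite divr_gt0//; lra).
have [d2 d20 Hd2] := derI_lip Hf.
have [d3 d30 Hd3] := derI_cont Hf (e := d / 2) ltac:(lra).
exists (Order.min (Order.min d1 d2) d3); first by rewrite !lt_min d10 d20.
move=> y Iy; rewrite !lt_min => /andP[/andP[yd1 yd2] yd3].
have := Hd (f y) (fD y Iy) ltac:(by apply: le_lt_trans (Hd3 _ Iy yd3) _; lra).
have := Hd1 y Iy yd1; have := Hd2 y Iy yd2 => A B C.
have -> : h (f y) - h (f x) - m * l * (y - x) = (h (f y) - h (f x) - m * (f y - f x))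
   + m * (f y - f x - l * (y - x)) by ring.
rewrite (le_trans (ler_normD _ _))// [e]splitr mulrDl lerD//.
  rewrite (le_trans C)// -mulrA ler_wpM2l//; first lra.
  by rewrite mulrC ler_pdivrMr// mulrC.
rewrite normrM (@le_trans _ _ ((`|m| + 1) * (e / 2 / (`|m| + 1) * `|y - x|)))//.
  by rewrite ler_pM// lerDl.
by rewrite mulrA mulrCA mulfV ?mulr1// gt_eqF.
Qed.

Lemma derI_comp h f x l m : (forall y, I01 y -> I01 (f y)) ->
  derI h (f x) m -> derI f x l -> derI (h \o f) x (m * l).
Proof. by move=> fI Hh; apply: (derI_comp_gen (D := @I01 R)). Qed.

Lemma is_derive_approx h z0 m : is_derive z0 1 h m ->
  forall e : R, 0 < e -> exists2 d : R, 0 < d & forall z, `|z - z0| < d ->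
     `|h z - h z0 - m * (z - z0)| <= e * `|z - z0|.
Proof.
move=> [dh <-] e e0; move: dh; rewrite /derivable -/(derive h z0 1) => /cvgrPdist_le.
move=> /(_ e e0); rewrite near_withinE => /nbhs_ballP[d /= d0 Hd].
exists d => // z zd; have [->|neq] := eqVneq z z0.
  by rewrite !subrr mulr0 subr0 normr0 mulr0.
have zz : z - z0 != 0 by rewrite subr_eq0.
have := Hd (z - z0); rewrite /ball/= sub0r normrN => /(_ zd zz).
rewrite /= [_ *: 1]mulr1 /GRing.scale/= subrK => H.
rewrite -ler_pdivrMr ?normr_gt0// -normf_div mulrBl mulfK// distrC.
by rewrite [X in _ - X]mulrC.
Qed.

Lemma derI_comp_is_derive h f x l m :
  is_derive (f x) 1 h m -> derI f x l -> derI (h \o f) x (m * l).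
Proof.
move=> Hh; apply: (derI_comp_gen (D := setT)) => // e e0.
by have [d d0 Hd] := is_derive_approx Hh e0; exists d => // z _; exact: Hd.
Qed.

(** Polarisation: [f g] is a quarter of [(f + g)^2 - (f - g)^2], so the chain rule for squaring is
    enough. *)
Lemma derI_mul f g x l m : derI f x l -> derI g x m ->
  derI (fun y => f y * g y) x (l * g x + f x * m).
Proof.
have sq k a b : derI k a b -> derI (fun y => k y ^+ 2) a (2 * k a * b).
  move=> H; apply: (derI_comp_is_derive (h := fun z => z ^+ 2)) H.
  have -> : (fun z : R => z ^+ 2) = id ^+ 2 by apply/funext.
  have D := is_deriveX (f := id) 2 (is_derive_id (k a) (1 : R)).
  by apply: is_derive_eq D _; rewrite /= expr1 /GRing.scale/= mulr1.
move=> Hf Hg.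
have := derI_add (derI_scale (1/4) (sq _ _ _ (derI_add Hf Hg)))
  (derI_scale (- (1/4)) (sq _ _ _ (derI_add Hf (derI_scale (-1) Hg)))).
move=> H e e0; have [d d0 Hd] := H e e0; exists d => // y Iy yd.
have := Hd y Iy yd; congr (`|_| <= _); by field.
Qed.

Lemma derI_is_derive f x l : 0 < x < 1 -> derI f x l -> is_derive x 1 f l.
Proof.
move=> x01 H.
have Hc : (fun t => t^-1 *: (f (t *: 1 + x) - f x)) @ 0^' --> l.
  apply/cvgrPdist_le => e e0; have [d d0 Hd] := H e e0.
  rewrite near_withinE; apply/nbhs_ballP.
  exists (Order.min d (Order.min x (1 - x))).
    by rewrite /= !lt_min d0; apply/andP; split=> //; apply/andP; split; lra.
  move=> t; rewrite /ball/= sub0r normrN !lt_min => /andP[td /andP[tx tx']] t0.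
  have Hx : I01 (t + x).
    by apply/I01P; move: tx tx'; rewrite !ltr_norml; lra.
  have := Hd _ Hx; rewrite addrK => /(_ td) Hy.
  rewrite [t *: 1]mulr1 /GRing.scale/= distrC mulrC.
  rewrite -[l](mulfK (x := t))// -mulrBl normf_div ler_pdivrMr ?normr_gt0//.
by split; [apply/cvg_ex; exists l | exact: cvg_lim].
Qed.


Lemma cont_within_approx f (a b : R) :
  (forall x, a <= x <= b -> forall e : R, 0 < e -> exists2 d : R, 0 < d &
    forall y, a <= y <= b -> `|y - x| < d -> `|f y - f x| <= e) ->
  {within `[a, b], continuous f}.
Proof.
move=> H; apply/subspace_continuousP => x /=; rewrite in_itv/= => xab.
apply/cvgrPdist_le => e e0; have [d d0 Hd] := H x xab e e0.
rewrite near_withinE; apply/nbhs_ballP; exists d => //= y.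
rewrite /ball/= distrC => yx; rewrite in_itv/= => yab.
by rewrite distrC; exact: Hd.
Qed.

(** One-sided derivatives at the endpoints do no harm, since the mean value theorem asks only for
    continuity there. The bound on [|c - x|] is what later keeps [c] close to a point of [K], or
    makes an error quadratic. *)
Lemma derI_mvt f f' x y : (forall x, I01 x -> derI f x (f' x)) ->
  I01 x -> I01 y -> exists c, [/\ I01 c, `|c - x| <= `|y - x| &
    f y - f x = f' c * (y - x)].
Proof.
move=> H.
have W a b : 0 <= a -> b <= 1 -> a <= b ->
    exists2 c, a <= c <= b & f b - f a = f' c * (b - a).
  move=> a0 b1 ab; have [c cab Hc] := MVT_segment ab (f := f) (df := f')
    ltac:(move=> z; rewrite in_itv/= => zab; apply: derI_is_derive; [lra | apply: H;
      apply/I01P; lra])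
    ltac:(apply: cont_within_approx => z zab e e0;
      have [d d0 Hd] := derI_cont (H z ltac:(apply/I01P; lra)) e0;
      exists d => // t tab; apply: Hd; apply/I01P; lra).
  by exists c => //; move: cab; rewrite in_itv.
move=> /I01P Ix /I01P Iy; have [xy|yx] := leP x y.
  have [c cab Hc] := W x y ltac:(lra) ltac:(lra) xy.
  exists c; split=> //; first by apply/I01P; lra.
  by rewrite !ger0_norm; lra.
have [c cab Hc] := W y x ltac:(lra) ltac:(lra) (ltW yx).
exists c; split=> //; first by apply/I01P; lra.
  by rewrite !ler0_norm; lra.
by rewrite -opprB Hc; ring.
Qed.

Lemma I01_unif_cont f :
  (forall x, I01 x -> forall e : R, 0 < e -> exists2 d : R, 0 < d &
    forall y, I01 y -> `|y - x| < d -> `|f y - f x| <= e) ->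
  forall e : R, 0 < e -> exists2 d : R, 0 < d &
    forall x y, I01 x -> I01 y -> `|y - x| < d -> `|f y - f x| <= e.
Proof.
move=> H e e0.
have e20 : 0 < e / 2 by lra.
have /compact_near_coveringP cov : compact (@I01 R) by exact: segment_compact.
have : \forall d \near 0^'+, @I01 R `<=` (fun x : R => forall y, I01 x -> I01 y ->
    `|y - x| < d -> `|f y - f x| <= e).
  apply: (cov R (0^'+)) => x Ix.
  have [d d0 Hd] := H x Ix _ e20.
  exists (ball x (d / 2), [set t : R | t < d / 2]).
    split=> /=; first by apply: nbhsx_ballx; lra.
    by apply: nbhs_right_lt; lra.
  move=> [z t] [/= xz td] y Iz Iy yz.
  have A := Hd z Iz; have B := Hd y Iy.
  move: xz; rewrite /ball/= distrC => xz.
  have {}A := A ltac:(lra).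
  have yx : `|y - x| < d by rewrite (le_lt_trans (ler_distD z _ _))//; lra.
  have {}B := B yx; rewrite (le_trans (ler_distD (f x) _ _))//.
  by rewrite [`|f x - f z|]distrC; lra.
move=> /filterI /(_ (nbhs_right_gt 0)) /filter_ex[d [Hd /= d0]].
by exists d => // x y Ix Iy; exact: Hd.
Qed.

Lemma I01_bounded f :
  (forall x, I01 x -> forall e : R, 0 < e -> exists2 d : R, 0 < d &
    forall y, I01 y -> `|y - x| < d -> `|f y - f x| <= e) ->
  exists2 M, 0 < M & forall x, I01 x -> `|f x| <= M.
Proof.
move=> H.
have C : {within `[0, 1], continuous (fun x => `|f x|)}.
  apply: cont_within_approx => x /I01P Ix e e0; have [d d0 Hd] := H x Ix e e0.
  exists d => // y /I01P Iy yx; apply: le_trans (Hd _ Iy yx).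
  exact: ler_dist_dist.
have [c _ Hc] := EVT_max ler01 C.
exists (`|f c| + 1); first by rewrite ltr_wpDl.
by move=> x Ix; rewrite (le_trans (Hc x Ix))// lerDl.
Qed.
End CalculusOnI.

(** * Continuity relative to the interval *)

Section ContinuousOnI.
Variable R : realType.
Implicit Types (f g : R -> R) (x y e d : R).

Definition contI f := forall x, I01 x -> f y @[y --> within (@I01 R) (nbhs x)] --> f x.

Lemma contIP f : contI f <-> forall x, I01 x -> forall e, 0 < e ->
  exists2 d, 0 < d & forall y, I01 y -> `|y - x| < d -> `|f y - f x| <= e.
Proof.
split=> [H x Ix e e0|H x Ix].
  have /cvgrPdist_le /(_ e e0) := H x Ix.
  rewrite near_withinE => /nbhs_ballP[d /= d0 Hd]; exists d => // y Iy yx.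
  by rewrite distrC; apply: Hd => //; rewrite /ball/= distrC.
apply/cvgrPdist_le => e e0; have [d d0 Hd] := H x Ix e e0.
rewrite near_withinE; apply/nbhs_ballP; exists d => //= y.
by rewrite /ball/= distrC => yx Iy; rewrite distrC; exact: Hd.
Qed.

Lemma within_contI f : {within @I01 R, continuous f} -> contI f.
Proof. by move=> /subspace_continuousP. Qed.

Lemma contI_within f : contI f -> {within @I01 R, continuous f}.
Proof. by move=> /subspace_continuousP. Qed.

Lemma contI_cst (c : R) : contI (fun=> c).
Proof. by move=> x _; exact: cvg_cst. Qed.

Lemma contI_add f g : contI f -> contI g -> contI (fun x => f x + g x).
Proof. by move=> Hf Hg x Ix; apply: cvgD; [exact: Hf|exact: Hg]. Qed.

Lemma contI_opp f : contI f -> contI (fun x => - f x).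
Proof. by move=> Hf x Ix; apply: cvgN; exact: Hf. Qed.

Lemma contI_mul f g : contI f -> contI g -> contI (fun x => f x * g x).
Proof. by move=> Hf Hg x Ix; apply: cvgM; [exact: Hf|exact: Hg]. Qed.

Lemma contI_inv f : contI f -> (forall x, I01 x -> f x != 0) -> contI (fun x => (f x)^-1).
Proof. by move=> Hf f0 x Ix; apply: cvgV; [exact: f0|exact: Hf]. Qed.

Lemma contI_comp f g : contI g -> contI f -> (forall x, I01 x -> I01 (f x)) ->
  contI (g \o f).
Proof.
move=> /contIP Hg /contIP Hf fI; apply/contIP => x Ix e e0.
have [d d0 Hd] := Hg (f x) (fI x Ix) e e0.
have [d' d'0 Hd'] := Hf x Ix (d / 2) ltac:(lra).
exists d' => // y Iy yx; apply: Hd; first exact: fI.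
by rewrite (le_lt_trans (Hd' _ Iy yx))//; lra.
Qed.

Lemma derI_contI f f' : (forall x, I01 x -> derI f x (f' x)) -> contI f.
Proof. by move=> H; apply/contIP => x Ix e e0; exact: derI_cont (H x Ix) _ e0. Qed.

Lemma contI_bounded f : contI f -> exists2 M, 0 < M & forall x, I01 x -> `|f x| <= M.
Proof. by move=> /contIP; exact: I01_bounded. Qed.

End ContinuousOnI.

(** * Words and the UNI condition *)
Section Words.
Variables (R : realType) (A : finType) (phi : A -> R -> R).
Implicit Types (w u : seq A) (x y : R).

Local Notation phiw := (compose phi).

Fixpoint der w x : R :=
  if w is a :: w' then derivI (phi a) (phiw w' x) * der w' x else 1.

(** The cocycle expression of [phi_w'' / phi_w'], the derivative of [theta w]. Written as a sum
    along the word, it is dominated by a geometric series. *)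
Fixpoint nonlin w x : R :=
  if w is a :: w' then nonlinearity (phi a) (phiw w' x) * der w' x + nonlin w' x
  else 0.

Definition theta w x : R := ln `|der w x|.

(** UNI in integrated form, the only form used in the cancellation argument. The radius [eta] may
    depend on the two words; it is needed because the segment from [x] to [y] leaves [K]. *)
Definition phase_separation (K : set R) : Prop :=
  exists2 c, 0 < c & exists N0, forall n, (N0 <= n)%N ->
  exists a b : seq A, exists2 eta, 0 < eta & [/\ size a = n, size b = n &
    forall x y, K x -> I01 y -> `|y - x| < eta ->
      c * `|y - x| <= `|(theta a y - theta b y) - (theta a x - theta b x)|].

Lemma compose_cat w u x : phiw (w ++ u) x = phiw w (phiw u x).
Proof. by elim: w => //= a w ->. Qed.

Lemma der_cat w u x : der (w ++ u) x = der w (phiw u x) * der u x.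
Proof. by elim: w => [|a w IH] /=; rewrite ?mul1r// IH compose_cat mulrA. Qed.

Hypothesis phiC2 : C2_IFS phi.
Variables (g g1 Cu Cl : R).
Hypotheses (g_gt1 : 1 < g) (g_lt : g < g1) (Cu0 : 0 < Cu) (Cl0 : 0 < Cl).
Hypothesis Hder : forall (n : nat) (w : n.-tuple A) (x : R), I01 x ->
      Cl * g1 ^- n <= `|derivI (phiw w) x| <= Cu * g ^- n.

Lemma phi_I a x : I01 x -> I01 (phi a x).
Proof. by have [_ H] := phiC2 a; move=> Ix; apply: H; exists x. Qed.

Lemma compose_I w x : I01 x -> I01 (phiw w x).
Proof. by move=> Ix; elim: w => //= a w IH; exact: phi_I. Qed.

Lemma derI_phi a x : I01 x -> derI (phi a) x (derivI (phi a) x).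
Proof. by have [[H _ _] _] := phiC2 a; exact: derivable_derI. Qed.

Lemma derI_compose w x : I01 x -> derI (phiw w) x (der w x).
Proof.
elim: w x => [|a w IH] x Ix /=; first exact: derI_id.
by apply: derI_comp (IH x Ix) => *; [exact: compose_I|apply: derI_phi; exact: compose_I].
Qed.

Lemma derivI_compose w x : I01 x -> derivI (phiw w) x = der w x.
Proof. by move=> Ix; apply: derI_derivI => //; exact: derI_compose. Qed.

Lemma der_bounds w x : I01 x ->
  Cl * g1 ^- size w <= `|der w x| <= Cu * g ^- size w.
Proof. by move=> Ix; have := Hder (in_tuple w) Ix; rewrite /= derivI_compose. Qed.

Lemma normder_gt0 w x : I01 x -> 0 < `|der w x|.
Proof.
move=> Ix; have /andP[+ _] := der_bounds w Ix; apply: lt_le_trans.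
have := g_gt1; have := g_lt; move=> *.
by rewrite mulr_gt0// invr_gt0 exprn_gt0//; lra.
Qed.

Lemma der_neq0 w x : I01 x -> der w x != 0.
Proof. by move=> Ix; rewrite -normr_gt0; exact: normder_gt0. Qed.

Lemma expR_theta w x : I01 x -> expR (theta w x) = `|der w x|.
Proof. by move=> Ix; rewrite lnK// posrE normder_gt0. Qed.

Lemma theta_cat w u x : I01 x -> theta (w ++ u) x = theta w (phiw u x) + theta u x.
Proof.
move=> Ix; rewrite /theta der_cat normrM lnM// posrE normder_gt0//.
exact: compose_I.
Qed.

Lemma dphi_neq0 a x : I01 x -> derivI (phi a) x != 0.
Proof. by move=> Ix; have := der_neq0 [:: a] Ix; rewrite /= mulr1. Qed.

Lemma derI_der w x : I01 x -> derI (der w) x (nonlin w x * der w x).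
Proof.
elim: w x => [|a w IH] x Ix /=; first by rewrite mulr1; exact: derI_cst.
have Iy := compose_I w Ix.
have [[_ H _] _] := phiC2 a.
have := derI_mul (derI_comp (@compose_I w) (derivable_derI H Iy) (derI_compose w Ix)) (IH x Ix).
congr derI; rewrite /nonlinearity /=; field; exact: dphi_neq0.
Qed.

Lemma nonlinearity_compose w x : I01 x -> nonlinearity (phiw w) x = nonlin w x.
Proof.
move=> Ix; rewrite /nonlinearity derivI_compose//.
rewrite (@derI_derivI _ _ _ (nonlin w x * der w x))//.
  by rewrite mulfK// der_neq0.
apply: eq_derI (derI_der w Ix) => // y; rewrite inE => Iy.
by rewrite derivI_compose.
Qed.

(** Differentiating half of [ln (der ^ 2)] avoids the absolute value and any discussion of signs. *)
Lemma derI_theta w x : I01 x -> derI (theta w) x (nonlin w x).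
Proof.
move=> Ix.
have p y : I01 y -> 0 < der w y * der w y.
  by move=> Iy; rewrite -expr2 exprn_even_gt0//= der_neq0.
have := derI_comp_is_derive (f := fun y => der w y * der w y)
  (is_derive1_ln (p x Ix)) (derI_mul (derI_der w Ix) (derI_der w Ix)).
move=> /(derI_scale (1/2)).
have -> : 1 / 2 * ((der w x * der w x)^-1 * (nonlin w x * der w x * der w x + der w x * (nonlin
  w x * der w x))) = nonlin w x.
  by field; exact: der_neq0.
apply: eq_derI => // y; rewrite inE => Iy /=.
rewrite /theta -[der w y * _]gtr0_norm ?p//.
by rewrite normrM lnM ?posrE ?normder_gt0//; field.
Qed.

Lemma nonlin_bounded : exists2 M, 0 < M & forall w x, I01 x -> `|nonlin w x| <= M.
Proof.
have [M M0 HM] : exists2 M, 0 < M & forall a x, I01 x -> `|nonlinearity (phi a) x| <= M.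
  have H a : exists2 M, 0 < M & forall x, I01 x -> `|nonlinearity (phi a) x| <= M.
    have [[H1 H2 H3] _] := phiC2 a; apply: contI_bounded.
    apply: contI_mul; first exact: within_contI.
    apply: contI_inv; last by move=> x; exact: dphi_neq0.
    apply: derI_contI => x Ix; exact: derivable_derI Ix.
  pose M a := xget 0 [set m | 0 < m /\ forall x, I01 x -> `|nonlinearity (phi a) x| <= m].
  have HM a : 0 < M a /\ forall x, I01 x -> `|nonlinearity (phi a) x| <= M a.
    by have [m m0 Hm] := H a; rewrite /M; case: xgetP => [y _ //|/(_ m)/not_andP[]].
  exists (1 + \sum_a M a) => [|a x Ix].
    by rewrite ltr_pwDl// sumr_ge0// => a _; have [/ltW] := HM a.
  rewrite (le_trans ((HM a).2 x Ix))// (bigD1 a)//= addrCA lerDl addr_ge0//.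
  by rewrite sumr_ge0// => b _; have [/ltW] := HM b.
have g1' := g_gt1.
have gi : g^-1 < 1 by rewrite invf_lt1//; lra.
have g0 : 0 < g^-1 by rewrite invr_gt0; lra.
exists (M * Cu / (1 - g^-1)); first by rewrite divr_gt0 ?mulr_gt0//; lra.
move=> w x Ix.
(* Partial sums of a geometric series make the bound inductive: a letter put in front of [w] adds at
   most [M * Cu * g ^- size w]. *)
suff H : `|nonlin w x| <= M * Cu / (1 - g^-1) * (1 - g ^- size w).
  apply: le_trans H _; rewrite ler_piMr//; last by rewrite gerBl -exprVn exprn_ge0// ltW.
  by rewrite divr_ge0 ?mulr_ge0//; [exact: ltW|exact: ltW|lra].
elim: w => [|a w IH] /=; first by rewrite expr0 invr1 subrr mulr0 normr0.
apply: le_trans (ler_normD _ _) _; rewrite normrM.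
have -> : M * Cu / (1 - g^-1) * (1 - g ^- (size w).+1) =
  M * (Cu * g ^- size w) + M * Cu / (1 - g^-1) * (1 - g ^- size w).
  by rewrite -!exprVn exprS; field; lra.
rewrite lerD// ler_pM//; first exact/HM/compose_I.
by have /andP[] := der_bounds w Ix.
Qed.

Lemma contI_nonlin w : contI (nonlin w).
Proof.
elim: w => [|a w IH] /=; first exact: contI_cst.
apply: contI_add => //; apply: contI_mul; last first.
  by apply: derI_contI => x; exact: derI_der.
apply: contI_comp; last by move=> x; exact: compose_I.
  have [[H1 H2 H3] _] := phiC2 a.
  apply: contI_mul; first exact: within_contI.
  apply: contI_inv; last by move=> x; exact: dphi_neq0.
  by apply: derI_contI => x Ix; exact: derivable_derI Ix.
by apply: derI_contI => x; exact: derI_compose.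
Qed.

Lemma compose_mvt w x y : I01 x -> I01 y -> exists2 c, I01 c &
  `|phiw w y - phiw w x| = `|der w c| * `|y - x|.
Proof.
move=> Ix Iy; have [c [Ic _ E]] := derI_mvt (@derI_compose w) Ix Iy.
by exists c => //; rewrite E normrM.
Qed.

Lemma theta_lip (M : R) : (forall w x, I01 x -> `|nonlin w x| <= M) ->
  forall w x y, I01 x -> I01 y -> `|theta w y - theta w x| <= M * `|y - x|.
Proof.
move=> HM w x y Ix Iy; have [c [Ic _ ->]] := derI_mvt (@derI_theta w) Ix Iy.
by rewrite normrM ler_wpM2r// HM.
Qed.

(** Since [phi_w'' = nonlin w * der w], the quadratic error is proportional to the size [D] of the
    derivative, with the same constant [M] for all words. *)
Lemma compose_linearization (M D : R) w x y :
  (forall w x, I01 x -> `|nonlin w x| <= M) -> 0 <= M ->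
  (forall x, I01 x -> `|der w x| <= D) -> I01 x -> I01 y ->
  `|phiw w y - phiw w x - der w x * (y - x)| <= M * D * `|y - x| ^+ 2.
Proof.
move=> HM M0 HD Ix Iy.
have [c [Ic cx ->]] := derI_mvt (@derI_compose w) Ix Iy.
have [c' [Ic' _ E]] := derI_mvt (@derI_der w) Ix Ic.
rewrite -mulrBl E !normrM expr2 mulrA ler_wpM2r// ler_pM ?mulr_ge0// ler_pM ?HM ?HD//.
Qed.

(** The mean value point need not lie in [K]. Uniform continuity of the difference of the two
    nonlinearities keeps it above [c1 / 2] within [eta] of [K]. *)
Lemma UNI_phase_separation (K : set R) : K `<=` @I01 R -> UNI phi K -> phase_separation K.
Proof.
move=> KI [c1 [c2 [c10 c20 [N HN]]]]; exists (c1 / 2); first lra.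
exists N => n /HN [a [b Hab]]; exists (val a), (val b).
have [eta eta0 Heta] := I01_unif_cont (proj1 (contIP _)
  (contI_add (@contI_nonlin a) (contI_opp (@contI_nonlin b)))) (e := c1 / 2) ltac:(lra).
exists eta => //; rewrite !size_tuple; split=> // x y Kx Iy yx.
have Ix := KI _ Kx.
have D z : I01 z -> derI (fun z => theta a z + -1 * theta b z) z (nonlin a z + -1 * nonlin b z).
  by move=> Iz; apply: derI_add (derI_theta _ Iz) (derI_scale _ (derI_theta _ Iz)).
have [c [Ic cx E]] := derI_mvt D Ix Iy.
have -> : theta a y - theta b y - (theta a x - theta b x) =
  (nonlin a c + -1 * nonlin b c) * (y - x) by rewrite -E; ring.
rewrite normrM ler_wpM2r//.
have := Heta x c Ix Ic (le_lt_trans cx yx).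
have := Hab x Kx; rewrite !nonlinearity_compose// => /andP[+ _].
rewrite mulN1r; set u := nonlin a c - _; set v := nonlin a x - _ => A1 A2.
have := lerB_dist v u; rewrite distrC => A3; lra.
Qed.

End Words.

(** * Integration against the self-conformal measure *)
Section BoundedMeasurable.
Variables (R : realType) (D : set R).
Implicit Types (f g : R -> R).

(** A class stable under all the operations used below and integrable for every finite measure, so
    that integrability reduces to closure rules. It serves [mu] on [I] as well as Lebesgue measure
    on a window. *)
Definition bmeas g := measurable_fun D g /\ exists M, forall x, D x -> `|g x| <= M.

Lemma bmeas_cst (c : R) : bmeas (fun=> c).
Proof. by split; [exact: measurable_cst|exists `|c|]. Qed.

Lemma bmeas_add f g : bmeas f -> bmeas g -> bmeas (fun x => f x + g x).
Proof.
move=> [mf [a fa]] [mg [b gb]]; split; first exact: measurable_funD.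
by exists (a + b) => x Dx; rewrite (le_trans (ler_normD _ _))// lerD ?fa ?gb.
Qed.

Lemma bmeas_mul f g : bmeas f -> bmeas g -> bmeas (fun x => f x * g x).
Proof.
move=> [mf [a fa]] [mg [b gb]]; split; first exact: measurable_funM.
by exists (a * b) => x Dx; rewrite normrM ler_pM ?fa ?gb.
Qed.

Lemma bmeas_scale (c : R) g : bmeas g -> bmeas (fun x => c * g x).
Proof. by move=> Hg; apply: bmeas_mul => //; exact: bmeas_cst. Qed.

Lemma bmeas_opp g : bmeas g -> bmeas (fun x => - g x).
Proof. by move=> Hg; under eq_fun do rewrite -mulN1r; exact: bmeas_scale. Qed.

Lemma bmeas_sub f g : bmeas f -> bmeas g -> bmeas (fun x => f x - g x).
Proof. by move=> Hf /bmeas_opp; exact: bmeas_add. Qed.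

Lemma bmeas_exp f n : bmeas f -> bmeas (fun x => f x ^+ n).
Proof.
move=> Hf; elim: n => [|n IH]; first exact: bmeas_cst.
by under eq_fun do rewrite exprS; exact: bmeas_mul.
Qed.

Lemma bmeas_sum (T : Type) (s : seq T) (F : T -> R -> R) :
  (forall i, bmeas (F i)) -> bmeas (fun x => \sum_(i <- s) F i x).
Proof.
move=> H; elim: s => [|a s IH].
  by under eq_fun do rewrite big_nil; exact: bmeas_cst.
by under eq_fun do rewrite big_cons; exact: bmeas_add.
Qed.

Lemma bmeas_max f g : bmeas f -> bmeas g -> bmeas (fun x => Num.max (f x) (g x)).
Proof.
move=> [mf [a fa]] [mg [b gb]]; split; first exact: measurable_maxr.
exists (Num.max a b) => x Dx; have := fa x Dx; have := gb x Dx.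
by case: (leP (f x) (g x)) => _ gb' fa'; rewrite le_max ?gb' ?fa' ?orbT.
Qed.

Lemma bmeas_min f g : bmeas f -> bmeas g -> bmeas (fun x => Num.min (f x) (g x)).
Proof.
move=> Hf Hg; under eq_fun do rewrite -[f _]opprK -[g _]opprK -oppr_max.
by apply/bmeas_opp/bmeas_max; exact: bmeas_opp.
Qed.

Lemma bmeas_norm f : bmeas f -> bmeas (fun x => `|f x|).
Proof.
move=> [mf [a fa]]; split; first by apply: measurableT_comp mf; exact: normr_measurable.
by exists a => x Dx; rewrite normr_id fa.
Qed.

Lemma bmeas_cos f : measurable_fun D f -> bmeas (fun x => cos (f x)).
Proof.
move=> mf; split; last by exists 1 => x _; exact: cos_max.
by apply: measurableT_comp mf; apply: continuous_measurable_fun; exact: continuous_cos.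
Qed.

Lemma bmeas_sin f : measurable_fun D f -> bmeas (fun x => sin (f x)).
Proof.
move=> mf; split; last by exists 1 => x _; exact: sin_max.
by apply: measurableT_comp mf; apply: continuous_measurable_fun; exact: continuous_sin.
Qed.

Lemma bmeas_indic (E : set R) : measurable E -> bmeas (\1_E : R -> R).
Proof.
move=> mE; split; first exact: measurable_indic.
by exists 1 => x _; rewrite indicE normr_nat; case: (_ \in _).
Qed.

Variables (m : {measure set R -> \bar R}).
Hypotheses (mD : measurable D) (fD : (m D < +oo)%E).

Lemma bmeas_integrable g : bmeas g -> m.-integrable D (EFin \o g).
Proof.
move=> [mg [M HM]]; apply: measurable_bounded_integrable => //.
by exists M; split; rewrite ?num_real // => y My x Dx /=; apply: le_trans (HM x Dx) _; exact: ltW.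
Qed.

Local Notation J g := (Rintegral m D g).

Lemma intB_add f g : bmeas f -> bmeas g -> J (fun x => f x + g x) = J f + J g.
Proof. by move=> /bmeas_integrable If /bmeas_integrable Ig; exact: RintegralD. Qed.

Lemma intB_sub f g : bmeas f -> bmeas g -> J (fun x => f x - g x) = J f - J g.
Proof. by move=> /bmeas_integrable If /bmeas_integrable Ig; exact: RintegralB. Qed.

Lemma intB_scale (c : R) g : bmeas g -> J (fun x => c * g x) = c * J g.
Proof. by move=> /bmeas_integrable Ig; exact: RintegralZl. Qed.

Lemma intB_sum (T : Type) (s : seq T) (F : T -> R -> R) : (forall i, bmeas (F i)) ->
  J (fun x => \sum_(i <- s) F i x) = \sum_(i <- s) J (F i).
Proof.
move=> H; elim: s => [|a s IH].
  rewrite big_nil; under eq_Rintegral do rewrite big_nil.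
  by rewrite Rintegral_cst// mul0r.
rewrite big_cons; under eq_Rintegral do rewrite big_cons.
by rewrite intB_add ?IH//; exact: bmeas_sum.
Qed.

Lemma intB_le f g : bmeas f -> bmeas g -> (forall x, D x -> f x <= g x) -> J f <= J g.
Proof. by move=> /bmeas_integrable If /bmeas_integrable Ig; exact: le_Rintegral. Qed.

Lemma intB_norm f : bmeas f -> `|J f| <= J (fun x => `|f x|).
Proof. by move=> /bmeas_integrable If; exact: le_normr_Rintegral. Qed.

End BoundedMeasurable.

Section SelfConformal.
Variables (R : realType) (A : finType) (phi : A -> R -> R) (p : A -> R)
  (mu : probability R R).
Hypotheses (p_prob : probability_vector p) (mu_sc : self_conformal phi p mu).
Hypothesis phiI : forall a x, I01 x -> I01 (phi a x).
Hypothesis phi_cont : forall a, contI (phi a).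

Notation I := (@I01 R).
Definition Emu (g : R -> R) : R := \int[mu]_(x in I) g x.

Lemma mu_I01_fin : (mu I < +oo)%E.
Proof. by have [-> _] := mu_sc; rewrite ltry. Qed.

Lemma measurable_I : measurable I.
Proof. exact: measurable_I01. Qed.

Lemma Emu_cst (c : R) : Emu (fun=> c) = c.
Proof.
rewrite /Emu Rintegral_cst; last exact: measurable_I.
by rewrite (congr1 fine (proj1 mu_sc)) mulr1.
Qed.

Lemma bmeas_phi a g : bmeas I g -> bmeas I (g \o phi a).
Proof.
move=> [mg [M HM]]; split; last by exists M => x Ix /=; apply/HM/phiI.
apply: measurable_comp mg _; first exact: measurable_I.
  by move=> _ [x Ix <-]; exact: phiI.
apply: subspace_continuous_measurable_fun; first exact: measurable_I.
exact: contI_within.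
Qed.

(* [self_conformal] pushes forward the restriction of [mu] to [I]; patching
   [phi a] outside [I] turns this into a pushforward by a measurable map of [R]. *)
Definition phi0 (a : A) : R -> R := patch (fun=> 0) I (phi a).

Lemma phi0I a x : I (phi0 a x).
Proof.
rewrite /phi0 /patch; case: ifPn => [/set_mem/phiI //|_].
by apply/I01P; rewrite lexx ler01.
Qed.

Lemma phi0E a x : I x -> phi0 a x = phi a x.
Proof. by move=> Ix; rewrite /phi0 patchT// inE. Qed.

Lemma measurable_phi0 a : measurable_fun setT (phi0 a).
Proof.
apply/(measurable_restrictT _ measurable_I).
apply: subspace_continuous_measurable_fun; first exact: measurable_I.
exact: contI_within.
Qed.

Lemma mu_setC_I01 : mu (~` I) = 0%E.
Proof.
rewrite probability_setC; last exact: measurable_I.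
by rewrite (proj1 mu_sc) subee.
Qed.

Lemma mu_restr (E : set R) : measurable E -> mu (E `&` I) = mu E.
Proof.
move=> mE; apply/esym/(etrans (measureDI mu mE measurable_I)).
apply: etrans (congr2 adde _ erefl) (add0e _).
apply: subset_measure0 mu_setC_I01; [|apply: measurableC; exact: measurable_I|exact: subDsetr].
by apply: measurableD => //; exact: measurable_I.
Qed.

Lemma mu_phi0 (E : set R) : measurable E ->
  mu E = (\sum_(a : A) (p a)%:E * pushforward mu (phi0 a) E)%E.
Proof.
move=> mE; rewrite (proj2 mu_sc)//; apply: eq_bigr => a _; congr (_ * _)%E.
rewrite /pushforward /mrestr -[RHS]mu_restr; last first.
  by rewrite -[X in measurable X]setTI; exact: measurable_phi0.
by congr (mu _); apply/seteqP; split=> x [] /= ? Ix; split=> //;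
  rewrite /preimage/= ?phi0E// -phi0E.
Qed.

Lemma Emu_phi_ge0 (g : R -> R) : measurable_fun I g -> (forall x, I x -> 0 <= g x) ->
  (\int[mu]_(x in I) (g x)%:E = \sum_(a : A) (p a)%:E * \int[mu]_(x in I) (g (phi a x))%:E)%E.
Proof.
move=> mg g0.
(* The letter [a0] is the default value in the enumeration of [A]; an empty alphabet would give the
   weights sum 0 instead of 1. *)
have [a0 _] : exists a : A, True.
  apply: contrapT => /forallNP nA; have := proj2 p_prob.
  rewrite big1 => [/eqP|a _]; first by rewrite eq_sym oner_eq0.
  by case: (nA a).
have pn a : 0 <= p a by have [/(_ a)/andP[/ltW]] := p_prob.
pose e n := nth a0 (enum A) n.
pose pf n : {measure set R -> \bar R} :=
  measure_function_pushforward__canonical__measure_function_Measure mu (measurable_phi0 (e n)).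
pose ms n : {measure set R -> \bar R} := mscale (NngNum (pn (e n))) (pf n).
have sumE (F : A -> \bar R) : (\sum_(n < #|A|) F (e n) = \sum_a F a)%E.
  rewrite -[RHS]big_enum (big_nth a0) -cardE big_mkord.
  by apply: eq_bigr.
transitivity (\int[msum ms #|A|]_(x in I) (g x)%:E)%E.
  apply: eq_measure_integral => E mE _; apply: etrans (mu_phi0 mE) _; rewrite -sumE.
  by apply: eq_bigr.
rewrite ge0_integral_measure_sum; [|exact: measurable_I|by move=> x /g0;
  rewrite lee_fin|exact/measurable_EFinP].
rewrite -[RHS]sumE; apply: eq_bigr => n _.
rewrite ge0_integral_mscale; [|exact: measurable_I|exact/measurable_EFinP|by move=> x /g0;
  rewrite lee_fin].
congr (_ * _)%E; rewrite ge0_integral_pushforward; first last.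
- by move=> x /set_mem/g0; rewrite lee_fin.
- exact/measurable_EFinP.
- exact: measurable_I.
- exact: measurable_phi0.
have -> : phi0 (e n) @^-1` I = setT by apply/seteqP; split=> // x _; exact: phi0I.
(* As [phi0] maps the whole line into [I], the integral now runs over the line; its part outside [I]
   is null. *)
rewrite (ge0_negligible_integral (N := ~` I)); first last.
- exact: mu_setC_I01.
- by move=> x _ /=; rewrite lee_fin; apply/g0/phi0I.
- apply/measurable_EFinP; apply: measurable_comp mg _; first exact: measurable_I.
    by move=> _ [x _ <-]; exact: phi0I.
  exact: measurable_phi0.
- exact: measurableT.
- apply: measurableC; exact: measurable_I.
rewrite setTD setCK; apply: eq_integral => x /set_mem Ix /=.
by rewrite phi0E.
Qed.

Lemma Emu_phi g : bmeas I g -> Emu g = \sum_a p a * Emu (g \o phi a).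
Proof.
move=> Hg; have [mg [M HM]] := Hg.
have mI := measurable_I; have fI := mu_I01_fin.
have E h : bmeas I h -> (forall x, I x -> 0 <= h x) -> Emu h = \sum_a p a * Emu (h \o phi a).
  move=> Hh h0; rewrite /Emu /Rintegral (Emu_phi_ge0 (proj1 Hh) h0).
  rewrite -sum_fine//.
    apply: eq_bigr => a _; rewrite fineM//.
    by apply: integrable_fin_num => //; apply: bmeas_integrable => //; exact: bmeas_phi.
  move=> a _; rewrite fin_numM//.
  by apply: integrable_fin_num => //; apply: bmeas_integrable => //; exact: bmeas_phi.
(* Adding the bound [M] reduces to the nonnegative case; the constant cancels because the weights
   sum to 1. *)
have gM x : I x -> 0 <= g x + M by move=> /HM; rewrite ler_norml; lra.
have := E (fun x => g x + M) (bmeas_add Hg (bmeas_cst _ _)) gM.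
rewrite {1}/Emu intB_add//; last exact: bmeas_cst.
rewrite -!/(Emu _) Emu_cst.
under eq_bigr => a _.
  rewrite {1}/Emu intB_add//; [|exact: bmeas_phi|exact: bmeas_cst].
  rewrite -!/(Emu _) Emu_cst mulrDr; over.
by rewrite big_split/= -mulr_suml (proj2 p_prob) mul1r => /addIr.
Qed.

End SelfConformal.

(** * Stationary families of words and the Frostman bound *)
Section WordWeights.
Variables (R : realType) (A : finType) (p : A -> R).
Hypothesis p_prob : probability_vector p.
Implicit Types (w u : seq A).

Definition pw w : R := \prod_(a <- w) p a.

Lemma pw_cat w u : pw (w ++ u) = pw w * pw u.
Proof. exact: big_cat. Qed.

Lemma pw_gt0 w : 0 < pw w.
Proof. by apply: prodr_gt0 => a _; have [/(_ a)/andP[]] := p_prob. Qed.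

Lemma pw_ge0 w : 0 <= pw w.
Proof. exact/ltW/pw_gt0. Qed.

Fixpoint words n : seq (seq A) :=
  if n is n'.+1 then [seq a :: w | a <- enum A, w <- words n'] else [:: [::]].

Lemma mem_words w n : (w \in words n) = (size w == n).
Proof.
elim: n w => [|n IH] w /=; first by rewrite inE size_eq0.
apply/allpairsP/idP => [[[a u] /= [_ Hu ->]] /=|]; first by rewrite eqSS -IH.
case: w => //= a w; rewrite eqSS -IH => Hw.
by exists (a, w); rewrite mem_enum.
Qed.

Lemma sum_wordsS (V : nmodType) n (F : seq A -> V) :
  \sum_(w <- words n.+1) F w = \sum_a \sum_(w <- words n) F (a :: w).
Proof. by rewrite /= big_allpairs_dep/= big_enum. Qed.

Lemma sum_words_cat (V : nmodType) m n (F : seq A -> V) : \sum_(w <- words (m + n)) F w =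
  \sum_(w <- words m) \sum_(u <- words n) F (w ++ u).
Proof.
elim: m F => [|m IH] F; first by rewrite big_seq1.
by rewrite addSn !sum_wordsS; apply: eq_bigr => a _; rewrite IH.
Qed.

Lemma sum_pw_words n : \sum_(w <- words n) pw w = 1.
Proof.
elim: n => [|n IH]; first by rewrite big_seq1 /pw big_nil.
rewrite sum_wordsS -[RHS](proj2 (p_prob)); apply: eq_bigr => a _.
under eq_bigr => w _ do rewrite /pw big_cons.
by rewrite -mulr_sumr IH mulr1.
Qed.

End WordWeights.

(* [M] bounds the nonlinearity of all words at once, hence the Lipschitz
   constants of all the [theta w] and the error of linearising [compose phi w]. *)
Record regular_ifs (R : realType) (A : finType) (phi : A -> R -> R) (p : A -> R)
    (mu : probability R R) (kap lam Cu Cl M : R) : Prop := RegularIFS {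
  rg_kap0 : 0 < kap;
  rg_kap1 : kap < 1;
  rg_lam0 : 0 < lam;
  rg_lam1 : lam < 1;
  rg_Cu0 : 0 < Cu;
  rg_Cl0 : 0 < Cl;
  rg_M0 : 0 < M;
  rg_I : forall w x, I01 x -> I01 (compose phi w x);
  rg_der : forall w x, I01 x ->
    Cl * lam ^+ size w <= `|der phi w x| <= Cu * kap ^+ size w;
  rg_mvt : forall w x y, I01 x -> I01 y -> exists2 c, I01 c &
    `|compose phi w y - compose phi w x| = `|der phi w c| * `|y - x|;
  rg_theta : forall w x y, I01 x -> I01 y ->
    `|theta phi w y - theta phi w x| <= M * `|y - x|;
  rg_expR : forall w x, I01 x -> expR (theta phi w x) = `|der phi w x|;
  rg_cat : forall w u x, I01 x ->
    theta phi (w ++ u) x = theta phi w (compose phi u x) + theta phi u x;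
  rg_lin : forall w D x y, (forall x, I01 x -> `|der phi w x| <= D) ->
    I01 x -> I01 y ->
    `|compose phi w y - compose phi w x - der phi w x * (y - x)| <= M * D * `|y - x| ^+ 2;
  rg_cont : forall w, contI (compose phi w);
  rg_prob : probability_vector p;
  rg_sc : self_conformal phi p mu }.

Section RegularIFS.
Variables (R : realType) (A : finType) (phi : A -> R -> R) (p : A -> R)
  (mu : probability R R).

Lemma regular_of_contracting : C2_IFS phi -> uniformly_contracting phi ->
  probability_vector p -> self_conformal phi p mu ->
  exists kap lam Cu Cl M, regular_ifs phi p mu kap lam Cu Cl M.
Proof.
move=> C2 [g [g1 [g_gt1 g_lt [Cu [Cl [Cu0 Cl0 H]]]]]] pp sc.
have [M M0 HM] := nonlin_bounded C2 g_gt1 g_lt Cu0 Cl0 H.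
exists g^-1, g1^-1, Cu, Cl, M; split=> //.
- by rewrite invr_gt0; lra.
- by rewrite invf_lt1//; lra.
- by rewrite invr_gt0; lra.
- by rewrite invf_lt1//; lra.
- exact: compose_I.
- by move=> w x Ix; rewrite !exprVn; apply: (der_bounds C2 H).
- exact: (compose_mvt C2).
- exact: (theta_lip C2 g_gt1 g_lt Cl0 H HM).
- by move=> w x Ix; apply: (expR_theta C2 g_gt1 g_lt Cl0 H).
- by move=> w u x Ix; apply: (theta_cat C2 g_gt1 g_lt Cl0 H).
- move=> w D x y HD Ix Iy; apply: (compose_linearization C2 g_gt1 g_lt Cl0 H HM) => //.
  exact: ltW.
- by move=> w; apply: derI_contI => x; exact: derI_compose.
Qed.

Variables (kap lam Cu Cl M : R).
Hypothesis G : regular_ifs phi p mu kap lam Cu Cl M.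

Local Notation I := (@I01 R).
Local Notation phiw := (compose phi).
Local Notation E := (Emu mu).
Implicit Types (w u v : seq A) (W U : seq (seq A)).

Lemma rg_pw_ge0 w : 0 <= pw p w.
Proof. exact: pw_ge0 (rg_prob G) w. Qed.

Lemma contI_measurable (f : R -> R) : contI f -> measurable_fun I f.
Proof.
move=> Hf; apply: subspace_continuous_measurable_fun; first exact: measurable_I.
exact: contI_within.
Qed.

Lemma contI_bmeas (f : R -> R) : contI f -> bmeas I f.
Proof.
move=> Hf; split; first exact: contI_measurable.
by have [m _ Hm] := contI_bounded Hf; exists m.
Qed.

Lemma bmeas_comp w (g : R -> R) : bmeas I g -> bmeas I (g \o phiw w).
Proof.
move=> [mg [m Hm]]; split; last by exists m => x Ix /=; apply/Hm/(rg_I G).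
apply: measurable_comp mg _; first exact: measurable_I.
  by move=> _ [x Ix <-]; exact: (rg_I G).
apply: contI_measurable; exact: (rg_cont G).
Qed.

Lemma E_cst (c : R) : E (fun=> c) = c.
Proof. exact: (Emu_cst (rg_sc G)). Qed.

Lemma E_add f g : bmeas I f -> bmeas I g -> E (fun x => f x + g x) = E f + E g.
Proof. by apply: intB_add; [exact: measurable_I|exact: (mu_I01_fin (rg_sc G))]. Qed.

Lemma E_scale (c : R) f : bmeas I f -> E (fun x => c * f x) = c * E f.
Proof. by apply: intB_scale; [exact: measurable_I|exact: (mu_I01_fin (rg_sc G))]. Qed.

Lemma E_sum (T : Type) (s : seq T) (F : T -> R -> R) : (forall i, bmeas I (F i)) ->
  E (fun x => \sum_(i <- s) F i x) = \sum_(i <- s) E (F i).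
Proof. by apply: intB_sum; [exact: measurable_I|exact: (mu_I01_fin (rg_sc G))]. Qed.

Lemma E_le f g : bmeas I f -> bmeas I g -> (forall x, I x -> f x <= g x) -> E f <= E g.
Proof. by apply: intB_le; [exact: measurable_I|exact: (mu_I01_fin (rg_sc G))]. Qed.

Lemma E_eq f g : (forall x, I x -> f x = g x) -> E f = E g.
Proof. by move=> fg; apply: eq_Rintegral => x; rewrite inE => /fg. Qed.

Lemma E_ge0 f : (forall x, I x -> 0 <= f x) -> 0 <= E f.
Proof. exact: Rintegral_ge0. Qed.

Lemma E_phi (g : R -> R) : bmeas I g -> E g = \sum_a p a * E (g \o phi a).
Proof.
move=> Hg; apply: (Emu_phi (rg_prob G) (rg_sc G)) => // [a x|a].
  exact: (rg_I G [:: a]).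
change (contI (compose phi [:: a])); exact: (rg_cont G).
Qed.

(** The identity [mu = sum p_w phi_w(mu)] over a family of words, for instance those at which a
    random word first meets a stopping rule. It concerns integrals only, so images of different
    words may overlap freely. *)
Definition stationary W := forall g, bmeas I g ->
  E g = \sum_(w <- W) pw p w * E (g \o phiw w).

Lemma stationary_nil : stationary [:: [::]].
Proof. by move=> g Hg; rewrite big_seq1 /pw big_nil mul1r. Qed.

Lemma stationary_rcons w (g : R -> R) : bmeas I g -> pw p w * E (g \o phiw w) =
  \sum_a pw p (rcons w a) * E (g \o phiw (rcons w a)).
Proof.
move=> Hg; rewrite (E_phi (bmeas_comp w Hg)) mulr_sumr; apply: eq_bigr => a _.
rewrite mulrA -cats1 pw_cat [pw p [:: a]]/pw big_seq1; congr (_ * _).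
by apply: E_eq => x _ /=; rewrite compose_cat.
Qed.

Lemma stationary_cat W U : stationary W -> stationary U ->
  stationary [seq w ++ u | w <- W, u <- U].
Proof.
move=> HW HU g Hg; rewrite big_allpairs_dep/= HW//; apply: eq_bigr => w _.
rewrite (HU _ (bmeas_comp w Hg)) mulr_sumr; apply: eq_bigr => u _.
rewrite mulrA pw_cat; congr (_ * _).
by apply: E_eq => x _ /=; rewrite compose_cat.
Qed.

Lemma stationary_words n : stationary (words A n).
Proof.
elim: n => [|n IH] /=; first exact: stationary_nil.
have -> : [seq a :: w | a <- enum A, w <- words A n] =
    [seq w ++ u | w <- [seq [:: a] | a <- enum A], u <- words A n].
  by rewrite allpairs_mapl.
apply: stationary_cat IH => g Hg; rewrite big_map big_enum/= E_phi//.
by apply: eq_bigr => a _; rewrite /pw big_seq1.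
Qed.

Lemma stationary_sum1 W : stationary W -> \sum_(w <- W) pw p w = 1.
Proof.
move=> HW; rewrite -[RHS](E_cst 1) HW; last exact: bmeas_cst.
by apply: eq_bigr => w _; rewrite (E_cst 1) mulr1.
Qed.

Lemma normder_le w x : I x -> `|der phi w x| <= Cu * kap ^+ size w.
Proof. by move=> Ix; have /andP[] := rg_der G w Ix. Qed.

Lemma compose_dist w x y (D : R) : (forall z, I z -> `|der phi w z| <= D) ->
  I x -> I y -> `|phiw w y - phiw w x| <= D * `|y - x|.
Proof.
move=> HD Ix Iy; have [c Ic ->] := rg_mvt G w Ix Iy.
by rewrite ler_wpM2r// HD.
Qed.

Lemma I01_dist x y : I x -> I y -> `|y - x| <= 1.
Proof. by move=> /I01P ? /I01P ?; rewrite ler_norml; lra. Qed.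

(** Bounded distortion with one constant for all words: [theta w] varies by at most [M] over an
    interval of length 1. *)
Lemma der_distortion w x y : I x -> I y ->
  `|der phi w y| <= expR M * `|der phi w x|.
Proof.
move=> Ix Iy; rewrite -!(rg_expR G)// -expRD ler_expR -lerBlDr.
apply: le_trans (ler_norm _) _; apply: le_trans (rg_theta G w Ix Iy) _.
by rewrite ler_piMr ?I01_dist// ltW// (rg_M0 G).
Qed.

Lemma I01_0 : I 0.
Proof. by apply/I01P; rewrite lexx ler01. Qed.

Lemma der_rcons w a x : der phi (rcons w a) x = der phi w (phi a x) * der phi [:: a] x.
Proof. by rewrite -cats1 der_cat. Qed.

(** [Cl * lam] is the least contraction of the last letter; one factor [expR (- M)] comes from the
    stopping threshold, the other from the distortion between 0 and the point considered. *)
Definition cut_const := Cl * lam * expR (- (2 * M)).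

Lemma exists_small_pow (k c : R) : 0 <= k < 1 -> 0 < c -> exists n, k ^+ n < c.
Proof.
move=> /andP[k0 k1] c0.
have /cvgrPdist_lt/(_ c c0) : (fun n => k ^+ n) @ \oo --> (0 : R).
  by apply: cvg_expr; rewrite ger0_norm.
by move=> [n _ /(_ n)/= /(_ (leqnn _))]; rewrite sub0r normrN ger0_norm ?exprn_ge0//; exists n.
Qed.

(* Extend a word as long as its derivative at 0 exceeds [r * expR (- M)]; by
   bounded distortion the last letter costs at most a constant factor. *)
Lemma cut_set (r : R) : 0 < r < 1 -> exists2 W, stationary W &
  forall v x, v \in W -> I x -> cut_const * r <= `|der phi v x| <= r.
Proof.
move=> /andP[r0 r1]; have M0 := rg_M0 G.
pose big v := r * expR (- M) < `|der phi v 0|.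
(* After [n] rounds the words still to be extended have length exactly [n], so the procedure ends
   once [Cu * kap ^+ n] is below the threshold. *)
have step n : exists2 W, stationary W & forall v, v \in W ->
    (big v /\ size v = n) \/ (~~ big v /\ forall x, I x -> cut_const * r <= `|der phi v x| <= r).
  elim: n => [|n [W HW Wsmall]].
    exists [:: [::]]; first exact: stationary_nil.
    move=> v; rewrite inE => /eqP ->; left; split=> //.
    rewrite /big /= normr1 -[ltRHS]mulr1 ltr_pM ?expR_ge0 ?ltW// expR_lt1; lra.
  exists (flatten [seq (if big v then [seq rcons v a | a <- enum A] else [:: v]) | v <- W]).
    move=> g Hg; rewrite big_flatten/= big_map HW//; apply: eq_bigr => v _.
    case: ifP => _; last by rewrite big_seq1.
    by rewrite big_map big_enum/= stationary_rcons.
  move=> v /flatten_mapP[v0 v0W]; case: ifP => [bv0|nb]; last first.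
    rewrite inE => /eqP ->; have [[bv0 _]|] := Wsmall _ v0W; last by right.
    by rewrite bv0 in nb.
  move=> /mapP[a _ ->].
  have [bv|nbv] := boolP (big (rcons v0 a)).
    have [[_ <-]|[]] := Wsmall _ v0W; first by left; rewrite size_rcons.
    by rewrite bv0.
  right; split=> // x Ix; apply/andP; split; last first.
    apply: le_trans (der_distortion _ I01_0 Ix) _.
    rewrite -leNgt in nbv; rewrite mulrC -ler_pdivlMr ?expR_gt0//.
    by rewrite -expRN.
  rewrite der_rcons normrM.
  have Iax : I (phi a x) by exact: (rg_I G [:: a]).
  have /andP[h1 _] := rg_der G [:: a] Ix.
  have h2 := der_distortion v0 Iax I01_0.
  rewrite /big in bv0.
  have h3 : expR (- M) * (r * expR (- M)) <= `|der phi v0 (phi a x)|.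
    rewrite -[leRHS]mul1r -{1}[1](expR0 R) -(subrr M) addrC expRD -mulrA.
    by rewrite ler_wpM2l ?expR_ge0// ltW// (lt_le_trans bv0).
  rewrite (_ : cut_const * r = (expR (- M) * (r * expR (- M))) * (Cl * lam)).
    apply: ler_pM => //; first by rewrite !mulr_ge0 ?expR_ge0// ltW.
    by rewrite mulr_ge0// ltW ?(rg_Cl0 G) ?(rg_lam0 G).
  rewrite /cut_const; have -> : - (2 * M) = - M + - M by ring.
  by rewrite expRD; ring.
have [n Hn] := @exists_small_pow kap (r * expR (- M) / Cu)
  ltac:(by rewrite (rg_kap1 G) ltW ?(rg_kap0 G))
  ltac:(by rewrite divr_gt0 ?(rg_Cu0 G)// mulr_gt0// expR_gt0).
have [W HW Hs] := step n; exists W => // v x vW Ix.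
have [[bv sv]|[_]] := Hs v vW; last exact.
move: bv; rewrite /big ltNge => /negP[]; apply: le_trans (normder_le _ I01_0) _.
by rewrite sv mulrC -ler_pdivlMr ?(rg_Cu0 G)// ltW.
Qed.

Lemma sum_drop (T : eqType) (s : seq T) (q F : T -> R) (a : T) (c : R) :
  (forall b, 0 <= q b) -> 0 <= c -> a \in s -> (forall b, b \in s -> F b <= c) -> F a <= 0 ->
  \sum_(w <- s) q w * F w <= (\sum_(w <- s) q w - q a) * c.
Proof.
move=> q0 c0 ain Fc Fa; rewrite !(big_rem a ain)/= addrAC subrr add0r.
rewrite -[leRHS]add0r; apply: lerD; first exact: mulr_ge0_le0.
rewrite mulr_suml big_seq [leRHS]big_seq ler_sum// => w /mem_rem wi.
by rewrite ler_wpM2l// Fc.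
Qed.

Variable K : set R.
Hypotheses (K_attr : attractor phi K) (K_nontriv : ~ exists x : R, K = [set x]).

Lemma attractor_I k : K k -> I k.
Proof. by have [KI _ _ _] := K_attr; exact: KI. Qed.

Lemma attractor_compose w k : K k -> K (phiw w k).
Proof.
move=> Kk; elim: w => //= a w IH; have [_ _ _ ->] := K_attr.
by exists a => //; exists (phiw w k).
Qed.

Lemma attractor_word n k : K k -> exists w, size w = n /\ exists2 k', K k' & k = phiw w k'.
Proof.
elim: n k => [|n IH] k Kk; first by exists [::]; split=> //; exists k.
have := Kk; have [_ _ _ {1}->] := K_attr => -[a _ [k1 Kk1 <-]].
have [w [<- [k' Kk' ->]]] := IH _ Kk1.
by exists (a :: w); split=> //; exists k'.
Qed.

Lemma attractor_two : exists k0 k1, [/\ K k0, K k1 & k0 != k1].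
Proof.
have [_ [k0 Kk0] _ _] := K_attr.
apply: contrapT => H; apply: K_nontriv; exists k0; apply/seteqP; split=> [k1 Kk1|_ -> //].
by apply/eqP/negPn/negP => k01; apply: H; exists k1, k0.
Qed.

(** Two points of [K] are coded by words so long that each cylinder has diameter below a quarter of
    their distance; half of the distance then remains between the cylinders. *)
Lemma two_cylinders : exists m a0 a1 d, [/\ size a0 = m, size a1 = m, 0 < d < 1,
  Cu * kap ^+ m < 1 & forall x y, I x -> I y -> d <= `|phiw a0 x - phiw a1 y| ].
Proof.
have [k0 [k1 [Kk0 Kk1 k01]]] := attractor_two.
have d0 : 0 < `|k0 - k1| by rewrite normr_gt0 subr_eq0.
have d1 := I01_dist (attractor_I Kk1) (attractor_I Kk0).
have [m Hm] := @exists_small_pow kap (`|k0 - k1| / 4 / Cu)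
  ltac:(by rewrite (rg_kap1 G) ltW ?(rg_kap0 G)) ltac:(by rewrite !divr_gt0 ?(rg_Cu0 G)).
rewrite ltr_pdivlMr ?(rg_Cu0 G)// mulrC in Hm.
have [a0 [sa0 [l0 Kl0 E0]]] := attractor_word m Kk0.
have [a1 [sa1 [l1 Kl1 E1]]] := attractor_word m Kk1.
exists m, a0, a1, (`|k0 - k1| / 2); split=> //; [lra|lra|].
move=> x y Ix Iy.
have A0 := compose_dist (fun z => normder_le a0 (x := z)) Ix (attractor_I Kl0).
have A1 := compose_dist (fun z => normder_le a1 (x := z)) (attractor_I Kl1) Iy.
rewrite -E0 sa0 in A0; rewrite -E1 sa1 in A1.
have c0 : 0 <= Cu * kap ^+ m by rewrite mulr_ge0 ?exprn_ge0 ?ltW ?(rg_Cu0 G) ?(rg_kap0 G).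
have B0 := le_trans A0 (ler_piMr c0 (I01_dist Ix (attractor_I Kl0))).
have B1 := le_trans A1 (ler_piMr c0 (I01_dist (attractor_I Kl1) Iy)).
have D : k0 - k1 = (k0 - phiw a0 x) + (phiw a0 x - phiw a1 y) + (phiw a1 y - k1) by ring.
have := ler_normD ((k0 - phiw a0 x) + (phiw a0 x - phiw a1 y)) (phiw a1 y - k1).
have := ler_normD (k0 - phiw a0 x) (phiw a0 x - phiw a1 y).
by rewrite -D; lra.
Qed.

Definition cball (x d : R) : set R := `[x - d, x + d]%classic.

Lemma cballE x d y : cball x d y <-> `|y - x| <= d.
Proof. by rewrite /cball /= in_itv/= ler_norml; split=> /andP[? ?]; apply/andP; split; lra. Qed.

Lemma bmeas_cball x d : bmeas I (\1_(cball x d) : R -> R).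
Proof. by apply: bmeas_indic; exact: measurable_itv. Qed.

Lemma E_cball_le1 x d : E (\1_(cball x d) : R -> R) <= 1.
Proof.
rewrite -[leRHS](E_cst 1); apply: E_le => [||y _]; [exact: bmeas_cball|exact: bmeas_cst|].
by rewrite indicE lern1 leq_b1.
Qed.

(* Two cylinders of the same level are at a positive distance, so a small ball
   misses one of them: each change of scale costs a factor [1 - pm]. *)
Lemma frostman_pow : exists d0 q pm, [/\ 0 < d0 < 1, 0 < q < 1, 0 < pm < 1 &
  forall k x, E (\1_(cball x (d0 * q ^+ k)) : R -> R) <= (1 - pm) ^+ k].
Proof.
have [m [a0 [a1 [d [sa0 sa1 /andP[d_gt0 d_lt1] Cm sep]]]]] := two_cylinders.
pose c := Cl * lam ^+ m.
have c0 : 0 < c by rewrite mulr_gt0 ?exprn_gt0 ?(rg_Cl0 G) ?(rg_lam0 G).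
have c1 : c < 1.
  have /andP[c1 c2] := rg_der G a0 I01_0; move: c1 c2; rewrite sa0 -/c; lra.
pose pm := Num.min (Num.min (pw p a0) (pw p a1)) (1 / 2).
have pm_gt0 : 0 < pm by rewrite !lt_min !(pw_gt0 (rg_prob G)); lra.
have pm_h : pm <= 1 / 2 by rewrite /pm ge_min lexx orbT.
exists (d / 4), (c / 2), pm; split; [lra|lra|lra|].
elim=> [|k IH] x; first by rewrite expr0; exact: E_cball_le1.
set r := d / 4 * _ ^+ k.+1.
have qk : (c / 2) ^+ k <= 1 by rewrite exprn_ile1//; lra.
have qk0 : 0 < (c / 2) ^+ k by rewrite exprn_gt0//; lra.
have r_le : r <= d / 4.
  rewrite /r exprS; have : c / 2 * (c / 2) ^+ k <= 1 by rewrite mulr_ile1//; lra.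
  by nra.
have pb w : E (\1_(cball x r) \o phiw w : R -> R) <= 1.
  rewrite -[leRHS](E_cst 1); apply: E_le => [||y _];
    [exact/bmeas_comp/bmeas_cball|exact: bmeas_cst|].
  by rewrite /= indicE lern1 leq_b1.
(* If the ball of radius [r] meets the image of [w], its preimage lies within [2 * r / c] of a point
   [y] of [I]. By the choice [q = c / 2] this is exactly the previous scale. *)
have Fw w : w \in words A m -> E (\1_(cball x r) \o phiw w : R -> R) <= (1 - pm) ^+ k.
  rewrite mem_words => /eqP sw.
  have [[y Iy /cballE By]|no] := pselect (exists2 y, I y & cball x r (phiw w y)).
    apply: le_trans (IH y); apply: E_le => [||z Iz];
      [exact/bmeas_comp/bmeas_cball|exact: bmeas_cball|].
    rewrite /= !indicE ler_nat; case: (boolP (_ \in cball x r)) => // /set_mem/cballE Bz.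
    rewrite mem_set//; apply/cballE.
    have [e Ie He] := rg_mvt G w Iy Iz.
    have /andP[+ _] := rg_der G w Ie; rewrite sw -/c => ce.
    have := ler_distD x (phiw w z) (phiw w y).
    rewrite [`|x - _|]distrC He => T.
    have T2 : `|der phi w e| * `|z - y| <= 2 * r by lra.
    have T3 : c * `|z - y| <= 2 * r by apply: le_trans T2; rewrite ler_wpM2r.
    move: T3; rewrite /r exprS => T3; rewrite -(ler_pM2l c0); apply: le_trans T3 _.
    by rewrite le_eqVlt; apply/orP; left; apply/eqP; field.
  rewrite -[leRHS](E_cst ((1 - pm) ^+ k)).
  apply: E_le => [||z Iz]; [exact/bmeas_comp/bmeas_cball|exact: bmeas_cst|].
  rewrite /= indicE memNset ?exprn_ge0//; first lra.
  by move=> Bz; apply: no; exists z.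
have [a [sa Fa pa]] : exists a, [/\ size a = m, E (\1_(cball x r) \o phiw a : R ->
  R) <= 0 & pm <= pw p a].
  have Z a : ~ (exists2 y, I y & cball x r (phiw a y)) -> E (\1_(cball x r) \o phiw a : R ->
    R) <= 0.
    move=> no; rewrite -[leRHS](E_cst 0).
    apply: E_le => [||z Iz]; [exact/bmeas_comp/bmeas_cball|exact: bmeas_cst|].
    by rewrite /= indicE memNset// => Bz; apply: no; exists z.
  have [[y Iy /cballE By]|no] := pselect (exists2 y, I y & cball x r (phiw a0 y)); last first.
    by exists a0; split=> //; [exact: Z|rewrite /pm !ge_min lexx].
  exists a1; split=> //; last by rewrite /pm !ge_min lexx orbT.
  apply: Z => -[z Iz /cballE Bz]; have := sep y z Iy Iz.
  have := ler_distD x (phiw a0 y) (phiw a1 z); rewrite [`|x - _|]distrC; lra.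
rewrite (stationary_words m (bmeas_cball _ _)).
apply: le_trans (sum_drop (c := (1 - pm) ^+ k) rg_pw_ge0 _ _ Fw Fa) _.
- by rewrite exprn_ge0//; lra.
- by rewrite mem_words sa.
rewrite (sum_pw_words (rg_prob G)) exprS ler_wpM2r ?exprn_ge0//; lra.
Qed.

(** The exponent is [ln (1 - pm) / ln q]. Radii are written [expR (- L)] because all later errors
    are exponentials in [L]. *)
Lemma frostman : exists2 s, 0 < s & exists2 C, 0 < C & forall x L,
  E (\1_(cball x (expR (- L))) : R -> R) <= C * expR (- (s * L)).
Proof.
have [d0 [q [pm [/andP[d00 d01] /andP[q0 q1] /andP[p0 p1] H]]]] := frostman_pow.
pose l := - ln q; pose t := - ln (1 - pm).
have l0 : 0 < l by rewrite oppr_gt0 ln_lt0// q0.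
have t0 : 0 < t by rewrite oppr_gt0 ln_lt0//; lra.
exists (t / l); first exact: divr_gt0.
exists (expR (t - t / l * ln d0)); first exact: expR_gt0.
move=> x L; rewrite -expRD.
have [Lneg|Lpos] := ltP (L + ln d0) 0.
  apply: le_trans (E_cball_le1 _ _) _; rewrite -[X in X <= _]expR0 ler_expR.
  have := mulr_gt0 (divr_gt0 t0 l0) (_ : 0 < - (L + ln d0)); rewrite oppr_gt0 => /(_ Lneg).
  lra.
pose k := Num.truncn ((L + ln d0) / l).
have k1 : k%:R <= (L + ln d0) / l by rewrite truncn_le// divr_ge0// ltW.
have k2 : (L + ln d0) / l < k%:R + 1 by rewrite natr1 truncnS_gt.
have -> : expR (t - t / l * ln d0 + - (t / l * L)) = expR (- (t * ((L + ln d0) / l - 1))).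
  by congr expR; field; rewrite gt_eqF.
apply: (@le_trans _ _ (E (\1_(cball x (d0 * q ^+ k)) : R -> R))).
  apply: E_le => [||y _]; [exact: bmeas_cball|exact: bmeas_cball|].
  rewrite !indicE ler_nat; case: (boolP (_ \in cball x (expR _))) => // /set_mem/cballE By.
  rewrite mem_set//; apply/cballE; apply: le_trans By _.
  have -> : d0 * q ^+ k = expR (ln d0 - k%:R * l).
    rewrite expRD lnK ?posrE// -mulrN opprK expRM_natl lnK ?posrE//.
  rewrite ler_expR; move: k1; rewrite ler_pdivlMr//; lra.
apply: le_trans (H k x) _.
have -> : (1 - pm) ^+ k = expR (- (k%:R * t)).
  by rewrite -mulrN opprK expRM_natl lnK// posrE; lra.
rewrite ler_expR lerN2 mulrC ler_wpM2r ?ltW//; lra.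
Qed.

End RegularIFS.

(** * Cancellation of phases *)
Section ComplexExponential.
Variable R : realType.
Implicit Types (s t x y P Q : R) (z g h : R[i]).

Local Notation nc := (@Normc.normc R).

Lemma le_of_sqr x y : 0 <= y -> x ^+ 2 <= y ^+ 2 -> x <= y.
Proof. by move=> y0 xy; case: leP => // yx; nra. Qed.

Lemma sqr_normc z : nc z ^+ 2 = complex.Re z ^+ 2 + complex.Im z ^+ 2.
Proof. by case: z => a b /=; rewrite sqr_sqrtr// addr_ge0// sqr_ge0. Qed.

Lemma normc_ge0 z : 0 <= nc z.
Proof. by case: z => a b /=; exact: sqrtr_ge0. Qed.

Lemma normc_dist z h : nc (z - h) = nc (h - z).
Proof. by rewrite -normcN opprB. Qed.

Lemma normcB_le z h : nc (z - h) <= nc z + nc h.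
Proof. by rewrite (le_trans (le_normcD _ _))// normcN. Qed.

Lemma normc_split z h : nc z <= nc h + nc (z - h).
Proof. by rewrite -{1}[z](subrK h) addrC le_normcD. Qed.

Lemma normc_real x : nc x%:C = `|x|.
Proof. by rewrite /= expr0n/= addr0 sqrtr_sqr. Qed.

Lemma normc_sum (T : Type) (r : seq T) (F : T -> R[i]) :
  nc (\sum_(i <- r) F i) <= \sum_(i <- r) nc (F i).
Proof.
elim: r => [|a r IH]; first by rewrite !big_nil /= !expr0n/= addr0 sqrtr0.
by rewrite !big_cons (le_trans (le_normcD _ _))// lerD2l.
Qed.

Lemma expi0 : expi (0 : R) = 1.
Proof. by rewrite /expi cos0 sin0. Qed.

Lemma expiD s t : expi (s + t) = expi s * expi t.
Proof. by rewrite /expi cosD sinD; apply/eqP; rewrite eq_complex/=; apply/andP; split;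
  apply/eqP; ring. Qed.

Lemma normc_expi t : nc (expi t) = 1.
Proof. by rewrite /expi /= cos2Dsin2 sqrtr1. Qed.

Lemma sin_mvt x : exists2 c, `|c| <= `|x| & sin x = cos c * x.
Proof.
have H (a b : R) : a <= b -> exists2 c, a <= c <= b & sin b - sin a = cos c * (b - a).
  move=> ab; have [|c cab ->] := @MVT_segment R sin cos a b ab (fun y _ => is_derive_sin y).
    by apply: continuous_subspaceT => y; exact: continuous_sin.
  by exists c => //; move: cab; rewrite in_itv.
have [x0|x0] := leP 0 x.
  have [c c1 E] := H 0 x x0; exists c; last by move: E; rewrite sin0 !subr0.
  by rewrite !ger0_norm//; lra.
have [c c1 E] := H x 0 (ltW x0); exists c; last by move: E;
  rewrite sin0 !sub0r mulrN => /oppr_inj.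
by rewrite !ler0_norm//; lra.
Qed.

Lemma sin_le x : `|sin x| <= `|x|.
Proof.
have [c _ ->] := sin_mvt x; rewrite normrM ler_piMl//.
by rewrite cos_max.
Qed.

Lemma cos_half x : 1 - cos x = 2 * sin (x / 2) ^+ 2.
Proof.
have -> : cos x = cos ((x / 2) *+ 2) by congr cos; rewrite mulr2n; field.
by rewrite cos_mulr2n cos2sin2; ring.
Qed.

Lemma cos_ge x : 1 - x ^+ 2 / 2 <= cos x.
Proof.
have := cos_half x.
have : sin (x / 2) ^+ 2 <= (x / 2) ^+ 2.
  by rewrite -[leLHS]real_normK ?num_real// -[leRHS]real_normK ?num_real// lerXn2r ?nnegrE//
    sin_le.
by rewrite expr_div_n; lra.
Qed.

Lemma sin_ge x : `|x| <= 1 -> `|x| / 2 <= `|sin x|.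
Proof.
move=> x1; have [c cx ->] := sin_mvt x; rewrite normrM mulrC ler_wpM2r//.
apply: le_trans (ler_norm _); have := cos_ge c.
have : c ^+ 2 <= 1 by rewrite -real_normK ?num_real// expr_le1// (le_trans cx).
lra.
Qed.

Lemma normc_expiB s t : nc (expi s - expi t) = 2 * `|sin ((s - t) / 2)|.
Proof.
apply/eqP; rewrite -(@eqrXn2 _ 2)//; last exact: normc_ge0.
rewrite sqr_normc /= exprMn real_normK ?num_real//.
have := cos_half (s - t); have := cos2Dsin2 s; have := cos2Dsin2 t; rewrite cosB.
by move=> A B C; apply/eqP; lra.
Qed.

Lemma normc_expiB_le s t : nc (expi s - expi t) <= `|s - t|.
Proof.
rewrite normc_expiB; have := sin_le ((s - t) / 2).
by rewrite normrM [`|2^-1|]gtr0_norm//; lra.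
Qed.

Lemma normc_expiB_ge s t : `|s - t| <= 1 -> `|s - t| / 2 <= nc (expi s - expi t).
Proof.
move=> st; rewrite normc_expiB; have := @sin_ge ((s - t) / 2).
by rewrite normrM [`|2^-1|]gtr0_norm// => /(_ ltac:(lra)); lra.
Qed.

(** The square of the left side equals [P (P + Q) |g|^2 + Q (P + Q) |h|^2 - P Q |g - h|^2]; the root
    is taken with the help of [min P Q * (P + Q) <= 2 P Q]. *)
Lemma normc_combination P Q g h : 0 <= P -> 0 <= Q -> nc g <= 1 -> nc h <= 1 ->
  nc (P%:C * g + Q%:C * h) <= P + Q - Num.min P Q * nc (g - h) ^+ 2 / 4.
Proof.
move=> P0 Q0 g1 h1.
have g2 : nc g ^+ 2 <= 1 by rewrite expr_le1// normc_ge0.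
have h2 : nc h ^+ 2 <= 1 by rewrite expr_le1// normc_ge0.
have n2 : nc (g - h) ^+ 2 <= 4.
  have := normcB_le g h => n1; have n0 := normc_ge0 (g - h).
  have : nc (g - h) <= 2 by lra.
  by move=> n3; nra.
have n0 : 0 <= nc (g - h) ^+ 2 by exact: sqr_ge0.
have E : nc (P%:C * g + Q%:C * h) ^+ 2 <= (P + Q) ^+ 2 - P * Q * nc (g - h) ^+ 2.
  move: g2 h2; rewrite !sqr_normc; case: g h {g1 h1 n2 n0} => [a b] [c d] /=.
  move=> g2 h2; rewrite !mul0r !subr0 !addr0.
  have -> : (P * a + Q * c) ^+ 2 + (P * b + Q * d) ^+ 2 =
    (P * (P + Q)) * (a ^+ 2 + b ^+ 2) + (Q * (P + Q)) * (c ^+ 2 + d ^+ 2)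
    - P * Q * ((a - c) ^+ 2 + (b - d) ^+ 2) by ring.
  rewrite lerB// [leRHS](_ : _ = P * (P + Q) + Q * (P + Q)); last by ring.
  by rewrite lerD// ler_piMr// mulr_ge0// addr_ge0.
set m := Num.min P Q.
have [m0 mP mQ] : [/\ 0 <= m, m <= P & m <= Q] by rewrite le_min P0 Q0 !ge_min !lexx orbT.
have mm : m * (P + Q) <= 2 * (P * Q) by rewrite /m; case: (leP P Q) => ?; nra.
move: E n2 n0; set n := nc (g - h) ^+ 2; set r := nc (_ + _) => E n2 n0.
have r0 : 0 <= r by exact: normc_ge0.
have q0 : 0 <= P + Q - m * n / 4 by nra.
apply: le_of_sqr => //; apply: le_trans E _.
have : 0 <= (m * n / 4) ^+ 2 by exact: sqr_ge0.
have := ler_wpM2r n0 mm; nra.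
Qed.

(** An upper bound for the exponential obtained from [1 + x <= expR x] at [x = - t / 2], squared and
    inverted. *)
Lemma expR_le_1D3x t : 0 <= t <= 1 -> expR t <= 1 + 3 * t.
Proof.
move=> /andP[t0 t1].
have h : (1 - t / 2) ^+ 2 <= expR (- t).
  have -> : - t = 2%:R * - (t / 2) by field.
  rewrite expRM_natl lerXn2r ?nnegrE ?expR_ge0//; first lra.
  by have := expR_ge1Dx (- (t / 2)).
have e0 := expR_gt0 t.
have e1 : expR t * expR (- t) = 1 by rewrite -expRD subrr expR0.
have h1 : expR t * (1 - t / 2) ^+ 2 <= 1 by rewrite -[leRHS]e1 ler_pM2l.
have h2 : 1 <= (1 + 3 * t) * (1 - t / 2) ^+ 2.
  have -> : (1 + 3 * t) * (1 - t / 2) ^+ 2 = 1 + t * ((1 - t) * (8 - 3 * t) / 4) by field.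
  by rewrite lerDl mulr_ge0// divr_ge0// mulr_ge0; lra.
have h3 : 0 < (1 - t / 2) ^+ 2 by rewrite exprn_gt0//; lra.
by rewrite -(ler_pM2r h3); exact: le_trans h2.
Qed.

(** One more term in Cauchy-Schwarz. It is isolated because [average_sqr_gain] singles out one word
    and gives it the factor [1 - d]. *)
Lemma cauchy_cons (q c h b X Y : R) : 0 <= q -> 0 <= X -> 0 <= Y -> b ^+ 2 <= X * Y ->
  (q * c * h + b) ^+ 2 <= (q * c ^+ 2 + X) * (q * h ^+ 2 + Y).
Proof.
move=> q0 X0 Y0 IH.
have K : 2 * (c * h * b) <= c ^+ 2 * Y + h ^+ 2 * X.
  have Z0 : 0 <= c ^+ 2 * Y + h ^+ 2 * X by rewrite addr_ge0// mulr_ge0// sqr_ge0.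
  apply: le_of_sqr => //.
  apply: (@le_trans _ _ (4 * (c ^+ 2 * h ^+ 2 * (X * Y)))).
    have -> : (2 * (c * h * b)) ^+ 2 = 4 * (c ^+ 2 * h ^+ 2 * b ^+ 2) by ring.
    by rewrite ler_wpM2l// ler_wpM2l// mulr_ge0// sqr_ge0.
  have := sqr_ge0 (c ^+ 2 * Y - h ^+ 2 * X); lra.
have := ler_wpM2l q0 K; lra.
Qed.

Lemma weighted_cauchy (T : Type) (r : seq T) (q c h : T -> R) : (forall i, 0 <= q i) ->
  (\sum_(i <- r) q i * c i * h i) ^+ 2 <=
  (\sum_(i <- r) q i * c i ^+ 2) * (\sum_(i <- r) q i * h i ^+ 2).
Proof.
move=> q0; elim: r => [|a r IH]; first by rewrite !big_nil expr0n/= mulr0.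
by rewrite !big_cons; apply: cauchy_cons => //; apply: sumr_ge0 => i _;
  rewrite mulr_ge0// sqr_ge0.
Qed.

Lemma weighted_jensen (T : Type) (r : seq T) (q h : T -> R) : (forall i, 0 <= q i) ->
  \sum_(i <- r) q i = 1 ->
  (\sum_(i <- r) q i * h i) ^+ 2 <= \sum_(i <- r) q i * h i ^+ 2.
Proof.
move=> q0 q1; have := weighted_cauchy r (fun=> 1) h q0.
under eq_bigr do rewrite mulr1.
under [X in _ <= X * _ -> _]eq_bigr do rewrite expr1n mulr1.
by rewrite q1 mul1r.
Qed.

(** Log-Lipschitz control of a truncated majorant [S - d * c * M]: [t] bounds the logarithmic
    variation of [S] and [M], and [u] the variation of the cutoff [c]. As [d <= 1 / 2], at least
    half of [S] survives, which turns the variation of the removed part into a relative error. *)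
Lemma loglip_truncation (S1 S2 M1 M2 c1 c2 t u d : R) : 0 <= t -> 0 <= u ->
  0 <= d <= 1 / 2 -> 0 <= M1 <= S1 -> 0 <= M2 -> 0 <= c1 <= 1 -> 0 <= c2 ->
  S2 <= expR t * S1 -> expR (- t) * M1 <= M2 -> c1 - u <= c2 ->
  S2 - d * c2 * M2 <= expR (t + 4 * d * t + 2 * d * u) * (S1 - d * c1 * M1).
Proof.
move=> t0 u0 /andP[d0 dh] /andP[M10 M1S] M20 /andP[c10 c11] c20 hS hM hc.
have e0 := expR_gt0 t; have ei0 := expR_gt0 (- t).
have eei : expR t * expR (- t) = 1 by rewrite -expRD subrr expR0.
have ei1 : expR (- t) <= 1 by rewrite -[leRHS]expR0 ler_expR; lra.
have ei2 : 1 - 2 * t <= expR (- t) ^+ 2.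
  by rewrite -expRM_natl; have := expR_ge1Dx (2 * - t); lra.
set e := expR t in hS e0 eei *; set ei := expR (- t) in hM ei0 eei ei1 ei2 *.
have A1 : (c1 - u) * M1 * ei <= c2 * M2.
  have [neg|pos] := leP (c1 - u) 0.
    rewrite (@le_trans _ _ 0)//; last exact: mulr_ge0.
    by rewrite -mulrA mulr_le0_ge0// mulr_ge0// ltW.
  by rewrite -mulrA ler_pM//; [exact: ltW|rewrite mulr_ge0// ltW|rewrite mulrC].
set H1 := S1 - d * c1 * M1.
have H1S : S1 / 2 <= H1.
  have : c1 * M1 <= S1 by apply: le_trans M1S; rewrite ler_piMl.
  by rewrite /H1; nra.
have S10 : 0 <= S1 by exact: le_trans M1S.
have A2 : S2 - d * c2 * M2 <= e * H1 + d * c1 * M1 * (e - ei) + d * u * M1 * ei.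
  have := ler_wpM2l d0 A1; rewrite /H1; nra.
have A3 : e * H1 + d * c1 * M1 * (e - ei) + d * u * M1 * ei <=
  e * (H1 * (1 + 4 * d * t + 2 * d * u)).
  have cM : c1 * M1 <= 2 * H1.
    apply: (@le_trans _ _ S1); last lra.
    by apply: le_trans M1S; rewrite ler_piMl.
  have E1 : e - ei = e * (1 - ei ^+ 2) by rewrite mulrBr mulr1 expr2 mulrA eei mul1r.
  have E2 : e - ei <= e * (2 * t) by rewrite E1 ler_pM2l//; lra.
  have E0 : 0 <= e - ei by rewrite E1 mulr_ge0 ?subr_ge0 ?expr_le1//; exact: ltW.
  have B1 : d * c1 * M1 * (e - ei) <= d * (2 * H1) * (e * (2 * t)).
    by rewrite ler_pM//; [rewrite !mulr_ge0|rewrite -mulrA ler_wpM2l].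
  have ei_e : ei <= e by lra.
  have B2 : d * u * M1 * ei <= d * u * (2 * H1) * e.
    apply: ler_pM => //; [by rewrite !mulr_ge0|exact: ltW|].
    by rewrite ler_wpM2l ?mulr_ge0//; lra.
  by move: B1 B2; lra.
apply: le_trans A2 _; apply: le_trans A3 _.
have -> : expR (t + 4 * d * t + 2 * d * u) = e * expR (4 * d * t + 2 * d * u).
  by rewrite /e -expRD; congr expR; ring.
rewrite -[leRHS]mulrA ler_pM2l// [leRHS]mulrC ler_wpM2l//; first lra.
rewrite -addrA.
exact: expR_ge1Dx.
Qed.

End ComplexExponential.

Section PhaseCancellation.
Variable R : realType.
Local Notation nc := (@Normc.normc R).
Local Notation I := (@I01 R).

(* [b * (tA - tB)] turns by a definite angle between [x0] and [x1], while [FA] and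
   [FB] hardly move: the two terms cannot be aligned near both points. *)
Lemma phase_cancel (tA tB : R -> R) (FA FB : R -> R[i]) (b m c l om r x0 x1 rho : R) :
  0 <= m -> 0 <= l ->
  (forall x, I x -> nc (FA x) <= 1) -> (forall x, I x -> nc (FB x) <= 1) ->
  (forall x y, I x -> I y -> `|y - x| <= r -> nc (FA y - FA x) <= l * `|y - x|) ->
  (forall x y, I x -> I y -> `|y - x| <= r -> nc (FB y - FB x) <= l * `|y - x|) ->
  (forall x y, I x -> I y -> `|tA y - tA x| <= m * `|y - x|) ->
  (forall x y, I x -> I y -> `|tB y - tB x| <= m * `|y - x|) ->
  I x0 -> I x1 -> `|x1 - x0| <= r -> 2 * m * `|b| * `|x1 - x0| <= 1 ->
  c * `|x1 - x0| <= `|(tA x1 - tB x1) - (tA x0 - tB x0)| ->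
  2 * om + 2 * l * `|x1 - x0| < c * `|b| * `|x1 - x0| / 4 ->
  rho <= r -> (2 * m * `|b| + 2 * l) * rho <= om / 2 -> l * rho <= 1 / 4 ->
  exists2 z, z = x0 \/ z = x1 & forall x, I x -> `|x - z| <= rho ->
    nc (FA x) <= 3 / 4 \/
    om / 2 <= nc (expi (b * tA x) * FA x - expi (b * tB x) * FB x).
Proof.
move=> m0 l0 FA1 FB1 lFA lFB ltA ltB Ix0 Ix1 x01r x01m cx om_lt rr rom rl.
pose ps x := tA x - tB x.
have lps x y : I x -> I y -> `|ps y - ps x| <= 2 * m * `|y - x|.
  move=> Ix Iy; have -> : ps y - ps x = (tA y - tA x) - (tB y - tB x) by rewrite /ps; ring.
  rewrite (le_trans (ler_normB _ _))//; have := ltA x y Ix Iy; have := ltB x y Ix Iy; lra.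
pose u x := expi (b * ps x) * FA x - FB x.
have uE x : nc (expi (b * tA x) * FA x - expi (b * tB x) * FB x) = nc (u x).
  have -> : expi (b * tA x) = expi (b * tB x) * expi (b * ps x).
    by rewrite -expiD; congr expi; rewrite /ps; ring.
  by rewrite -mulrA -mulrBr Normc.normcM normc_expi mul1r.
have ul x z : I x -> I z -> `|x - z| <= r -> nc (u x - u z) <= (2 * m * `|b| + 2 * l) * `|x - z|.
  move=> Ix Iz xz.
  have -> : u x - u z = (expi (b * ps x) * (FA x - FA z)
    + (expi (b * ps x) - expi (b * ps z)) * FA z) + (FB z - FB x) by rewrite /u; ring.
  rewrite (le_trans (le_normcD _ _))//.
  have h1 : nc (FB z - FB x) <= l * `|x - z| by rewrite normc_dist lFB.
  have h2 : nc (expi (b * ps x) * (FA x - FA z)) <= l * `|x - z|.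
    by rewrite Normc.normcM normc_expi mul1r lFA.
  have h3 : nc ((expi (b * ps x) - expi (b * ps z)) * FA z) <= 2 * m * `|b| * `|x - z|.
    rewrite Normc.normcM -[leRHS]mulr1 ler_pM ?normc_ge0 ?FA1//.
    rewrite (le_trans (normc_expiB_le _ _))// -mulrBr normrM.
    rewrite [leRHS](_ : _ = `|b| * (2 * m * `|x - z|)); last by ring.
    by rewrite ler_wpM2l// lps.
  have := le_normcD (expi (b * ps x) * (FA x - FA z)) ((expi (b * ps x) - expi (b * ps z)) * FA
    z).
  lra.
have good z : I z -> om <= nc (u z) -> forall x, I x -> `|x - z| <= rho ->
    om / 2 <= nc (expi (b * tA x) * FA x - expi (b * tB x) * FB x).
  move=> Iz omz x Ix xz; rewrite uE.
  have := ul x z Ix Iz (le_trans xz rr).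
  have : (2 * m * `|b| + 2 * l) * `|x - z| <= om / 2.
    by apply: le_trans rom; rewrite ler_wpM2l// addr_ge0 ?mulr_ge0.
  have := normc_split (u z) (u x); rewrite normc_dist; lra.
have [FAs|FAb] := leP (nc (FA x0)) (1 / 2).
  exists x0; first by left.
  move=> x Ix xz; left; have := lFA x0 x Ix0 Ix (le_trans xz rr).
  have : l * `|x - x0| <= 1 / 4 by apply: le_trans rl; rewrite ler_wpM2l.
  have := normc_split (FA x) (FA x0); lra.
have [u0|u0] := leP om (nc (u x0)).
  by exists x0; [left|move=> x Ix xz; right; exact: good xz].
have [u1|u1] := leP om (nc (u x1)).
  by exists x1; [right|move=> x Ix xz; right; exact: good xz].
exfalso.
(* If [u] is below [om] at both points, the chord turned by [expi (b * ps)], weighted by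
   [|FA x0| > 1 / 2], is at most [2 om + 2 l |x1 - x0|]; phase separation makes it at least
   [c |b| |x1 - x0| / 4]. *)
have e1 : nc ((expi (b * ps x1) - expi (b * ps x0)) * FA x0) <= 2 * om + 2 * l * `|x1 - x0|.
  have -> : (expi (b * ps x1) - expi (b * ps x0)) * FA x0 =
     (u x1 - u x0) + (FB x1 - FB x0) - expi (b * ps x1) * (FA x1 - FA x0).
    by rewrite /u; ring.
  have h1 : nc (FB x1 - FB x0) <= l * `|x1 - x0| by exact: lFB.
  have h2 : nc (expi (b * ps x1) * (FA x1 - FA x0)) <= l * `|x1 - x0|.
    by rewrite Normc.normcM normc_expi mul1r lFA.
  have := normcB_le (u x1 - u x0 + (FB x1 - FB x0)) (expi (b * ps x1) * (FA x1 - FA x0)).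
  have := le_normcD (u x1 - u x0) (FB x1 - FB x0).
  have := normcB_le (u x1) (u x0); lra.
have bp : `|b * ps x1 - b * ps x0| <= 1.
  rewrite -mulrBr normrM (le_trans _ x01m)//.
  rewrite [leRHS](_ : _ = `|b| * (2 * m * `|x1 - x0|)); last by ring.
  by rewrite ler_wpM2l// lps.
have e2 := normc_expiB_ge bp.
have e3 : c * `|b| * `|x1 - x0| <= `|b * ps x1 - b * ps x0|.
  rewrite -mulrBr normrM [leLHS](_ : _ = `|b| * (c * `|x1 - x0|)); last by ring.
  by rewrite ler_wpM2l.
rewrite Normc.normcM in e1.
have e4 : c * `|b| * `|x1 - x0| / 2 <= nc (expi (b * ps x1) - expi (b * ps x0)) by lra.
have n0 := normc_ge0 (expi (b * ps x1) - expi (b * ps x0)).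
nra.
Qed.

(** The two bounds on [d] match the two cases: a factor of modulus at most 3/4 saves a quarter of
    [P], and a distance [om / 2] saves [(om / 2)^2 / 4] of the minimum. *)
Lemma combination_gain (P Q d om : R) (g h : R[i]) : 0 <= P -> 0 <= Q ->
  nc g <= 1 -> nc h <= 1 -> d <= 1 / 4 -> d <= om ^+ 2 / 16 -> 0 <= om ->
  nc g <= 3 / 4 \/ om / 2 <= nc (g - h) ->
  nc (P%:C * g + Q%:C * h) <= P + Q - d * Num.min P Q.
Proof.
move=> P0 Q0 g1 h1 d4 dom om0.
set m := Num.min P Q.
have [m0 mP] : 0 <= m /\ m <= P by rewrite le_min P0 Q0 ge_min lexx.
case=> [g34|gh].
  have := le_normcD (P%:C * g) (Q%:C * h); rewrite !Normc.normcM !normc_real !ger0_norm//.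
  have := ler_wpM2l P0 g34; have := ler_wpM2l Q0 h1; have := ler_wpM2r m0 d4; lra.
apply: le_trans (normc_combination P0 Q0 g1 h1) _; rewrite -/m lerB//.
have n2 : om ^+ 2 / 4 <= nc (g - h) ^+ 2.
  have -> : om ^+ 2 / 4 = (om / 2) ^+ 2 by field.
  by rewrite lerXn2r ?nnegrE ?normc_ge0//; lra.
have : d <= nc (g - h) ^+ 2 / 4 by lra.
by move=> /(ler_wpM2r m0); lra.
Qed.

(** The numerator contributes [a] and the denominator [3 * a], by [expR a <= 1 + 3 a]. *)
Lemma ratio_lip (f0 f1 : R[i]) (h0 h1 a : R) : 0 < h0 -> 0 < h1 -> 0 <= a <= 1 ->
  nc f1 <= h1 -> nc (f1 - f0) <= a * h0 -> h1 <= expR a * h0 -> h0 <= expR a * h1 ->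
  nc ((h1^-1)%:C * f1 - (h0^-1)%:C * f0) <= 4 * a.
Proof.
move=> h00 h10 a01 f1h fd h10e h01e; have /andP[a0 a1] := a01.
have ea := expR_le_1D3x a01.
have -> : (h1^-1)%:C * f1 - (h0^-1)%:C * f0 =
    (h0^-1)%:C * (f1 - f0) + (h1^-1 - h0^-1)%:C * f1 by rewrite rmorphB/=; ring.
apply: le_trans (le_normcD _ _) _; rewrite !Normc.normcM !normc_real.
have i0 : 0 < h0^-1 by rewrite invr_gt0.
have A : `|h0^-1| * nc (f1 - f0) <= a.
  by rewrite gtr0_norm// mulrC ler_pdivrMr.
have B : `|h1^-1 - h0^-1| * nc f1 <= 3 * a.
  apply: (@le_trans _ _ (`|h1^-1 - h0^-1| * h1)); first by rewrite ler_wpM2l.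
  rewrite -{2}(gtr0_norm h10) -normrM mulrBl mulVf ?gt_eqF// distrC.
  rewrite ler_norml; apply/andP; split; last first.
    by rewrite lerBlDr mulrC ler_pdivrMr//; apply: le_trans h10e _; rewrite ler_pM2r//; lra.
  have : (1 - a) * h0 <= h1.
    have := ler_wpM2l (expR_ge0 (- a)) h01e; rewrite mulrA -expRD addNr expR0 mul1r.
    by apply: le_trans; rewrite ler_pM2r//; have := expR_ge1Dx (- a).
  by rewrite -ler_pdivlMr// mulrC; lra.
lra.
Qed.

(** A maximum of tents rather than a sum: the Lipschitz constant is [s] whatever the number of
    centres and however much their neighbourhoods overlap. *)
Definition bump (T : eqType) (W : seq T) (z : T -> R) (s x : R) : R :=
  \big[Num.max/0]_(v <- W) Num.max 0 (1 - s * `|x - z v|).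

Variables (T : eqType) (W : seq T) (z : T -> R) (s : R).

Lemma bump_ge0 x : 0 <= bump W z s x.
Proof.
rewrite /bump; elim: W => [|v W' IH]; first by rewrite big_nil.
by rewrite big_cons le_max IH orbT.
Qed.

Lemma bump_le1 x : 0 <= s -> bump W z s x <= 1.
Proof.
move=> s0; rewrite /bump; elim: W => [|v W' IH]; first by rewrite big_nil ler01.
by rewrite big_cons !ge_max IH ler01 gerBl mulr_ge0.
Qed.

Lemma bump_lip x y : 0 <= s -> bump W z s y - s * `|y - x| <= bump W z s x.
Proof.
move=> s0; rewrite /bump; elim: W => [|v W' IH].
  by rewrite !big_nil sub0r oppr_le0 mulr_ge0.
rewrite !big_cons; set A := \big[_/_]_(_ <- _) _ in IH *; set B := \big[_/_]_(_ <- _) _ in IH *.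
rewrite lerBlDr !ge_max; apply/andP; split; [apply/andP; split|].
- by rewrite addr_ge0 ?mulr_ge0// !le_max lexx.
- apply: (@le_trans _ _ (1 - s * `|x - z v| + s * `|y - x|)); last first.
    by rewrite lerD2r !le_max lexx orbT.
  have := ler_wpM2l s0 (ler_distD y x (z v)); rewrite [`|x - y|]distrC mulrDr; lra.
- by apply: (@le_trans _ _ (B + s * `|y - x|)); [lra|rewrite lerD2r le_max lexx orbT].
Qed.

Lemma bump_pos x : 0 < bump W z s x -> exists2 v, v \in W & s * `|x - z v| < 1.
Proof.
rewrite /bump; elim: W => [|v W' IH]; first by rewrite big_nil ltxx.
rewrite big_cons !lt_max ltxx /= => /orP[h|/IH[u uW hu]].
  by exists v; [rewrite mem_head|lra].
by exists u => //; rewrite in_cons uW orbT.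
Qed.

Lemma bump_ge x v : v \in W -> 1 - s * `|x - z v| <= bump W z s x.
Proof.
rewrite /bump; elim: W => // u W' IH; rewrite in_cons big_cons !le_max => /orP[/eqP <-|/IH ->].
  by rewrite lexx orbT.
by rewrite orbT.
Qed.

Lemma bmeas_bump : bmeas I (bump W z s).
Proof.
rewrite /bump; elim: W => [|v W' IH].
  by under eq_fun do rewrite big_nil; exact: bmeas_cst.
under eq_fun do rewrite big_cons; apply: bmeas_max => //.
apply: bmeas_max; first exact: bmeas_cst.
apply: bmeas_sub; first exact: bmeas_cst.
apply/bmeas_scale/bmeas_norm/bmeas_sub; last exact: bmeas_cst.
by apply: contI_bmeas => x Ix; exact: cvg_within.
Qed.

End PhaseCancellation.

(** * Contraction of the transfer operators *)
Section TransferOperator.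
Variables (R : realType) (A : finType) (phi : A -> R -> R) (p : A -> R)
  (mu : probability R R) (kap lam Cu Cl M : R).
Hypothesis G : regular_ifs phi p mu kap lam Cu Cl M.

Local Notation I := (@I01 R).
Local Notation phiw := (compose phi).
Local Notation E := (Emu mu).
Local Notation nc := (@Normc.normc R).
Local Notation pr := (pw p).
Implicit Types (w u v : seq A) (f : R -> R[i]) (H : R -> R).

(** On [I] this is the [N]-th iterate of the averaging operator over single letters, twisted by the
    character [|phi'|^(i b)]. *)
Definition transfer (b : R) N f x : R[i] :=
  \sum_(w <- words A N) (pr w)%:C * (expi (b * theta phi w x) * f (phiw w x)).

Definition average N H x : R := \sum_(w <- words A N) pr w * H (phiw w x).

(* Dolgopyat's cone, [be] being the modulus of the frequency. *)
Record dcone (B be : R) f H : Prop := DCone {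
  dc_meas : bmeas I H;
  dc_pos : forall x, I x -> 0 < H x;
  dc_le : forall x, I x -> nc (f x) <= H x;
  dc_lip : forall x y, I x -> I y -> nc (f y - f x) <= B * be * `|y - x| * H x;
  dc_log : forall x y, I x -> I y -> H y <= expR (B * be * `|y - x|) * H x }.

(** The aperture [4 * M] reproduces itself. With [Cu * kap ^+ N <= 1 / 4], one step gives the
    Lipschitz constant [M + 4 M / 4 = 2 M] relative to the average of [H], and the new majorant
    keeps at least half of that average. *)
Definition cone_contraction (N : nat) (rho b0 : R) : Prop :=
  forall b f H, b0 <= `|b| -> dcone (4 * M) `|b| f H ->
    exists2 H', dcone (4 * M) `|b| (transfer b N f) H' &
      E (fun x => H' x ^+ 2) <= rho * E (fun x => H x ^+ 2).

Lemma bmeas_average N H : bmeas I H -> bmeas I (average N H).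
Proof.
move=> HH; apply: bmeas_sum => w; apply: bmeas_scale.
exact: (bmeas_comp G).
Qed.

Lemma average_ge0 N H x : (forall x, I x -> 0 <= H x) -> I x -> 0 <= average N H x.
Proof.
move=> H0 Ix; apply: sumr_ge0 => w _; rewrite mulr_ge0 ?(rg_pw_ge0 G)//.
by apply: H0; exact: (rg_I G).
Qed.

Lemma average_gt0 N H x : (forall x, I x -> 0 < H x) -> I x -> 0 < average N H x.
Proof.
move=> H0 Ix; have s1 := sum_pw_words (rg_prob G) N.
have : exists w, w \in words A N.
  case: (words A N) s1 => [|w s _]; last by exists w; rewrite mem_head.
  by rewrite big_nil => /eqP; rewrite eq_sym oner_eq0.
move=> [w wN]; rewrite /average (big_rem w)//= ltr_pwDl//.
  by rewrite mulr_gt0 ?(pw_gt0 (rg_prob G))//; apply: H0; exact: (rg_I G).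
apply: sumr_ge0 => u _; rewrite mulr_ge0 ?(rg_pw_ge0 G)//.
by apply/ltW/H0; exact: (rg_I G).
Qed.

Lemma E_average N H : bmeas I H -> E (average N H) = E H.
Proof.
move=> HH; rewrite (stationary_words G N HH).
rewrite (E_sum G); last by move=> w; apply/bmeas_scale/(bmeas_comp G).
by apply: eq_bigr => w _; rewrite (E_scale G)//; exact: (bmeas_comp G).
Qed.

Lemma size_words w N : w \in words A N -> size w = N.
Proof. by rewrite mem_words => /eqP. Qed.

Lemma phiw_dist w N x y : w \in words A N -> I x -> I y ->
  `|phiw w y - phiw w x| <= Cu * kap ^+ N * `|y - x|.
Proof.
move=> /size_words <- Ix Iy; apply: (compose_dist G) => // z Iz.
exact: (normder_le G).
Qed.

Section Cone.
Variables (B b : R) (f : R -> R[i]) (H : R -> R) (N : nat).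
Hypotheses (B0 : 0 <= B) (FH : dcone B `|b| f H).
Let kN := Cu * kap ^+ N.

Lemma kN_ge0 : 0 <= kN.
Proof. by rewrite mulr_ge0 ?exprn_ge0 ?ltW ?(rg_Cu0 G) ?(rg_kap0 G). Qed.

Lemma transfer_le x : I x -> nc (transfer b N f x) <= average N H x.
Proof.
move=> Ix; apply: le_trans (normc_sum _ _) _; apply: ler_sum => w _.
rewrite !Normc.normcM normc_real normc_expi mul1r ger0_norm ?(rg_pw_ge0 G)//.
rewrite ler_wpM2l ?(rg_pw_ge0 G)//; apply: (dc_le FH); exact: (rg_I G).
Qed.

(** A Lasota-Yorke estimate: [M] comes from differentiating the twist, while the variation of [f]
    itself is damped by the contraction [kN]. *)
Lemma transfer_lip x y : I x -> I y -> nc (transfer b N f y - transfer b N f x) <=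
  `|b| * `|y - x| * (M + B * kN) * average N H x.
Proof.
move=> Ix Iy; rewrite /transfer -sumrB; apply: le_trans (normc_sum _ _) _.
rewrite /average mulr_sumr big_seq [leRHS]big_seq; apply: ler_sum => w wN.
rewrite -mulrBr Normc.normcM normc_real ger0_norm ?(rg_pw_ge0 G)// mulrCA ler_wpM2l ?(rg_pw_ge0
  G)//.
have Iwx := rg_I G w Ix; have Iwy := rg_I G w Iy.
have -> : expi (b * theta phi w y) * f (phiw w y) - expi (b * theta phi w x) * f (phiw w x) =
  expi (b * theta phi w y) * (f (phiw w y) - f (phiw w x)) +
  (expi (b * theta phi w y) - expi (b * theta phi w x)) * f (phiw w x) by ring.
apply: le_trans (le_normcD _ _) _; rewrite !Normc.normcM normc_expi mul1r.
have Hx := dc_pos FH Iwx.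
have h1 : nc (f (phiw w y) - f (phiw w x)) <= `|b| * `|y - x| * (B * kN) * H (phiw w x).
  apply: le_trans (dc_lip FH Iwx Iwy) _.
  rewrite ler_pM2r// [leRHS](_ : _ = B * `|b| * (kN * `|y - x|)); last by ring.
  by rewrite ler_wpM2l ?mulr_ge0// phiw_dist.
have h2 : nc (expi (b * theta phi w y) - expi (b * theta phi w x)) * nc (f (phiw w x)) <=
    `|b| * `|y - x| * M * H (phiw w x).
  rewrite ler_pM ?normc_ge0 ?(dc_le FH)//.
  apply: le_trans (normc_expiB_le _ _) _; rewrite -mulrBr normrM -mulrA ler_wpM2l//.
  by rewrite mulrC (rg_theta G).
lra.
Qed.

Lemma average_log x y : I x -> I y ->
  average N H y <= expR (B * kN * `|b| * `|y - x|) * average N H x.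
Proof.
move=> Ix Iy; rewrite /average mulr_sumr big_seq [leRHS]big_seq; apply: ler_sum => w wN.
have Iwx := rg_I G w Ix; have Iwy := rg_I G w Iy.
rewrite mulrCA ler_wpM2l ?(rg_pw_ge0 G)//; apply: le_trans (dc_log FH Iwx Iwy) _.
rewrite ler_pM2r ?(dc_pos FH)// ler_expR.
rewrite [leRHS](_ : _ = B * `|b| * (kN * `|y - x|)); last by ring.
by rewrite ler_wpM2l ?mulr_ge0// phiw_dist.
Qed.

Lemma comp_log w x y : w \in words A N -> I x -> I y ->
  H (phiw w y) <= expR (B * kN * `|b| * `|y - x|) * H (phiw w x).
Proof.
move=> wN Ix Iy; have Iwx := rg_I G w Ix; have Iwy := rg_I G w Iy.
apply: le_trans (dc_log FH Iwx Iwy) _.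
rewrite ler_pM2r ?(dc_pos FH)// ler_expR.
rewrite [leRHS](_ : _ = B * `|b| * (kN * `|y - x|)); last by ring.
by rewrite ler_wpM2l ?mulr_ge0// phiw_dist.
Qed.

Lemma average_sqr_log x y : I x -> I y ->
  average N (fun t => H t ^+ 2) y <=
    expR (2 * (B * kN * `|b| * `|y - x|)) * average N (fun t => H t ^+ 2) x.
Proof.
move=> Ix Iy; rewrite /average mulr_sumr big_seq [leRHS]big_seq; apply: ler_sum => w wN.
rewrite [leRHS]mulrCA ler_wpM2l ?(rg_pw_ge0 G)// expRM_natl -exprMn lerXn2r ?nnegrE//;
  last exact: comp_log.
- by apply/ltW/(dc_pos FH)/(rg_I G).
- by rewrite mulr_ge0 ?expR_ge0//; apply/ltW/(dc_pos FH)/(rg_I G).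
Qed.

End Cone.

Lemma average_sqr N H x : average N H x ^+ 2 <= average N (fun t => H t ^+ 2) x.
Proof. by apply: weighted_jensen; [exact: (rg_pw_ge0 G)|exact: (sum_pw_words (rg_prob G))]. Qed.

(** Cauchy-Schwarz with the word [w] weakened to [1 - d]: the total weight drops to
    [(1 - d)^2 p_w + 1 - p_w], at most [1 - d p_w]. *)
Lemma average_sqr_gain N H x w d : w \in words A N -> 0 <= d <= 1 ->
  0 <= average N (fun t => H t ^+ 2) x ->
  (average N H x - d * (pr w * H (phiw w x))) ^+ 2 <=
  (1 - d * pr w) * average N (fun t => H t ^+ 2) x.
Proof.
move=> wN /andP[d0 d1]; rewrite /average.
have := sum_pw_words (rg_prob G) N; rewrite !(big_rem w wN)/=.
set s := rem w _; set h := H (phiw w x) => s1.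
set b := \sum_(i <- s) pr i * H _; set Y := \sum_(i <- s) pr i * _ ^+ 2.
have cs : b ^+ 2 <= (\sum_(i <- s) pr i) * Y.
  have := weighted_cauchy s (fun=> 1) (fun i => H (phiw i x)) (rg_pw_ge0 G).
  under eq_bigr do rewrite mulr1.
  by under [X in _ <= X * _ -> _]eq_bigr do rewrite expr1n mulr1.
set X := \sum_(i <- s) pr i in s1 cs.
move=> T0.
have -> : pr w * h + b - d * (pr w * h) = pr w * (1 - d) * h + b by ring.
have Y0 : 0 <= Y by apply: sumr_ge0 => i _; rewrite mulr_ge0 ?(rg_pw_ge0 G)// sqr_ge0.
have X0 : 0 <= X by apply: sumr_ge0 => i _; rewrite (rg_pw_ge0 G).
have := cauchy_cons (1 - d) h (rg_pw_ge0 G w) X0 Y0 cs => /le_trans; apply.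
apply: ler_wpM2r => //; have P0 := rg_pw_ge0 G w.
have d1' : 0 <= 1 - d by lra.
have := mulr_ge0 (mulr_ge0 d0 P0) d1'; have -> : X = 1 - pr w by lra.
lra.
Qed.

(** Phase cancellation for the normalised functions [f / H] along [al] and [be]. Composed with a
    long word they move at the rate [16 M kN |b|], where [kN = Cu * kap ^+ N] and 16 is the cone
    aperture 4 times the constant of [ratio_lip]. For [N] large this is far below the rate [c |b|]
    at which the phases separate. The angle [om] is [c * L0 / 16]. *)
Lemma transfer_cancel (N : nat) (al be : seq A) (b c L0 rho d : R) f H x0 x1 :
  al \in words A N -> be \in words A N -> al != be ->
  b != 0 -> 0 < c -> 0 < L0 ->
  Cu * kap ^+ N <= 1 / 4 -> 16 * M * (Cu * kap ^+ N) <= 1 -> 16 * M * (Cu * kap ^+ N) <= c / 32 ->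
  0 <= rho -> rho <= 1 / (2 * M) -> rho <= c * L0 / 16 / (8 * (M + 1)) -> rho <= 1 / 4 ->
  d <= 1 / 4 -> d <= (c * L0 / 16) ^+ 2 / 16 ->
  dcone (4 * M) `|b| f H ->
  I x0 -> I x1 -> `|b| * `|x1 - x0| <= 1 / (2 * M) -> L0 <= `|b| * `|x1 - x0| ->
  c * `|x1 - x0| <= `|(theta phi al x1 - theta phi be x1) - (theta phi al x0 - theta phi be
    x0)| ->
  exists2 z, z = x0 \/ z = x1 & forall x, I x -> `|b| * `|x - z| <= rho ->
    nc (transfer b N f x) <= average N H x -
      d * Num.min (pr al * H (phiw al x)) (pr be * H (phiw be x)).
Proof.
move=> alN beN albe b0 c0 L00 kN4 kN1 kNc rho0 rhoD rhoom rho4 d4 dom FH Ix0 Ix1 xD xL psi.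
have M0 := rg_M0 G; have b_gt0 : 0 < `|b| by rewrite normr_gt0.
have M0' := ltW M0.
have kN0 := kN_ge0 N.
have Hlog := @comp_log (4 * M) b f H N ltac:(by rewrite mulr_ge0) FH.
have Hdist w x y (wN : w \in words A N) := @phiw_dist w N x y wN.
move: (Cu * kap ^+ N) => kN in kN0 Hlog Hdist kN1 kN4 kNc.
pose F w x : R[i] := ((H (phiw w x))^-1)%:C * f (phiw w x).
have Hp w x : I x -> 0 < H (phiw w x) by move=> Ix; apply/(dc_pos FH)/(rg_I G).
have F1 w x : I x -> nc (F w x) <= 1.
  move=> Ix; rewrite Normc.normcM normc_real gtr0_norm ?invr_gt0 ?Hp//.
  by rewrite mulrC ler_pdivrMr ?Hp// mul1r; apply/(dc_le FH)/(rg_I G).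
set l := 16 * M * kN * `|b|.
have lF w : w \in words A N -> forall x y, I x -> I y -> `|y - x| <= 1 / (2 * M) / `|b| ->
    nc (F w y - F w x) <= l * `|y - x|.
  move=> wN x y Ix Iy xy.
  have -> : l * `|y - x| = 4 * (4 * M * kN * `|b| * `|y - x|) by rewrite /l; ring.
  have q0 : 0 <= 4 * M * kN * `|b| * `|y - x| by rewrite !mulr_ge0.
  have q1 : 4 * M * kN * `|b| * `|y - x| <= 1.
    have : `|b| * `|y - x| <= 1 / (2 * M) by rewrite mulrC -ler_pdivlMr.
    move=> h; apply: (@le_trans _ _ (4 * M * kN * (1 / (2 * M)))).
      by rewrite -[leLHS]mulrA ler_wpM2l// !mulr_ge0.
    have -> : 4 * M * kN * (1 / (2 * M)) = 2 * kN by field; rewrite gt_eqF.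
    lra.
  apply: ratio_lip; rewrite ?Hp ?q0 ?q1//.
  - by apply/(dc_le FH)/(rg_I G).
  - apply: le_trans (dc_lip FH (rg_I G w Ix) (rg_I G w Iy)) _.
    rewrite ler_pM2r ?Hp// [leRHS](_ : _ = 4 * M * `|b| * (kN * `|y - x|)); last by ring.
    by rewrite ler_wpM2l ?mulr_ge0 ?(Hdist _ _ _ wN).
  - exact: Hlog.
  - by rewrite distrC; exact: Hlog.
have thl w x y : I x -> I y -> `|theta phi w y - theta phi w x| <= M * `|y - x|.
  by move=> Ix Iy; exact: (rg_theta G).
have om0 : 0 < c * L0 / 16 by rewrite divr_gt0// mulr_gt0.
have h2M : 2 * M * `|b| * `|x1 - x0| <= 1.
  have -> : 2 * M * `|b| * `|x1 - x0| = (`|b| * `|x1 - x0|) * (2 * M) by ring.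
  by rewrite -ler_pdivlMr// mulr_gt0.
have hom : 2 * (c * L0 / 16) + 2 * l * `|x1 - x0| < c * `|b| * `|x1 - x0| / 4.
  have -> : 2 * l * `|x1 - x0| = 2 * ((16 * M * kN) * (`|b| * `|x1 - x0|)) by rewrite /l; ring.
  have -> : c * `|b| * `|x1 - x0| = c * (`|b| * `|x1 - x0|) by ring.
  have X0 : 0 < `|b| * `|x1 - x0| by exact: lt_le_trans xL.
  have := ler_wpM2l (ltW c0) xL; have := ler_wpM2r (ltW X0) kNc; have := mulr_gt0 c0 X0.
  lra.
have hrom : (2 * M * `|b| + 2 * l) * (rho / `|b|) <= c * L0 / 16 / 2.
  have -> : (2 * M * `|b| + 2 * l) * (rho / `|b|) = (2 * M + 2 * (16 * M * kN)) * rho.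
    by rewrite /l; field; rewrite gt_eqF.
  move: rhoom; rewrite ler_pdivlMr; last lra.
  have : (16 * M * kN) * rho <= rho by rewrite ler_piMl.
  lra.
have hrl : l * (rho / `|b|) <= 1 / 4.
  have -> : l * (rho / `|b|) = (16 * M * kN) * rho by rewrite /l; field; rewrite gt_eqF.
  by apply: le_trans rho4; rewrite ler_piMl.
have [z zx Hz] := @phase_cancel R (theta phi al) (theta phi be) (F al) (F be) b M c l
  (c * L0 / 16) (1 / (2 * M) / `|b|) x0 x1 (rho / `|b|)
  M0' ltac:(by rewrite /l !mulr_ge0) (F1 al) (F1 be) (lF al alN) (lF be beN)
  (thl al) (thl be) Ix0 Ix1
  ltac:(by rewrite ler_pdivlMr// mulrC)
  h2M
  psi
  hom
  ltac:(by rewrite ler_pM2r ?invr_gt0)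
  hrom hrl.
exists z => // x Ix xz.
have {Hz} := Hz x Ix ltac:(by rewrite ler_pdivlMr// mulrC).
have Pa : 0 <= pr al * H (phiw al x) by rewrite mulr_ge0 ?(rg_pw_ge0 G)// ltW// Hp.
have Pb : 0 <= pr be * H (phiw be x) by rewrite mulr_ge0 ?(rg_pw_ge0 G)// ltW// Hp.
have eF w : nc (expi (b * theta phi w x) * F w x) = nc (F w x).
  by rewrite Normc.normcM normc_expi mul1r.
rewrite -(eF al) => Hz.
have eF1 w : nc (expi (b * theta phi w x) * F w x) <= 1 by rewrite eF F1.
have gain := combination_gain Pa Pb (eF1 al) (eF1 be) d4 dom (ltW om0) Hz.
have FE w : (pr w * H (phiw w x))%:C * (expi (b * theta phi w x) * F w x) =
    (pr w)%:C * (expi (b * theta phi w x) * f (phiw w x)).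
  rewrite /F rmorphM/= -!mulrA; congr (_ * _); rewrite mulrCA; congr (_ * _).
  by rewrite mulrA -rmorphM/= mulfV ?gt_eqF ?Hp// mul1r.
rewrite !FE in gain.
rewrite /transfer /average (big_rem al)//= [in leRHS](big_rem al)//=.
have beR : be \in rem al (words A N).
  by rewrite rem_mem// eq_sym.
rewrite (big_rem be)//= [in leRHS](big_rem be)//= [X in nc X <= _]addrA.
apply: le_trans (le_normcD _ _) _.
rewrite [leRHS](_ : _ = (pr al * H (phiw al x) + pr be * H (phiw be x)
  - d * Num.min (pr al * H (phiw al x)) (pr be * H (phiw be x))) +
  \sum_(w <- rem be (rem al (words A N))) pr w * H (phiw w x)); last by ring.
apply: lerD => //; apply: le_trans (normc_sum _ _) _; apply: ler_sum => w _.
rewrite !Normc.normcM normc_real normc_expi mul1r ger0_norm ?(rg_pw_ge0 G)//.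
by rewrite ler_wpM2l ?(rg_pw_ge0 G)//; apply/(dc_le FH)/(rg_I G).
Qed.

(* Substitute for a doubling property: the subcylinder [v ++ a] carries a fixed
   proportion of the integral of [T] over the cylinder [v]. *)
Lemma E_gain_cylinder (m : nat) (g T : R -> R) (s e : R) (a v : seq A) :
  a \in words A m -> bmeas I g -> bmeas I T -> 0 <= s ->
  (forall x, I x -> g x <= T x) ->
  (forall x, I x -> g (phiw v (phiw a x)) <= (1 - s) * T (phiw v (phiw a x))) ->
  (forall x y, I x -> I y -> T (phiw v x) <= e * T (phiw v y)) -> 0 < e ->
  E (g \o phiw v) <= (1 - s * pr a / e) * E (T \o phiw v).
Proof.
move=> am bg bT s0 gT gs Te e0.
have bgv := bmeas_comp G v bg; have bTv := bmeas_comp G v bT.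
have h1 : E (g \o phiw v) <= E (T \o phiw v) - s * pr a * E (T \o phiw v \o phiw a).
  rewrite (stationary_words G m bgv) (stationary_words G m bTv).
  rewrite !(big_rem a am)/=.
  have A1 : E (g \o phiw v \o phiw a) <= (1 - s) * E (T \o phiw v \o phiw a).
    rewrite -(E_scale G); last exact: (bmeas_comp G).
    apply: (E_le G) => [||x Ix]; [exact: (bmeas_comp G)|apply: bmeas_scale;
      exact: (bmeas_comp G)|exact: gs].
  have A2 : \sum_(y <- rem a (words A m)) pr y * E (g \o phiw v \o phiw y) <=
      \sum_(y <- rem a (words A m)) pr y * E (T \o phiw v \o phiw y).
    apply: ler_sum => y _; rewrite ler_wpM2l ?(rg_pw_ge0 G)//.
    apply: (E_le G) => [||x Ix]; [exact: (bmeas_comp G)|exact: (bmeas_comp G)|].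
    by apply: gT; do 2 apply: (rg_I G).
  have := ler_wpM2l (rg_pw_ge0 G a) A1; lra.
have h2 : E (T \o phiw v) <= e * E (T \o phiw v \o phiw a).
  rewrite -(E_scale G); last exact: (bmeas_comp G).
  rewrite -[leLHS](E_cst G).
  apply: (E_le G) => [||y Iy]; [exact: bmeas_cst|apply: bmeas_scale; exact: (bmeas_comp G)|].
  rewrite -[leRHS](E_cst G).
  apply: (E_le G) => [||x Ix]; [exact: bTv|exact: bmeas_cst|].
  by apply: Te => //; exact: (rg_I G).
have h3 : E (T \o phiw v) / e <= E (T \o phiw v \o phiw a) by rewrite ler_pdivrMr// mulrC.
have := ler_wpM2l (mulr_ge0 s0 (rg_pw_ge0 G a)) h3; lra.
Qed.

(* The new majorant removes from the average of [H] a bump around the points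
   [z v] where cancellation takes place; [d] is so small with respect to [rho]
   that the bump does not spoil the logarithmic Lipschitz bound. *)
Lemma cone_cut (N : nat) (al be : seq A) (b rho d : R) f H f1 (W : seq (seq A)) (z : seq A -> R) :
  al \in words A N -> be \in words A N -> b != 0 ->
  Cu * kap ^+ N <= 1 / 4 -> 0 < rho -> 0 <= d <= 1 / 2 -> d <= M * rho / 2 ->
  dcone (4 * M) `|b| f H ->
  f1 = transfer b N f ->
  let Mn x := Num.min (pr al * H (phiw al x)) (pr be * H (phiw be x)) in
  let H1 x := average N H x - d * bump W z (`|b| / rho) x * Mn x in
  (forall x v, I x -> v \in W -> `|b| * `|x - z v| <= rho ->
     nc (f1 x) <= average N H x - d * Mn x) ->
  [/\ dcone (4 * M) `|b| f1 H1,
      (forall x, I x -> H1 x ^+ 2 <= average N (fun t => H t ^+ 2) x) &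
      forall x v, I x -> v \in W -> `|b| * `|x - z v| <= rho / 2 ->
        H1 x ^+ 2 <= (1 - d / 2 * Num.min (pr al) (pr be)) * average N (fun t => H t ^+ 2) x].
Proof.
move=> alN beN b0 kN4 rho0 d01 drho FH ->{f1} Mn H1 Hz; have /andP[d0 dh] := d01.
have M0 := rg_M0 G; have b_gt0 : 0 < `|b| by rewrite normr_gt0.
have B0 : 0 <= 4 * M by lra.
have Hp w x : I x -> 0 < H (phiw w x) by move=> Ix; apply/(dc_pos FH)/(rg_I G).
set s := `|b| / rho; have s0 : 0 <= s by rewrite divr_ge0// ltW.
set chi := bump W z s.
have chi0 x : 0 <= chi x by exact: bump_ge0.
have chi1 x : chi x <= 1 by exact: bump_le1.
have Mn0 x : I x -> 0 <= Mn x.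
  by move=> Ix; rewrite le_min !mulr_ge0 ?(rg_pw_ge0 G)// ltW// Hp.
have Sp x : I x -> 0 < average N H x by move=> Ix; apply: average_gt0 => //; exact: (dc_pos FH).
have S1 w x : w \in words A N -> I x -> pr w * H (phiw w x) <= average N H x.
  move=> wN Ix; rewrite /average (big_rem w wN)/= lerDl.
  by apply: sumr_ge0 => u _; rewrite mulr_ge0 ?(rg_pw_ge0 G)// ltW// Hp.
have MnS x : I x -> Mn x <= average N H x.
  by move=> Ix; rewrite (le_trans _ (S1 al x alN Ix))// ge_min lexx.
have cM x : I x -> 0 <= chi x * Mn x <= Mn x.
  by move=> Ix; rewrite mulr_ge0 ?Mn0//= ler_piMl ?Mn0.
have H1S x : I x -> average N H x / 2 <= H1 x.
  move=> Ix; have /andP[c0 c1] := cM x Ix; have := MnS x Ix; have := Sp x Ix.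
  rewrite /H1 -/s -/chi -mulrA; nra.
have H1le x : I x -> H1 x <= average N H x.
  by move=> Ix; rewrite /H1 gerBl -mulrA mulr_ge0//; have /andP[] := cM x Ix.
have T0 x : I x -> 0 <= average N (fun t => H t ^+ 2) x.
  by move=> Ix; apply: average_ge0 => // y _; exact: sqr_ge0.
have bH := dc_meas FH.
split.
- split.
  + apply: bmeas_sub; first exact: bmeas_average.
    apply: bmeas_mul; first by apply: bmeas_scale; exact: bmeas_bump.
    by apply: bmeas_min; apply: bmeas_scale; exact: (bmeas_comp G).
  + by move=> x Ix; apply: lt_le_trans (H1S x Ix); rewrite divr_gt0// Sp.
  + move=> x Ix; have [c0|c0] := leP (chi x) 0.
      have c00 : chi x = 0 by apply/eqP; rewrite eq_le c0 chi0.
      by rewrite /H1 -/s -/chi c00 mulr0 mul0r subr0; exact: (transfer_le N FH).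
    have [v vW] := bump_pos c0; rewrite /s mulrAC ltr_pdivrMr// mul1r => /ltW xz.
    apply: le_trans (Hz x v Ix vW xz) _; rewrite /H1 lerB// -mulrA ler_wpM2l//.
    by have /andP[] := cM x Ix.
  + move=> x y Ix Iy; apply: le_trans (transfer_lip N B0 FH Ix Iy) _.
    have := H1S x Ix; have := Sp x Ix => h1 h2.
    have h3 : M + 4 * M * (Cu * kap ^+ N) <= 2 * M.
      have := ler_wpM2l B0 kN4; lra.
    have h4 : `|b| * `|y - x| * (M + 4 * M * (Cu * kap ^+ N)) <= `|b| * `|y - x| * (2 * M).
      by rewrite ler_wpM2l// mulr_ge0.
    apply: (@le_trans _ _ (`|b| * `|y - x| * (2 * M) * average N H x)).
      by rewrite ler_wpM2r// ltW.
    have -> : 4 * M * `|b| * `|y - x| * H1 x = `|b| * `|y - x| * (2 * M) * (2 * H1 x) by ring.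
    by rewrite ler_wpM2l ?mulr_ge0//; lra.
  + move=> x y Ix Iy; rewrite /H1 -/s -/chi.
    set t := 4 * M * (Cu * kap ^+ N) * `|b| * `|y - x|.
    have kN0 := kN_ge0 N.
    have t0 : 0 <= t by rewrite /t mulr_ge0// mulr_ge0// mulr_ge0.
    have u0 : 0 <= s * `|y - x| by rewrite mulr_ge0.
    apply: le_trans (@loglip_truncation R (average N H x) (average N H y) (Mn x) (Mn y)
      (chi x) (chi y) t (s * `|y - x|) d t0 u0 d01 _ (Mn0 y Iy) _ (chi0 y) _ _ _) _.
    * by rewrite Mn0 ?MnS.
    * by rewrite chi0 chi1.
    * exact: (average_log N B0 FH).
    * have hw w : w \in words A N -> Mn x <= pr w * H (phiw w x) ->
          expR (- t) * Mn x <= pr w * H (phiw w y).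
        move=> wN Mw; apply: (@le_trans _ _ (expR (- t) * (pr w * H (phiw w x)))).
          by rewrite ler_wpM2l ?expR_ge0.
        rewrite mulrCA ler_wpM2l ?(rg_pw_ge0 G)//.
        have := comp_log B0 FH wN Iy Ix; rewrite distrC -/t => /(ler_wpM2l (expR_ge0 (- t))).
        by rewrite mulrA -expRD addNr expR0 mul1r.
      by rewrite le_min !hw// ge_min lexx ?orbT.
    * by rewrite distrC; exact: bump_lip.
    rewrite ler_wpM2r//.
      by have := H1S x Ix; rewrite /H1 -/s -/chi; apply: le_trans; rewrite divr_ge0// ltW// Sp.
    rewrite ler_expR.
    (* With [X = |b| |y - x|] and [u = s |y - x|]: [t <= M X], [4 d t <= 2 M X] and [2 d u <= M X],
       which add up to the aperture [4 M]. *)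
    have X0 : 0 <= `|b| * `|y - x| by rewrite mulr_ge0.
    have tX : t <= M * (`|b| * `|y - x|).
      have -> : t = 4 * M * (`|b| * `|y - x|) * (Cu * kap ^+ N) by rewrite /t; ring.
      have := ler_wpM2l (mulr_ge0 B0 X0) kN4; lra.
    have dt : d * t <= 1 / 2 * t by rewrite ler_wpM2r.
    have ds : d * (s * `|y - x|) <= M / 2 * (`|b| * `|y - x|).
      have -> : d * (s * `|y - x|) = d / rho * (`|b| * `|y - x|) by rewrite /s; field;
        rewrite gt_eqF.
      by rewrite ler_wpM2r// ler_pdivrMr//; lra.
    lra.
- move=> x Ix; apply: le_trans (average_sqr N H x).
  rewrite lerXn2r ?nnegrE ?H1le//; last exact/ltW/Sp.
  by apply: le_trans (H1S x Ix); rewrite divr_ge0// ltW// Sp.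
- move=> x v Ix vW xz.
  have chih : 1 / 2 <= chi x.
    apply: le_trans (bump_ge z s x vW).
    have : s * `|x - z v| <= 1 / 2.
      by rewrite /s mulrAC ler_pdivrMr//; lra.
    lra.
  have H1' w : Mn x = pr w * H (phiw w x) ->
    H1 x <= average N H x - d / 2 * (pr w * H (phiw w x)).
    move=> <-; rewrite /H1 -/s -/chi lerB// ler_wpM2r ?Mn0//.
    by have := ler_wpM2l d0 chih; lra.
  have [w [wN E1 E2]] : exists w, [/\ w \in words A N, Mn x = pr w * H (phiw w x) & Num.min (pr
    al) (pr be) <= pr w].
    rewrite /Mn; case: leP => _; [exists al|exists be]; split=> //.
      by rewrite ge_min lexx.
    by rewrite ge_min lexx orbT.
  apply: (@le_trans _ _ ((average N H x - d / 2 * (pr w * H (phiw w x))) ^+ 2)).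
    have H10 : 0 <= H1 x by apply: le_trans (H1S x Ix); rewrite divr_ge0// ltW// Sp.
    by rewrite lerXn2r ?nnegrE ?H1'// (le_trans H10)// H1'.
  apply: le_trans (average_sqr_gain wN _ (T0 x Ix)) _; first by apply/andP; split; lra.
  rewrite ler_wpM2r ?T0// lerB// ler_wpM2l//; lra.
Qed.

Lemma exists_pos_le (s : seq R) : (forall x, x \in s -> 0 < x) ->
  exists2 e, 0 < e & forall x, x \in s -> e <= x.
Proof.
elim: s => [|a s IH] H; first by exists 1.
have [|e e0 He] := IH; first by move=> x xs; apply: H; rewrite in_cons xs orbT.
exists (Num.min a e); first by rewrite lt_min e0 andbT H ?mem_head.
move=> x; rewrite in_cons => /orP[/eqP ->|/He ex]; first by rewrite ge_min lexx.
by rewrite (le_trans _ ex)// ge_min lexx orbT.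
Qed.

Lemma dolgopyat_step (K : set R) : attractor phi K -> ~ (exists x, K = [set x]) ->
  phase_separation phi K ->
  exists N rho b0, [/\ (0 < N)%N, 0 < rho < 1, 0 < b0 & cone_contraction N rho b0].
Proof.
move=> K_attr K_nontriv [c c0 [N0 uni]].
have M0 := rg_M0 G; have Cu0 := rg_Cu0 G; have kap0 := rg_kap0 G.
have [k0 [k1 [Kk0 Kk1 k01]]] := attractor_two K_attr K_nontriv.
have Ik0 := attractor_I K_attr Kk0; have Ik1 := attractor_I K_attr Kk1.
have kap01 : 0 <= kap < 1 by rewrite (rg_kap1 G) ltW.
have [eN eN0 HeN] := @exists_pos_le [:: 1 / 4; 1 / (16 * M); c / 32 / (16 * M)] ltac:(
  by move=> x; rewrite !inE => /or3P[] /eqP ->; rewrite !divr_gt0 ?mulr_gt0).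
have [n0 Hn0] := exists_small_pow kap01 (divr_gt0 eN0 Cu0).
(* Long enough for the contraction to be below [eN] and for UNI to supply words of this length; the
   successor makes [N] positive. *)
pose N := (n0 + N0).+1.
have kN : Cu * kap ^+ N <= eN.
  rewrite mulrC -ler_pdivlMr// (le_trans _ (ltW Hn0))// /N -addnS exprD.
  by rewrite ler_piMr ?exprn_ge0 ?exprn_ile1 ?ltW ?(rg_kap1 G)//; apply: ltW.
have kN4 : Cu * kap ^+ N <= 1 / 4 by rewrite (le_trans kN)// HeN// mem_head.
have kN1 : 16 * M * (Cu * kap ^+ N) <= 1.
  rewrite mulrC -ler_pdivlMr ?mulr_gt0// (le_trans kN)// HeN//.
  by rewrite !inE eqxx orbT.
have kNc : 16 * M * (Cu * kap ^+ N) <= c / 32.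
  rewrite mulrC -ler_pdivlMr ?mulr_gt0// (le_trans kN)// HeN//.
  by rewrite !inE eqxx !orbT.
have [al [be [eta eta0 [sal sbe Hphase]]]] := uni N ltac:(by rewrite /N -addSn leq_addl).
have alN : al \in words A N by rewrite mem_words sal.
have beN : be \in words A N by rewrite mem_words sbe.
(* Equal words have no phase difference at all, contradicting phase separation at any point of [I]
   close to [k0] and distinct from it. *)
have albe : al != be.
  apply/eqP => ab; rewrite ab in Hphase.
  pose t := Num.min (eta / 2) (1 / 2).
  have t0 : 0 < t by rewrite lt_min; apply/andP; split; lra.
  have te : t <= eta / 2 by rewrite ge_min lexx.
  have th : t <= 1 / 2 by rewrite ge_min lexx orbT.
  have [y Iy yt] : exists2 y, I y & `|y - k0| = t.
    have /I01P k0I := Ik0; have [kh|kh] := leP k0 (1 / 2).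
      by exists (k0 + t); [apply/I01P; lra|rewrite addrC addKr gtr0_norm].
    exists (k0 - t); first by apply/I01P; lra.
    by rewrite addrC addKr normrN gtr0_norm.
  have := Hphase k0 y Kk0 Iy; rewrite yt subrr sub0r normrN => /(_ ltac:(lra)).
  rewrite subrr normr0; have := mulr_gt0 c0 t0; lra.
(* The cut set is taken at scale [D / |b|]: across one cylinder the relative phase turns by at most
   [2 M D = 1], a range in which chord and angle are comparable. *)
pose D := 1 / (2 * M).
have D0 : 0 < D by rewrite divr_gt0// mulr_gt0.
have cc0 : 0 < cut_const lam Cl M.
  by rewrite /cut_const !mulr_gt0 ?expR_gt0 ?(rg_Cl0 G) ?(rg_lam0 G).
pose L0 := cut_const lam Cl M * D * `|k1 - k0|.
have L00 : 0 < L0.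
  by apply: mulr_gt0 (mulr_gt0 cc0 D0) _; rewrite normr_gt0 subr_eq0 eq_sym.
have om0 : 0 < c * L0 / 16 by apply: divr_gt0 => //; exact: mulr_gt0.
have om1 : 0 < 8 * (M + 1) by lra.
have q4 : 0 < 1 / 4 :> R by lra.
have [rho rho0 Hrho] := @exists_pos_le [:: D; c * L0 / 16 / (8 * (M + 1)); 1 / 4] ltac:(
  by move=> x; rewrite !inE => /or3P[] /eqP ->; [|exact: divr_gt0 om0 om1|]).
have d20 : 0 < (c * L0 / 16) ^+ 2 / 16 by apply: divr_gt0 => //; exact: exprn_gt0.
have d30 : 0 < M * rho / 2 by apply: divr_gt0 => //; exact: mulr_gt0.
have [d d0 Hd] := @exists_pos_le [:: 1 / 4; (c * L0 / 16) ^+ 2 / 16; M * rho / 2] ltac:(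
  by move=> x; rewrite !inE => /or3P[] /eqP ->).
have rhoD : rho <= D by rewrite Hrho// !inE eqxx.
have rhoom : rho <= c * L0 / 16 / (8 * (M + 1)) by rewrite Hrho// !inE eqxx orbT.
have rho4 : rho <= 1 / 4 by rewrite Hrho// !inE eqxx !orbT.
have d4 : d <= 1 / 4 by rewrite Hd// !inE eqxx.
have dom : d <= (c * L0 / 16) ^+ 2 / 16 by rewrite Hd// !inE eqxx orbT.
have drho : d <= M * rho / 2 by rewrite Hd// !inE eqxx !orbT.
have D20 : 0 < 2 * D by exact: mulr_gt0.
(* Words [e0], [e1] of length [m] code [k0], [k1]. Inside a cylinder of scale [D / |b|], the
   corresponding subcylinder stays within [rho / (2 |b|)] of the cancellation point, where the bump
   is at least 1/2. *)
have [m Hm] := exists_small_pow kap01 (divr_gt0 (divr_gt0 rho0 D20) Cu0).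
rewrite ltr_pdivlMr// mulrC in Hm.
have [e0 [se0 [k0' Kk0' E0]]] := attractor_word K_attr m Kk0.
have [e1 [se1 [k1' Kk1' E1]]] := attractor_word K_attr m Kk1.
have e0m : e0 \in words A m by rewrite mem_words se0.
have e1m : e1 \in words A m by rewrite mem_words se1.
pose ps := Num.min (pr e0) (pr e1).
have ps0 : 0 < ps by rewrite lt_min !(pw_gt0 (rg_prob G)).
pose sg := d / 2 * Num.min (pr al) (pr be).
have sg0 : 0 < sg by rewrite mulr_gt0 ?divr_gt0// lt_min !(pw_gt0 (rg_prob G)).
have pw1 n w : w \in words A n -> pr w <= 1.
  move=> wn; rewrite -(sum_pw_words (rg_prob G) n) (big_rem w wn)/= lerDl.
  by apply: sumr_ge0 => u _; exact: (rg_pw_ge0 G).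
have sg1 : sg <= 1 / 2.
  have : Num.min (pr al) (pr be) <= 1 by rewrite ge_min (pw1 _ _ alN).
  have d2 : 0 <= d / 2 by rewrite divr_ge0// ltW.
  by move=> /(ler_wpM2l d2); rewrite -/sg; move: d4; clear -G; lra.
have ps1 : ps <= 1 by rewrite ge_min (pw1 _ _ e0m).
pose e := expR (1 : R).
have e_gt1 : 1 < e by rewrite expR_gt1.
(* [sg] is the pointwise gain near a cancellation point, [ps] the weight of the subcylinder and [e]
   the variation of the averaged square over one cylinder. The frequency threshold makes [D / |b|]
   less than 1, as [cut_set] requires, and less than [eta], so that phase separation applies inside
   each cylinder. *)
exists N, (1 - sg * ps / e), (1 + D + D / eta); split=> //.
- have e_gt0 : 0 < e by exact: expR_gt0.
  have h1 : 0 < sg * ps / e by exact: divr_gt0 (mulr_gt0 sg0 ps0) e_gt0.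
  have h2 : sg * ps / e <= 1 / 2.
    rewrite ler_pdivrMr//.
    have : sg * ps <= 1 / 2 * 1 by apply: ler_pM => //; exact: ltW.
    by move: e_gt1; clear -G; lra.
  by apply/andP; split; move: h1 h2; clear -G; lra.
- by have := divr_gt0 D0 eta0; move: D0; clear -G; lra.
move=> b f H bb FH.
have De0 : 0 < D / eta by rewrite divr_gt0.
have b_gt0 : 0 < `|b| by move: bb D0 De0; clear -G; lra.
have b0 : b != 0 by rewrite -normr_gt0.
have [W HW HWd] := cut_set G (r := D / `|b|) ltac:(
  by rewrite divr_gt0//= ltr_pdivrMr// mul1r; move: bb De0; clear -G; lra).
pose kk (i : bool) := if i then k1 else k0.
pose ee (i : bool) := if i then e1 else e0.
have Hdv v x y : v \in W -> I x -> I y -> `|b| * `|phiw v y - phiw v x| <= D * `|y - x|.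
  move=> vW Ix Iy.
  have h := compose_dist G (fun z Iz => proj2 (andP (HWd v z vW Iz))) Ix Iy.
  rewrite (le_trans (ler_wpM2l (ltW b_gt0) h))// mulrA mulrCA mulfV ?gt_eqF// mulr1//.
(* Each cylinder offers cancellation near one of its images of [k0] and [k1], and which one depends
   on [f]; [i] records the choice. *)
have /choice[i Hi] : forall v, exists i : bool, v \in W ->
    forall x, I x -> `|b| * `|x - phiw v (kk i)| <= rho ->
    nc (transfer b N f x) <= average N H x -
      d * Num.min (pr al * H (phiw al x)) (pr be * H (phiw be x)).
  move=> v; have [vW|nvW] := boolP (v \in W); last by exists true.
  have Kx0 := attractor_compose K_attr v Kk0.
  have Ix0 := rg_I G v Ik0; have Ix1 := rg_I G v Ik1.
  have xD : `|b| * `|phiw v k1 - phiw v k0| <= D.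
    by apply: le_trans (Hdv v _ _ vW Ik0 Ik1) _; rewrite ler_piMr ?I01_dist// ltW.
  have xL : L0 <= `|b| * `|phiw v k1 - phiw v k0|.
    have [t It ->] := rg_mvt G v Ik0 Ik1; have /andP[h _] := HWd v t vW It.
    rewrite mulrA ler_wpM2r//; apply: le_trans (ler_wpM2l (ltW b_gt0) h).
    rewrite [leRHS](_ : _ = cut_const lam Cl M * D)//; field.
    by rewrite gt_eqF.
  have xeta : `|phiw v k1 - phiw v k0| < eta.
    have xDb : `|phiw v k1 - phiw v k0| <= D / `|b| by rewrite ler_pdivlMr// mulrC.
    by apply: le_lt_trans xDb _; rewrite ltr_pdivrMr// mulrC -ltr_pdivrMr//; move: bb D0;
      clear -G; lra.
  have [z zz Hz] := @transfer_cancel N al be b c L0 rho d f H (phiw v k0) (phiw v k1)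
    alN beN albe b0 c0 L00 kN4 kN1 kNc (ltW rho0) rhoD rhoom rho4 d4 dom FH Ix0 Ix1 xD
    xL (Hphase _ _ Kx0 Ix1 xeta).
  by case: zz => zz; [exists false|exists true] => _; rewrite /= -zz.
have [Hcone Hsup Hgain] := @cone_cut N al be b rho d f H (transfer b N f) W
  (fun v => phiw v (kk (i v))) alN beN b0 kN4 rho0
  ltac:(by apply/andP; split; move: d0 d4; clear -G; lra) drho FH erefl
  (fun x v Ix vW xv => Hi v vW x Ix xv).
eexists; first exact: Hcone.
set H1 := (fun x => average N H x - _) in Hcone Hsup Hgain *.
have bH1 : bmeas I (fun x => H1 x ^+ 2) by apply/bmeas_exp/(dc_meas Hcone).
have bH2 : bmeas I (fun x => H x ^+ 2) by apply/bmeas_exp/(dc_meas FH).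
set T := average N (fun t => H t ^+ 2) in Hsup Hgain.
have bT : bmeas I T by exact: bmeas_average.
rewrite -[E (fun x => H x ^+ 2)](E_average N)// -/T.
(* Both integrals are split along the cut set, and every cylinder saves the same proportion. *)
rewrite (HW _ bH1) (HW _ bT) mulr_sumr big_seq [leRHS]big_seq; apply: ler_sum => v vW.
rewrite mulrCA ler_wpM2l ?(rg_pw_ge0 G)//.
have T0 x : I x -> 0 <= T x by move=> Ix; apply: average_ge0 => // y _; exact: sqr_ge0.
apply: (@le_trans _ _ ((1 - sg * pr (ee (i v)) / e) * E (T \o phiw v))); last first.
  apply: ler_wpM2r; first by apply: E_ge0 => x Ix /=; apply/T0/(rg_I G).
  rewrite lerB// ler_pM2r ?invr_gt0 ?expR_gt0//.
  by rewrite ler_pM2l// /ps /ee; case: (i v); rewrite ge_min lexx ?orbT.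
apply: (@E_gain_cylinder m) => //.
- by rewrite /ee; case: (i v).
- exact: ltW.
- move=> x Ix; apply: (Hgain _ v) => //; first by do 2 apply: (rg_I G).
  have [k' Kk' ->] : exists2 k', K k' & kk (i v) = phiw (ee (i v)) k'.
    by rewrite /kk /ee; case: (i v); [exists k1'|exists k0'].
  have see : size (ee (i v)) = m by rewrite /ee; case: (i v).
  have Ik' := attractor_I K_attr Kk'.
  apply: le_trans (Hdv v _ _ vW _ _) _; [exact: (rg_I G)|exact: (rg_I G)|].
  have := compose_dist G (fun z Iz => normder_le G (ee (i v)) Iz) Ik' Ix.
  rewrite see => h.
  have h2 : `|phiw (ee (i v)) x - phiw (ee (i v)) k'| <= Cu * kap ^+ m.
    by apply: le_trans h _; rewrite ler_piMr ?I01_dist// mulr_ge0 ?exprn_ge0// ltW.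
  have := le_trans h2 (ltW Hm); rewrite ler_pdivlMr; last by rewrite mulr_gt0.
  move: (`|_ - _|) => y; clear -G; lra.
- move=> x y Ix Iy; have Ivx := rg_I G v Ix; have Ivy := rg_I G v Iy.
  have B0 : 0 <= 4 * M by rewrite mulr_ge0// ltW.
  apply: le_trans (average_sqr_log N B0 FH Ivy Ivx) _.
  rewrite ler_wpM2r ?T0// /e ler_expR.
  have := Hdv v _ _ vW Iy Ix => h.
  have h2 : `|b| * `|phiw v x - phiw v y| <= D.
    by apply: le_trans h _; rewrite ler_piMr ?I01_dist// ltW.
  have -> : 2 * (4 * M * (Cu * kap ^+ N) * `|b| * `|phiw v x - phiw v y|) =
    8 * M * (Cu * kap ^+ N) * (`|b| * `|phiw v x - phiw v y|) by ring.
  have kN0 := kN_ge0 N.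
  apply: (@le_trans _ _ (8 * M * (Cu * kap ^+ N) * D)).
    by rewrite ler_wpM2l// mulr_ge0//; move: B0; clear -G; lra.
  have -> : 8 * M * (Cu * kap ^+ N) * D = 4 * (Cu * kap ^+ N) by rewrite /D; field;
    rewrite gt_eqF.
  by move: kN4; clear -G; lra.
- exact: expR_gt0.
Qed.

End TransferOperator.

(** * Characteristic functions of [theta] along random words *)

Section MellinDecay.
Variables (R : realType) (A : finType) (phi : A -> R -> R) (p : A -> R)
  (mu : probability R R) (kap lam Cu Cl M : R).
Hypothesis G : regular_ifs phi p mu kap lam Cu Cl M.

Local Notation I := (@I01 R).
Local Notation phiw := (compose phi).
Local Notation E := (Emu mu).
Local Notation nc := (@Normc.normc R).
Local Notation pr := (pw p).
Implicit Types (w u v : seq A) (f : R -> R[i]) (H : R -> R).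

Lemma transfer_comp b m n f x : I x ->
  transfer phi p b n (transfer phi p b m f) x = transfer phi p b (m + n) f x.
Proof.
move=> Ix; rewrite /transfer sum_words_cat exchange_big/=; apply: eq_bigr => u _.
rewrite !mulr_sumr; apply: eq_bigr => w _.
rewrite pw_cat compose_cat (rg_cat G)// mulrDr expiD rmorphM/=; ring.
Qed.

Lemma eq_dcone B be f g H : (forall x, I x -> f x = g x) ->
  dcone B be f H -> dcone B be g H.
Proof.
move=> fg [a1 a2 a3 a4 a5]; split=> // [x Ix|x y Ix Iy]; rewrite -!fg//; [exact: a3|exact: a4].
Qed.

Lemma dcone1 B be : 0 <= B -> 0 <= be -> dcone B be (fun=> 1 : R[i]) (fun=> 1).
Proof.
move=> B0 be0; split=> // [|x _|x y _ _|x y _ _].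
- exact: bmeas_cst.
- by rewrite -expi0 normc_expi.
- by rewrite subrr /= expr0n/= addr0 sqrtr0 !mulr_ge0.
- by rewrite mulr1 -[leLHS]expR0 ler_expR !mulr_ge0.
Qed.

Lemma dolgopyat_iterate N rho b0 :
  cone_contraction phi p mu M N rho b0 -> 0 <= rho ->
  forall J b, b0 <= `|b| -> exists2 H, dcone (4 * M) `|b| (transfer phi p b (N * J) (fun=> 1)) H &
    E (fun x => H x ^+ 2) <= rho ^+ J.
Proof.
move=> step rho0; elim=> [|J IH] b bb.
  exists (fun=> 1); last by under eq_fun do rewrite expr1n; rewrite (E_cst G) expr0.
  apply: eq_dcone (dcone1 _ _) => // [x Ix|]; last by rewrite mulr_ge0// ltW// (rg_M0 G).
  by rewrite muln0 /transfer big_seq1 /theta/= /pw big_nil normr1 ln1 mulr0 expi0 !mulr1.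
have [H FH EH] := IH b bb; have [H' FH' EH'] := step b _ H bb FH.
exists H'; last by rewrite exprS (le_trans EH')// ler_wpM2l.
by apply: eq_dcone FH' => x Ix; rewrite transfer_comp// mulnSr.
Qed.

(* Averaging over the words of [W] turns the [L^2(mu)] bound on the majorant into
   a pointwise one, since the majorant is nearly constant at scale [r]. *)
Lemma mellin_decay N rho b0 :
  cone_contraction phi p mu M N rho b0 -> 0 <= rho ->
  forall J b r W x, b0 <= `|b| -> stationary phi p mu W ->
    (forall u x, u \in W -> I x -> `|der phi u x| <= r) -> I x ->
    nc (\sum_(w <- words A (N * J)) \sum_(u <- W)
      (pr w * pr u)%:C * expi (b * theta phi (w ++ u) x)) ^+ 2 <=
    expR (8 * M * `|b| * r) * rho ^+ J.
Proof.
move=> step rho0 J b r W x bb HW Wr Ix.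
have [H FH EH] := dolgopyat_iterate step rho0 J bb.
have H0 y : I y -> 0 <= H y by move=> Iy; exact/ltW/(dc_pos FH).
have le1 : nc (\sum_(w <- words A (N * J)) \sum_(u <- W)
      (pr w * pr u)%:C * expi (b * theta phi (w ++ u) x)) <= \sum_(u <- W) pr u * H (phiw u x).
  rewrite exchange_big/=.
  have -> : \sum_(u <- W) \sum_(w <- words A (N * J)) (pr w * pr u)%:C * expi (b * theta phi (w
    ++ u) x) =
    \sum_(u <- W) (pr u)%:C * (expi (b * theta phi u x) * transfer phi p b (N * J) (fun=> 1)
      (phiw u x)).
    apply: eq_bigr => u _; rewrite /transfer !mulr_sumr; apply: eq_bigr => w _.
    by rewrite (rg_cat G)// mulrDr expiD rmorphM/= mulr1; ring.
  apply: le_trans (normc_sum _ _) _; apply: ler_sum => u _.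
  rewrite !Normc.normcM normc_real normc_expi mul1r ger0_norm ?(rg_pw_ge0 G)//.
  by rewrite ler_wpM2l ?(rg_pw_ge0 G)//; apply: (dc_le FH); exact: (rg_I G).
have S0 : 0 <= \sum_(u <- W) pr u * H (phiw u x).
  by apply: sumr_ge0 => u _; rewrite mulr_ge0 ?(rg_pw_ge0 G)//; apply/H0/(rg_I G).
apply: (@le_trans _ _ ((\sum_(u <- W) pr u * H (phiw u x)) ^+ 2)).
  by rewrite lerXn2r ?nnegrE ?normc_ge0.
apply: le_trans (weighted_jensen _ (rg_pw_ge0 G) (stationary_sum1 G HW)) _.
apply: le_trans (ler_wpM2l (expR_ge0 _) EH).
have bH2 : bmeas I (fun x => H x ^+ 2) by apply/bmeas_exp/(dc_meas FH).
rewrite (HW _ bH2) mulr_sumr big_seq [leRHS]big_seq; apply: ler_sum => u uW.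
rewrite [leRHS]mulrCA ler_wpM2l ?(rg_pw_ge0 G)// -(E_scale G); last exact: (bmeas_comp G).
rewrite -[leLHS](E_cst G); apply: (E_le G) => [||y Iy].
- exact: bmeas_cst.
- by apply: bmeas_scale; exact: (bmeas_comp G).
have Iux := rg_I G u Ix; have Iuy := rg_I G u Iy.
rewrite /= (_ : 8 * M * `|b| * r = 2%:R * (4 * M * `|b| * r)); last by ring.
rewrite expRM_natl -exprMn lerXn2r ?nnegrE ?H0//; first by rewrite mulr_ge0 ?expR_ge0 ?H0.
apply: le_trans (dc_log FH Iuy Iux) _; rewrite ler_wpM2r ?H0// ler_expR.
have M0 := rg_M0 G.
rewrite ler_wpM2l//; first by rewrite mulr_ge0//; lra.
have h := compose_dist G (fun z Iz => Wr u z uW Iz) Iy Ix.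
have r0 : 0 <= r by apply: le_trans (Wr u x uW Ix).
by apply: le_trans h _; rewrite ler_piMr// I01_dist.
Qed.

End MellinDecay.

(** * Large deviations *)
Section LargeDeviations.
Variable R : realType.

Lemma expR_le_quadratic (t : R) : `|t| <= 1 / 4 -> expR t <= 1 + t + t ^+ 2.
Proof.
rewrite ler_norml => /andP[t0 t1].
have e0 := expR_gt0 t.
have h : (1 - t / 2) ^+ 2 <= expR (- t).
  have -> : - t = 2%:R * - (t / 2) by field.
  rewrite expRM_natl lerXn2r ?nnegrE ?expR_ge0//; first lra.
  by have := expR_ge1Dx (- (t / 2)).
have e1 : expR t * expR (- t) = 1 by rewrite -expRD subrr expR0.
have h1 : expR t * (1 - t / 2) ^+ 2 <= 1 by rewrite -[leRHS]e1 ler_pM2l.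
have h2 : 1 <= (1 + t + t ^+ 2) * (1 - t / 2) ^+ 2.
  have -> : (1 + t + t ^+ 2) * (1 - t / 2) ^+ 2 = 1 + t ^+ 2 * ((1 - 3 * t + t ^+ 2) / 4) by
    field.
  rewrite lerDl mulr_ge0 ?sqr_ge0// divr_ge0//.
  by have := sqr_ge0 t; lra.
have h3 : 0 < (1 - t / 2) ^+ 2 by rewrite exprn_gt0//; lra.
by rewrite -(ler_pM2r h3); exact: le_trans h2.
Qed.

Variables (A : finType) (p : A -> R).
Hypothesis p_prob : probability_vector p.
Local Notation pr := (pw p).
Implicit Types (w u : seq A).

(* Chernoff's bound over [j] independent blocks of [q] letters; [X] is
   subadditive only up to [C1], which is why blocks must be long. *)
Lemma upper_deviation (X : seq A -> R) (q : nat) (B C1 eps : R) :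
  0 < B -> 0 < eps -> C1 <= eps / 4 -> X [::] <= 0 ->
  (forall w, w \in words A q -> `|X w| <= B) ->
  (forall w u, X (w ++ u) <= X w + X u + C1) ->
  exists2 c, 0 < c & forall j,
    \sum_(w <- words A (q * j) | (\sum_(u <- words A q) pr u * X u + eps) * j%:R < X w) pr w
      <= expR (- (c * j%:R)).
Proof.
move=> B0 eps0 C1e X0 XB Xsub; set m := \sum_(u <- _) _.
have mB : `|m| <= B.
  apply: le_trans (ler_norm_sum _ _ _) _.
  apply: (@le_trans _ _ (\sum_(u <- words A q) pr u * B)); last first.
    by rewrite -mulr_suml (sum_pw_words p_prob) mul1r.
  rewrite big_seq [leRHS]big_seq; apply: ler_sum => u uq.
  by rewrite normrM ger0_norm ?(pw_ge0 p_prob)// ler_wpM2l ?(pw_ge0 p_prob) ?XB.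
(* The second bound keeps [s * (X u - m)] in the range of the quadratic estimate; the first gives
   [4 s^2 B^2 <= s eps / 4]. With [s C1 <= s eps / 4] half of [s eps] is left as the rate. *)
pose s := Num.min (eps / (16 * B ^+ 2)) (1 / (8 * B)).
have s0 : 0 < s by rewrite lt_min !divr_gt0 ?mulr_gt0 ?exprn_gt0.
have s1 : s <= eps / (16 * B ^+ 2) by rewrite ge_min lexx.
have s2 : s <= 1 / (8 * B) by rewrite ge_min lexx orbT.
have mgf1 : \sum_(u <- words A q) pr u * expR (s * X u) <= expR (s * m + 4 * s ^+ 2 * B ^+ 2).
  rewrite expRD; apply: (@le_trans _ _ (expR (s * m) * (1 + 4 * s ^+ 2 * B ^+ 2))); last first.
    by rewrite ler_wpM2l ?expR_ge0// expR_ge1Dx.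
  have -> : \sum_(u <- words A q) pr u * expR (s * X u) =
      expR (s * m) * \sum_(u <- words A q) pr u * expR (s * (X u - m)).
    rewrite mulr_sumr; apply: eq_bigr => u _; rewrite mulrCA -expRD; congr (_ * expR _); ring.
  rewrite ler_wpM2l ?expR_ge0//.
  apply: (@le_trans _ _ (\sum_(u <- words A q) (pr u * (1 + 4 * s ^+ 2 * B ^+ 2) + s * (pr u *
    X u) - s * m * pr u))).
    rewrite big_seq [leRHS]big_seq; apply: ler_sum => u uq.
    have Xm : `|X u - m| <= 2 * B.
      by rewrite (le_trans (ler_normB _ _))//; have := XB u uq; lra.
    have sX : `|s * (X u - m)| <= 1 / 4.
      rewrite normrM gtr0_norm//; have := ler_pM (ltW s0) (normr_ge0 _) s2 Xm.
      have -> : 1 / (8 * B) * (2 * B) = 1 / 4 by field; rewrite gt_eqF.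
      done.
    have := expR_le_quadratic sX => e1.
    have sq : (s * (X u - m)) ^+ 2 <= 4 * s ^+ 2 * B ^+ 2.
      have -> : 4 * s ^+ 2 * B ^+ 2 = s ^+ 2 * (2 * B) ^+ 2 by ring.
      rewrite exprMn ler_wpM2l ?sqr_ge0// -[leLHS]real_normK ?num_real//.
      by rewrite lerXn2r ?nnegrE//; lra.
    have := (pw_ge0 p_prob) u => pu;
      have : expR (s * (X u - m)) <= 1 + s * (X u - m) + 4 * s ^+ 2 * B ^+ 2 by lra.
    move=> /(ler_wpM2l pu); lra.
  rewrite sumrB big_split/= -mulr_suml -!mulr_sumr (sum_pw_words p_prob) -/m; lra.
have mgf j : \sum_(w <- words A (q * j)) pr w * expR (s * X w) <=
    expR ((s * C1 + s * m + 4 * s ^+ 2 * B ^+ 2) * j%:R).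
  elim: j => [|j IH].
    rewrite muln0 big_seq1 /pw big_nil mul1r mulr0 ler_expR.
    by rewrite pmulr_rle0.
  rewrite mulnSr sum_words_cat.
  apply: (@le_trans _ _ (\sum_(w <- words A (q * j)) (pr w * expR (s * X w)) *
      (expR (s * C1) * \sum_(u <- words A q) pr u * expR (s * X u)))).
    apply: ler_sum => w _; rewrite mulr_sumr mulr_sumr; apply: ler_sum => u _.
    rewrite pw_cat.
    have -> : pr w * expR (s * X w) * (expR (s * C1) * (pr u * expR (s * X u))) =
      (pr w * pr u) * (expR (s * X w + s * X u + s * C1)) by rewrite !expRD; ring.
    rewrite ler_wpM2l ?mulr_ge0 ?(pw_ge0 p_prob)// ler_expR -!mulrDr.
    by rewrite ler_pM2l.
  rewrite -mulr_suml -[j.+1]addn1 natrD mulrDr mulr1 expRD.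
  apply: ler_pM => //.
  - by apply: sumr_ge0 => w _; rewrite mulr_ge0 ?(pw_ge0 p_prob) ?expR_ge0.
  - by rewrite mulr_ge0 ?expR_ge0// sumr_ge0// => w _;
    rewrite mulr_ge0 ?(pw_ge0 p_prob) ?expR_ge0.
  - by rewrite -addrA [leRHS]expRD ler_wpM2l ?expR_ge0.
exists (s * eps / 2); first by rewrite divr_gt0// mulr_gt0.
move=> j.
apply: (@le_trans _ _ (expR (- (s * ((m + eps) * j%:R))) * \sum_(w <- words A (q * j)) pr w *
  expR (s * X w))).
  rewrite mulr_sumr big_mkcond; apply: ler_sum => w _ /=.
  case: ifPn => [lt|_]; last by rewrite !mulr_ge0 ?(pw_ge0 p_prob) ?expR_ge0.
  rewrite mulrCA ler_peMr ?(pw_ge0 p_prob)//.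
  by rewrite -expRD -[leLHS]expR0 ler_expR addrC subr_ge0 ler_pM2l// ltW.
apply: le_trans (ler_wpM2l (expR_ge0 _) (mgf j)) _.
rewrite -expRD ler_expR.
have j0 : 0 <= j%:R :> R by [].
have k1 : 4 * s ^+ 2 * B ^+ 2 <= s * eps / 4.
  have B2 : 0 < 16 * B ^+ 2 by rewrite mulr_gt0// exprn_gt0.
  move: s1; rewrite ler_pdivlMr// => s1'.
  have := ler_wpM2l (ltW s0) s1'; lra.
have k2 : s * C1 <= s * eps / 4 by have := ler_wpM2l (ltW s0) C1e; lra.
have : (s * C1 + s * m + 4 * s ^+ 2 * B ^+ 2 - s * (m + eps) + s * eps / 2) * j%:R <= 0.
  by rewrite mulr_le0_ge0//; lra.
lra.
Qed.

End LargeDeviations.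

Section ThetaDeviation.
Variables (R : realType) (A : finType) (phi : A -> R -> R) (p : A -> R)
  (mu : probability R R) (kap lam Cu Cl M : R).
Hypothesis G : regular_ifs phi p mu kap lam Cu Cl M.
Local Notation pr := (pw p).

Definition theta_rate := - ln lam + `|ln Cl| + `|ln Cu| + 1.

Lemma theta_rate_gt0 : 0 < theta_rate.
Proof.
rewrite /theta_rate ltr_wpDl// !addr_ge0// oppr_ge0 ltW// ln_lt0//.
by rewrite (rg_lam0 G) (rg_lam1 G).
Qed.

(** The constants [Cl] and [Cu] are charged to the letters, which requires at least one. *)
Lemma theta_bound w x : (0 < size w)%N -> I01 x -> `|theta phi w x| <= theta_rate * (size w)%:R.
Proof.
move=> sw Ix; have /andP[h1 h2] := rg_der G w Ix.
have q1 : 1 <= (size w)%:R :> R by rewrite ler1n.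
have d0 : 0 < `|der phi w x| by rewrite -(rg_expR G w Ix) expR_gt0.
have lam0 := rg_lam0 G; have kap0 := rg_kap0 G; have Cl0 := rg_Cl0 G; have Cu0 := rg_Cu0 G.
have l1 : ln Cl + (size w)%:R * ln lam <= theta phi w x.
  rewrite mulr_natl -lnXn// -lnM ?posrE ?exprn_gt0// ler_ln ?posrE ?mulr_gt0 ?exprn_gt0//.
have l2 : theta phi w x <= ln Cu.
  rewrite ler_ln ?posrE//; apply: le_trans h2 _; rewrite ler_piMr ?exprn_ile1 ?ltW ?(rg_kap1 G)//.
have ll : ln lam < 0 by rewrite ln_lt0// lam0 (rg_lam1 G).
have a1 := ler_norm (ln Cu); have a2 := ler_norm (- ln Cl); rewrite normrN in a2.
have b1 : `|ln Cl| <= `|ln Cl| * (size w)%:R by rewrite ler_peMr.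
have b2 : `|ln Cu| <= `|ln Cu| * (size w)%:R by rewrite ler_peMr.
have b3 : 0 <= - ln lam * (size w)%:R by rewrite mulr_ge0//; lra.
have n1 := normr_ge0 (ln Cl); have n2 := normr_ge0 (ln Cu).
rewrite ler_norml /theta_rate; apply/andP; split; lra.
Qed.

(** The centre [m] is the mean of [theta] over a block of [q] letters; no Lyapunov exponent is
    involved. Blocks add up to within [M] each, which the third hypothesis lets [eps * q] absorb. *)
Lemma theta_deviation (eps : R) (q : nat) : 0 < eps -> (0 < q)%N -> M <= eps * q%:R / 4 ->
  exists m c, [/\ `|m| <= theta_rate * q%:R, 0 < c & forall j,
    \sum_(w <- words A (q * j) | eps * q%:R * j%:R < `|theta phi w 0 - m * j%:R|) pr w
      <= 2 * expR (- (c * j%:R))].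
Proof.
move=> e0 q0 Mq; have r0 := theta_rate_gt0; have q0' : 0 < q%:R :> R by rewrite ltr0n.
have P := rg_prob G; have I01_0 := @I01_0 R.
have XB w : w \in words A q -> `|theta phi w 0| <= theta_rate * q%:R.
  by move=> wq; have <- := size_words wq; apply: theta_bound; rewrite ?(size_words wq).
have th0 : theta phi [::] 0 = 0 by rewrite /theta/= normr1 ln1.
have sub w u : `|theta phi (w ++ u) 0 - (theta phi w 0 + theta phi u 0)| <= M.
  rewrite (rg_cat G)// opprD addrA addrAC addrK.
  have Iu := rg_I G u I01_0; apply: le_trans (rg_theta G w I01_0 Iu) _.
  by rewrite ler_piMr ?I01_dist//; exact/ltW/(rg_M0 G).
have rq : 0 < theta_rate * q%:R by rewrite mulr_gt0.
have eq0 : 0 < eps * q%:R by rewrite mulr_gt0.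
have [c1 c10 H1] := @upper_deviation R A p P (fun w => theta phi w 0) q (theta_rate * q%:R) M
  (eps * q%:R)
  rq eq0 Mq ltac:(by rewrite /= th0) XB
  ltac:(by move=> w u /=; have := sub w u; rewrite ler_norml; lra).
have [c2 c20 H2] := @upper_deviation R A p P (fun w => - theta phi w 0) q (theta_rate * q%:R) M
  (eps * q%:R)
  rq eq0 Mq ltac:(by rewrite /= th0 oppr0) ltac:(by move=> w wq /=; rewrite normrN XB)
  ltac:(by move=> w u /=; have := sub w u; rewrite ler_norml; lra).
set m := \sum_(u <- words A q) pr u * theta phi u 0 in H1.
have mE : \sum_(u <- words A q) pr u * - theta phi u 0 = - m.
  by rewrite -sumrN; apply: eq_bigr => u _; rewrite mulrN.
rewrite mE in H2.
exists m, (Num.min c1 c2); split.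
- apply: le_trans (ler_norm_sum _ _ _) _.
  apply: (@le_trans _ _ (\sum_(u <- words A q) pr u * (theta_rate * q%:R))); last first.
    by rewrite -mulr_suml (sum_pw_words P) mul1r.
  rewrite big_seq [leRHS]big_seq; apply: ler_sum => u uq.
  by rewrite normrM ger0_norm ?(rg_pw_ge0 G)// ler_wpM2l ?(rg_pw_ge0 G)// XB.
- by rewrite lt_min c10.
move=> j; have j0 : 0 <= j%:R :> R by [].
apply: (@le_trans _ _ (\sum_(w <- words A (q * j) | (m + eps * q%:R) * j%:R < theta phi w 0) pr
  w +
    \sum_(w <- words A (q * j) | (- m + eps * q%:R) * j%:R < - theta phi w 0) pr w)).
  rewrite big_mkcond [X in _ <= X + _]big_mkcond [X in _ <= _ + X]big_mkcond -big_split/=.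
  apply: ler_sum => w _.
  have pw0 := rg_pw_ge0 G w.
  case: ifPn => [|_]; last by rewrite addr_ge0//; case: ifP.
  rewrite lter_normr => /orP[h|h].
    have -> : (m + eps * q%:R) * j%:R < theta phi w 0 by lra.
    by rewrite lerDl; case: ifP.
  have -> : (- m + eps * q%:R) * j%:R < - theta phi w 0 by lra.
  by rewrite lerDr; case: ifP.
have := H1 j; have := H2 j.
have h1 : expR (- (c1 * j%:R)) <= expR (- (Num.min c1 c2 * j%:R)).
  by rewrite ler_expR lerN2 ler_wpM2r// ge_min lexx.
have h2 : expR (- (c2 * j%:R)) <= expR (- (Num.min c1 c2 * j%:R)).
  by rewrite ler_expR lerN2 ler_wpM2r// ge_min lexx orbT.
lra.
Qed.

End ThetaDeviation.

(** * Oscillatory sums *)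
Section OscillatorySum.
Variable R : realType.
Implicit Types (x y z t a b : R).

Lemma sin_pi_sub x : sin (pi - x) = sin x :> R.
Proof. by rewrite sinB sinpi cospi mul0r mulN1r opprK add0r. Qed.

Lemma sin_lower1 t : 0 <= t <= 1 -> t / 2 <= sin t :> R.
Proof.
move=> /andP[t0 t1]; have p2 := pi_ge2 R.
have s0 : 0 <= sin t by apply: sin_ge0_pi; lra.
by have := @sin_ge R t; rewrite (ger0_norm t0) (ger0_norm s0); apply.
Qed.

Lemma sin_lower t : 0 <= t -> t <= 3 * pi / 4 -> t / 12 <= sin t :> R.
Proof.
move=> t0 t1; have p2 := pi_ge2 R; have p4 := pihalf_lt2 R.
have s1 : 1 / 4 <= sin (1 / 2 : R) by have := @sin_lower1 (1 / 2); lra.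
have [tl|tl] := leP t 1; first by have := @sin_lower1 t; lra.
have inc (u : R) : 1 / 2 <= u <= pi / 2 -> 1 / 4 <= sin u.
  move=> /andP[u1 u2]; apply: le_trans s1 _; have [->//|ne] := eqVneq u (1 / 2).
  have lt : 1 / 2 < u by rewrite lt_neqAle eq_sym ne.
  by apply: ltW; rewrite ltr_sin// in_itv/=; apply/andP; split; lra.
have [th|th] := leP t (pi / 2).
  by have := inc t ltac:(lra); lra.
by have := inc (pi - t) ltac:(lra); rewrite sin_pi_sub; lra.
Qed.

(** The range goes beyond [pi] but stays away from [2 pi], the next zero of [1 - cos]. It is that of
    [om * (z - y)] for [|z| <= L] and [|y| <= 2 L]: the averaging window is twice as wide as the
    range of [z] for this reason. *)
Lemma one_sub_cos_lower x : `|x| <= 3 * pi / 2 -> x ^+ 2 / 288 <= 1 - cos x.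
Proof.
move=> xb; rewrite cos_half.
have h : `|x| / 24 <= `|sin (x / 2)|.
  have [x0|x0] := leP 0 x.
    rewrite (ger0_norm x0) in xb *; have := @sin_lower (x / 2) ltac:(lra) ltac:(lra).
    by move=> h; apply: le_trans (ler_norm _); lra.
  rewrite (ltr0_norm x0) in xb *; have := @sin_lower (- x / 2) ltac:(lra) ltac:(lra).
  rewrite mulNr sinN => h; rewrite -normrN; apply: le_trans (ler_norm _); lra.
have h2 : (`|x| / 24) ^+ 2 <= `|sin (x / 2)| ^+ 2 by rewrite lerXn2r ?nnegrE ?divr_ge0.
move: h2; rewrite expr_div_n !real_normK ?num_real//; lra.
Qed.

Definition dirichlet n x : R := 1 + 2 * \sum_(1 <= k < n.+1) cos (k%:R * x).

Lemma dirichlet_mul n x :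
  (1 - cos x) * dirichlet n x = cos (n%:R * x) - cos (n.+1%:R * x).
Proof.
rewrite /dirichlet; elim: n => [|n IH].
  by rewrite big_geq// mulr0 addr0 mulr1 mul0r cos0 mul1r.
rewrite big_nat_recr//=; set S := \sum_(_ <= _ < _) _ in IH *.
have E : cos (n.+2%:R * x) + cos (n%:R * x) = 2 * cos (n.+1%:R * x) * cos x.
  have -> : n.+2%:R * x = n.+1%:R * x + x by rewrite -[n.+2]addn1 natrD; ring.
  have -> : n%:R * x = n.+1%:R * x - x by rewrite -[n.+1]addn1 natrD; ring.
  by rewrite cosD cosB; ring.
lra.
Qed.

Definition fejer n x : R := n%:R^-1 * \sum_(0 <= j < n) dirichlet j x.

Lemma fejer_mul n x : (0 < n)%N -> (1 - cos x) * fejer n x = n%:R^-1 * (1 - cos (n%:R * x)).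
Proof.
move=> n0; rewrite /fejer mulrCA; congr (_ * _); elim: n {n0} => [|n IH].
  by rewrite big_geq// mulr0 mul0r cos0 subrr.
by rewrite big_nat_recr//= mulrDr IH dirichlet_mul; ring.
Qed.

Lemma cos_mul_eq1 n x : cos x = 1 -> cos (n%:R * x) = 1.
Proof.
move=> c1; have s0 : sin x = 0.
  by apply/eqP; rewrite -sqrf_eq0 sin2cos2 c1 expr1n subrr.
suff [] : cos (n%:R * x) = 1 /\ sin (n%:R * x) = 0 by [].
elim: n => [|n [IHc IHs]]; first by rewrite mul0r cos0 sin0.
rewrite -[n.+1]addn1 natrD mulrDl mul1r cosD sinD IHc IHs c1 s0.
by rewrite !mul0r !mulr0 mulr1 subr0 addr0.
Qed.

Lemma fejer_ge0 n x : (0 < n)%N -> 0 <= fejer n x.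
Proof.
(* Where [cos x = 1] the closed form degenerates to [0 = 0], but there every [cos (k x)] is 1. *)
move=> n0; have [c1|cn] := eqVneq (cos x) 1.
  rewrite /fejer mulr_ge0 ?invr_ge0// sumr_ge0// => j _.
  rewrite /dirichlet addr_ge0// mulr_ge0// sumr_ge0// => k _.
  by rewrite cos_mul_eq1.
have c1 : 0 < 1 - cos x by rewrite subr_gt0 lt_neqAle cn cos_le1.
by rewrite -(pmulr_rge0 _ c1) fejer_mul// mulr_ge0 ?invr_ge0// subr_ge0 cos_le1.
Qed.

Lemma Rintegral_FTC (F f : R -> R) a b : a < b -> (forall y, is_derive y (1 : R) F (f y)) ->
  continuous f -> \int[lebesgue_measure]_(y in `[a, b]) f y = F b - F a.
Proof.
move=> ab dF cf; have cF y : {for y, continuous F}.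
  by apply: differentiable_continuous; apply/derivable1_diffP; have [] := dF y.
rewrite /Rintegral (continuous_FTC2 (F := F) ab)//.
- exact: continuous_subspaceT.
- split=> [y _||]; [by have [] := dF y|exact/cvg_at_right_filter/cF|exact/cvg_at_left_filter/cF].
- by move=> y _; rewrite derive1E; have [_] := dF y.
Qed.

Lemma cos_lip x y : `|cos x - cos y| <= `|x - y|.
Proof.
have -> : cos x - cos y = - 2 * sin ((x + y) / 2) * sin ((x - y) / 2).
  have -> : cos x = cos ((x + y) / 2 + (x - y) / 2) by congr cos; field.
  have -> : cos y = cos ((x + y) / 2 - (x - y) / 2) by congr cos; field.
  by rewrite cosD cosB; ring.
have := sin_le ((x - y) / 2); rewrite !normrM normrN !normr_nat normfV normr_nat => h.
have : `|sin ((x + y) / 2)| <= 1 by exact: sin_max.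
have : 0 <= `|sin ((x - y) / 2)| by []; move: `|sin _| `|sin _| h => u v; nra.
Qed.

Lemma expR_lip c x y : x <= c -> y <= c -> `|expR x - expR y| <= expR c * `|x - y|.
Proof.
wlog yx : x y / y <= x => [H xc yc|xc _].
  by have /orP[le|le] := le_total x y; [rewrite distrC (distrC x); apply: H|apply: H].
rewrite !ger0_norm ?subr_ge0 ?ler_expR//.
have -> : expR x - expR y = expR x * (1 - expR (y - x)).
  by rewrite mulrBr mulr1 -expRD (_ : x + (y - x) = y)//; ring.
apply: ler_pM; rewrite ?expR_ge0 ?ler_expR//.
  by rewrite subr_ge0 -[leRHS]expR0 ler_expR subr_le0.
by have := expR_ge1Dx (y - x); lra.
Qed.

Section Interval.
Variables (L : R).
Hypothesis L1 : 1 <= L.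
Let D : set (measurableTypeR R) := `[- (2 * L), 2 * L]%classic.

Lemma measurable_window : measurable D. Proof. exact: measurable_itv. Qed.

Let leb : {measure set (measurableTypeR R) -> \bar R} := @lebesgue_measure R.

Lemma lebesgue_window : leb D = (4 * L)%:E.
Proof.
apply: etrans (lebesgue_measure_itv _) _; rewrite /= lte_fin ifT; last by have := L1; lra.
by rewrite -EFinB; congr (_%:E); ring.
Qed.

Lemma lebesgue_window_fin : (leb D < +oo)%E.
Proof. by rewrite lebesgue_window ltry. Qed.

Definition mean (g : R -> R) : R := (4 * L)^-1 * Rintegral leb D g.

Lemma inv_width_gt0 : 0 < (4 * L)^-1.
Proof. by rewrite invr_gt0; have := L1; lra. Qed.

Lemma mean_cst (c : R) : mean (fun=> c) = c.
Proof.
rewrite /mean Rintegral_cst; last exact: measurable_window.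
by have l1 := L1; rewrite lebesgue_window/=; field; lra.
Qed.

Lemma bmeas_leb_integrable g : bmeas D g -> leb.-integrable D (EFin \o g).
Proof.
move=> [mg [M HM]]; apply: measurable_bounded_integrable.
- exact: measurable_window.
- exact: lebesgue_window_fin.
- exact: mg.
- by exists M; split; rewrite ?num_real // => y My x Dx /=; apply: le_trans (HM x Dx) _;
  exact: ltW.
Qed.

Lemma mean_add f g : bmeas D f -> bmeas D g -> mean (fun y => f y + g y) = mean f + mean g.
Proof.
move=> /bmeas_leb_integrable Hf /bmeas_leb_integrable Hg; rewrite /mean -mulrDr; congr (_ * _).
exact: RintegralD measurable_window Hf Hg.
Qed.

Lemma mean_scale (c : R) g : bmeas D g -> mean (fun y => c * g y) = c * mean g.
Proof.
move=> /bmeas_leb_integrable Hg; rewrite /mean [RHS]mulrCA; congr (_ * _).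
exact: RintegralZl c measurable_window Hg.
Qed.

Lemma mean_sum (T : Type) (s : seq T) (F : T -> R -> R) : (forall i, bmeas D (F i)) ->
  mean (fun y => \sum_(i <- s) F i y) = \sum_(i <- s) mean (F i).
Proof.
move=> H; elim: s => [|a s IH].
  by rewrite big_nil -[RHS](mean_cst 0); congr mean; apply/funext => y; rewrite big_nil.
rewrite big_cons -IH -mean_add//; last exact: bmeas_sum.
by congr mean; apply/funext => y; rewrite big_cons.
Qed.

Lemma mean_le f g : bmeas D f -> bmeas D g -> (forall y, D y -> f y <= g y) -> mean f <= mean g.
Proof.
move=> /bmeas_leb_integrable Hf /bmeas_leb_integrable Hg fg;
  rewrite /mean ler_pM2l ?inv_width_gt0//.
exact: le_Rintegral measurable_window Hf Hg fg.
Qed.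

Lemma mean_norm f : bmeas D f -> `|mean f| <= mean (fun y => `|f y|).
Proof.
move=> /bmeas_leb_integrable Hf;
  rewrite /mean normrM gtr0_norm ?inv_width_gt0// ler_pM2l ?inv_width_gt0//.
exact: le_normr_Rintegral measurable_window Hf.
Qed.

Lemma mean_norm_le f (c : R) : bmeas D f -> (forall y, D y -> `|f y| <= c) -> `|mean f| <= c.
Proof.
move=> Hf fc; apply: le_trans (mean_norm Hf) _; rewrite -[leRHS]mean_cst.
by apply: mean_le => //; [exact: bmeas_norm|exact: bmeas_cst].
Qed.

Lemma mean_FTC (F f : R -> R) : (forall y, is_derive y (1 : R) F (f y)) -> continuous f ->
  mean f = (4 * L)^-1 * (F (2 * L) - F (- (2 * L))).
Proof. by move=> dF cf; rewrite /mean (Rintegral_FTC _ dF cf)//; have := L1; lra. Qed.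

Lemma measurable_affine (k z : R) : measurable_fun D (fun y => k * (z - y)).
Proof.
apply: measurable_funS (measurableT) (@subsetT _ _) _.
apply: continuous_measurable_fun => y; apply: cvgM; first exact: cvg_cst.
by apply: cvgB; [exact: cvg_cst|exact: cvg_id].
Qed.

Lemma continuous_affine (k z : R) : continuous (fun y => k * (z - y)).
Proof.
move=> y; apply: cvgM; first exact: cvg_cst.
by apply: cvgB; [exact: cvg_cst|exact: cvg_id].
Qed.

Lemma continuous_cos_affine (k z : R) : continuous (fun y => cos (k * (z - y))).
Proof.
by move=> y; apply: continuous_comp; [exact: continuous_affine|exact: continuous_cos].
Qed.

Lemma continuous_sin_affine (k z : R) : continuous (fun y => sin (k * (z - y))).
Proof.
by move=> y; apply: continuous_comp; [exact: continuous_affine|exact: continuous_sin].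
Qed.

(* The frequencies [k%:R * om] are those of period [4 * L], the window's width. *)
Let om := pi / (2 * L).

Lemma mean_cos_affine (k : nat) z : (0 < k)%N -> mean (fun y => cos (k%:R * (om * (z - y)))) = 0.
Proof.
move=> k0; have l1 := L1; have p2 := pi_ge2 R.
have om0 : 0 < om by rewrite divr_gt0//; lra.
have ko : 0 < k%:R * om by rewrite mulr_gt0// ltr0n.
have -> : (fun y => cos (k%:R * (om * (z - y)))) = (fun y => cos (k%:R * om * (z - y))).
  by apply/funext => y; rewrite mulrA.
have dF y : is_derive y (1 : R) (fun y => - (k%:R * om)^-1 * sin (k%:R * om * (z - y)))
    (cos (k%:R * om * (z - y))).
  apply: is_derive_eq; move: (k%:R * om) ko => c c0.
  by rewrite /GRing.scale/=; field; rewrite gt_eqF.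
rewrite (mean_FTC dF); last exact: continuous_cos_affine.
have -> : k%:R * om * (z - - (2 * L)) = k%:R * om * (z - 2 * L) + pi *+ 2 *+ k.
  rewrite -mulr_natr -[pi *+ 2]mulr_natr /om; field; lra.
by rewrite (periodicn (@sinD2pi R)) subrr mulr0.
Qed.

Lemma bmeas_cos_affine (k : nat) z : bmeas D (fun y => cos (k%:R * (om * (z - y)))).
Proof.
apply: bmeas_cos; under eq_fun do rewrite mulrA.
exact: measurable_affine.
Qed.

Lemma bmeas_dirichlet j z : bmeas D (fun y => dirichlet j (om * (z - y))).
Proof.
apply: bmeas_add; first exact: bmeas_cst.
by apply: bmeas_scale; apply: bmeas_sum => k; exact: bmeas_cos_affine.
Qed.

Lemma bmeas_fejer n z : bmeas D (fun y => fejer n (om * (z - y))).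
Proof. by apply: bmeas_scale; apply: bmeas_sum => j; exact: bmeas_dirichlet. Qed.

Lemma mean_dirichlet j z : mean (fun y => dirichlet j (om * (z - y))) = 1.
Proof.
rewrite /dirichlet mean_add.
- rewrite mean_cst mean_scale; last by apply: bmeas_sum => k; exact: bmeas_cos_affine.
  rewrite mean_sum; last by move=> k; exact: bmeas_cos_affine.
  rewrite big_nat big1 ?mulr0 ?addr0// => k /andP[k0 _].
  exact: mean_cos_affine.
- exact: bmeas_cst.
- by apply: bmeas_scale; apply: bmeas_sum => k; exact: bmeas_cos_affine.
Qed.

Lemma mean_fejer n z : (0 < n)%N -> mean (fun y => fejer n (om * (z - y))) = 1.
Proof.
move=> n0; rewrite /fejer mean_scale; last by apply: bmeas_sum => j; exact: bmeas_dirichlet.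
rewrite mean_sum; last by move=> j; exact: bmeas_dirichlet.
under eq_bigr do rewrite mean_dirichlet.
by rewrite sumr_const_nat subn0 mulVf// pnatr_eq0 -lt0n.
Qed.

Variable tau : R.
Hypothesis tau0 : 0 < tau.
Let h y : R := cos (tau * expR y).

Lemma continuous_tau_expR : continuous (fun y : R => tau * expR y).
Proof. by move=> y; apply: cvgM; [exact: cvg_cst|exact: continuous_expR]. Qed.

Lemma measurable_tau_expR : measurable_fun D (fun y => tau * expR y).
Proof.
apply: measurable_funS (measurableT) (@subsetT _ _) _.
exact: continuous_measurable_fun continuous_tau_expR.
Qed.

Lemma bmeas_phase : bmeas D h. Proof. by apply: bmeas_cos; exact: measurable_tau_expR. Qed.

Lemma windowP y : D y -> - (2 * L) <= y <= 2 * L. Proof. by rewrite /D/= in_itv. Qed.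

Lemma phase_lip z y : z <= 2 * L -> y <= 2 * L ->
  `|h z - h y| <= tau * expR (2 * L) * `|z - y|.
Proof.
move=> z1 y1; rewrite /h; apply: le_trans (cos_lip _ _) _.
rewrite -mulrBr normrM gtr0_norm// -mulrA ler_pM2l//.
exact: expR_lip.
Qed.

Lemma phase_le1 y : `|h y| <= 1. Proof. by rewrite /h cos_max. Qed.

(** The Fejer mean at [z] of the periodic extension of [h] from the window. *)
Let conv n z : R := mean (fun y => h y * fejer n (om * (z - y))).

Lemma bmeas_conv n z : bmeas D (fun y => h y * fejer n (om * (z - y))).
Proof. by apply: bmeas_mul; [exact: bmeas_phase|exact: bmeas_fejer]. Qed.

Lemma conv_le1 n z : (0 < n)%N -> `|conv n z| <= 1.
Proof.
move=> n0; apply: le_trans (mean_norm (bmeas_conv _ _)) _.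
rewrite -[leRHS](mean_fejer z n0); apply: mean_le.
- by apply: bmeas_norm; exact: bmeas_conv.
- exact: bmeas_fejer.
- move=> y Dy; rewrite normrM [X in _ * X]ger0_norm ?fejer_ge0//.
  by rewrite ler_piMl ?phase_le1// fejer_ge0.
Qed.

Lemma sqr_le_fejer_angle z y : `|z| <= L -> D y ->
  (z - y) ^+ 2 <= 288 * L ^+ 2 * (1 - cos (om * (z - y))).
Proof.
rewrite ler_norml => /andP[z1 z2] /windowP/andP[y1 y2]; have l1 := L1; have p2 := pi_ge2 R.
have om0 : 0 < om by rewrite divr_gt0//; lra.
have zy : `|z - y| <= 3 * L by rewrite ler_norml; apply/andP; split; lra.
have e1 : om * L = pi / 2 by rewrite /om; field; lra.
have : `|om * (z - y)| <= 3 * pi / 2.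
  rewrite normrM gtr0_norm//; apply: le_trans (_ : om * (3 * L) <= _); first by rewrite ler_pM2l.
  by lra.
move=> /one_sub_cos_lower; rewrite exprMn => H.
have e2 : L ^+ 2 * om ^+ 2 = (pi / 2) ^+ 2 by rewrite -exprMn mulrC -e1 mulrC.
have p4 : 1 <= (pi / 2 : R) ^+ 2 by rewrite exprn_ege1//; lra.
have H2 : L ^+ 2 * (om ^+ 2 * (z - y) ^+ 2 / 288) <= L ^+ 2 * (1 - cos (om * (z - y))).
  by rewrite ler_wpM2l// sqr_ge0.
have : (pi / 2) ^+ 2 * (z - y) ^+ 2 <= 288 * (L ^+ 2 * (1 - cos (om * (z - y)))).
  by rewrite -e2; lra.
have : (z - y) ^+ 2 <= (pi / 2) ^+ 2 * (z - y) ^+ 2 by rewrite ler_peMl ?sqr_ge0.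
lra.
Qed.

(** The closed form of the kernel [F] gives [(z - y)^2 F <= 576 L^2 / m^2] pointwise. AM-GM with
    parameter [lam = m / L] turns this into a first moment of order [L / m], and the Lipschitz bound
    on [h] concludes. The order is written [m ^ 2] because the rate is its inverse square root. *)
Lemma conv_close m z : (0 < m)%N -> `|z| <= L ->
  `|h z - conv (m ^ 2) z| <= 289 * (tau * expR (2 * L)) * L / m%:R.
Proof.
move=> m0 zL; have l1 := L1; have n0 : (0 < m ^ 2)%N by rewrite expn_gt0 m0.
have mR : 0 < m%:R :> R by rewrite ltr0n.
set G := tau * expR (2 * L); have G0 : 0 < G by rewrite mulr_gt0 ?expR_gt0.
have z2 : z <= 2 * L by move: zL; rewrite ler_norml => /andP[]; lra.
pose F y := fejer (m ^ 2) (om * (z - y)).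
have bF : bmeas D F by exact: bmeas_fejer.
have F0 y : 0 <= F y by exact: fejer_ge0.
have bd : bmeas D (fun y => (h z - h y) * F y).
  by apply: bmeas_mul => //; apply: bmeas_sub; [exact: bmeas_cst|exact: bmeas_phase].
have -> : h z - conv (m ^ 2) z = mean (fun y => (h z - h y) * F y).
  rewrite -[X in X - _]mulr1 -(mean_fejer z n0) -mean_scale//.
  rewrite -[- _]mulN1r -mean_scale; last exact: bmeas_conv.
  rewrite -mean_add//; last by apply: bmeas_scale; exact: bmeas_conv.
    by congr mean; apply/funext => y; rewrite /F; ring.
  exact: bmeas_scale.
pose lam := m%:R / L; have lam0 : 0 < lam by rewrite divr_gt0//; lra.
apply: le_trans (mean_norm bd) _.
have e : G * (288 * L / m%:R) + G * (2 * lam)^-1 * mean F <= 289 * G * L / m%:R.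
  rewrite (mean_fejer z n0) mulr1 /lam.
  have -> : (2 * (m%:R / L))^-1 = L / m%:R / 2 by field; apply/andP; split; lra.
  have q0 : 0 <= G * (L / m%:R) by rewrite mulr_ge0 ?divr_ge0//; lra.
  lra.
apply: le_trans e; rewrite -(mean_cst (G * _)) -mean_scale// -mean_add//; first last.
- exact: bmeas_scale.
- exact: bmeas_cst.
apply: mean_le.
- exact: bmeas_norm.
- by apply: bmeas_add; [exact: bmeas_cst|exact: bmeas_scale].
move=> y Dy; rewrite normrM (ger0_norm (F0 y)).
have y2 : y <= 2 * L by have /andP[] := windowP Dy.
have h1 := phase_lip z2 y2.
have h2 := sqr_le_fejer_angle zL Dy.
have h3 : (1 - cos (om * (z - y))) * F y <= 2 / m%:R ^+ 2.
  rewrite fejer_mul// natrX mulrC ler_pM2r ?invr_gt0 ?exprn_gt0//.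
  have := cos_geN1 ((m ^ 2)%:R * (om * (z - y))); rewrite natrX; lra.
(* AM-GM: [|t| <= (lam t^2 + 1 / lam) / 2] *)
have h4 : `|z - y| <= lam / 2 * (z - y) ^+ 2 + (2 * lam)^-1.
  have := sqr_ge0 (`|z - y| * lam - 1); rewrite sqrrB expr1n mulr1 exprMn real_normK ?num_real//.
  have il : 0 <= (2 * lam)^-1 by rewrite invr_ge0; lra.
  move=> /(mulr_ge0 il).
  have -> : (2 * lam)^-1 * ((z - y) ^+ 2 * lam ^+ 2 - (`|z - y| * lam) *+ 2 + 1) =
    lam / 2 * (z - y) ^+ 2 - `|z - y| + (2 * lam)^-1 by rewrite -mulr_natr; field; lra.
  by lra.
apply: le_trans (_ : G * (lam / 2 * (288 * L ^+ 2 * (1 - cos (om * (z - y)))) + (2 * lam)^-1) *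
  F y <= _).
  rewrite ler_wpM2r//; apply: le_trans h1 _; rewrite ler_pM2l//.
  by apply: le_trans h4 _; rewrite lerD2r ler_wpM2l// ltW// divr_gt0.
rewrite mulrDr mulrDl lerD2r -mulrA ler_pM2l//.
rewrite (_ : _ * F y = 144 * lam * L ^+ 2 * ((1 - cos (om * (z - y))) * F y)); last by field.
apply: le_trans (_ : 144 * lam * L ^+ 2 * (2 / m%:R ^+ 2) <= _).
  by rewrite ler_wpM2l// mulr_ge0 ?sqr_ge0// mulr_ge0// ltW.
by rewrite le_eqVlt; apply/orP; left; apply/eqP; rewrite /lam; field; apply/andP; split; lra.
Qed.

(** Integration by parts: [sin (tau * expR y) * expR (- y) / tau] is a primitive of [h] up to a
    remainder carrying the same factor [expR (- y) / tau], which is at most [expR (2 L) / tau] on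
    the window. *)
Lemma mean_low_frequency (ka z : R) : 0 <= ka ->
  `|mean (fun y => h y * cos (ka * (z - y)))| <= expR (2 * L) / tau * (2 + ka).
Proof.
move=> ka0; have l1 := L1; have tN : tau != 0 by rewrite gt_eqF.
pose Phi y := sin (tau * expR y) * expR (- y) * cos (ka * (z - y)) / tau.
pose r y := sin (tau * expR y) * expR (- y) * (cos (ka * (z - y)) - ka * sin (ka * (z - y))) /
  tau.
have dPhi y : is_derive y (1 : R) Phi (h y * cos (ka * (z - y)) - r y).
  apply: is_derive_eq; rewrite /GRing.scale/= /h /r.
  have e : expR y != 0 by rewrite gt_eqF ?expR_gt0.
  rewrite expRN; field; exact/andP.
have cE : continuous (fun y : R => expR (- y)).
  by move=> y; apply: continuous_comp; [exact: opp_continuous|exact: continuous_expR].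
have cS : continuous (fun y : R => sin (tau * expR y)).
  by move=> y; apply: continuous_comp; [exact: continuous_tau_expR|exact: continuous_sin].
have cr : continuous r.
  move=> y; apply: cvgM; last exact: cvg_cst.
  apply: cvgM; first by apply: cvgM; [exact: cS|exact: cE].
  apply: cvgB; first exact: continuous_cos_affine.
  by apply: cvgM; [exact: cvg_cst|exact: continuous_sin_affine].
have rb y : D y -> `|r y| <= expR (2 * L) / tau * (1 + ka).
  move=> /windowP/andP[y1 y2]; rewrite /r normrM normfV (gtr0_norm tau0) -!mulrA.
  rewrite [in leRHS]mulrA [leRHS]mulrAC ler_pM2r ?invr_gt0// mulrA !normrM.
  rewrite (ger0_norm (expR_ge0 _)); apply: ler_pM; rewrite ?mulr_ge0 ?expR_ge0//.
    rewrite -[leRHS]mul1r; apply: ler_pM; rewrite ?expR_ge0 ?sin_max// ler_expR; lra.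
  apply: le_trans (ler_normB _ _) _; rewrite lerD ?cos_max// normrM (ger0_norm ka0).
  by rewrite ler_piMr// sin_max.
have br : bmeas D r.
  split; last by exists (expR (2 * L) / tau * (1 + ka)).
  by apply: measurable_funS (measurableT) (@subsetT _ _) _; exact: continuous_measurable_fun.
have bh : bmeas D (fun y => h y * cos (ka * (z - y))).
  apply: bmeas_mul; first exact: bmeas_phase.
  by apply: bmeas_cos; exact: measurable_affine.
have Phib y : D y -> `|Phi y| <= expR (2 * L) / tau.
  move=> /windowP/andP[y1 y2]; rewrite /Phi normrM normfV (gtr0_norm tau0) ler_pM2r ?invr_gt0//.
  rewrite !normrM (ger0_norm (expR_ge0 _)) -mulrA.
  apply: le_trans (_ : 1 * (expR (- y) * 1) <= _); last by rewrite mul1r mulr1 ler_expR; lra.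
  by apply: ler_pM; rewrite ?mulr_ge0 ?expR_ge0 ?sin_max// ler_wpM2l ?expR_ge0 ?cos_max.
have cf : continuous (fun y => h y * cos (ka * (z - y)) - r y).
  move=> y; apply: cvgB; last exact: cr.
  apply: cvgM; last exact: continuous_cos_affine.
  by apply: continuous_comp; [exact: continuous_tau_expR|exact: continuous_cos].
have e1 : mean (fun y => h y * cos (ka * (z - y))) =
    (4 * L)^-1 * (Phi (2 * L) - Phi (- (2 * L))) + mean r.
  rewrite -(mean_FTC dPhi cf) -mean_add//; last exact: bmeas_sub.
  by congr mean; apply/funext => y; rewrite subrK.
have D1 : D (2 * L) by rewrite /D/= in_itv/=; apply/andP; split; lra.
have D2 : D (- (2 * L)) by rewrite /D/= in_itv/=; apply/andP; split; lra.
rewrite e1; apply: le_trans (ler_normD _ _) _.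
have := mean_norm_le br rb; set B := expR (2 * L) / tau in rb Phib *.
have B0 : 0 <= B by rewrite divr_ge0 ?expR_ge0// ltW.
have : `|(4 * L)^-1 * (Phi (2 * L) - Phi (- (2 * L)))| <= B.
  rewrite normrM gtr0_norm ?inv_width_gt0//.
  apply: le_trans (_ : (4 * L)^-1 * (B + B) <= _).
    rewrite ler_pM2l ?inv_width_gt0//; apply: le_trans (ler_normB _ _) _.
    by rewrite lerD// Phib.
  rewrite mulrC ler_pdivrMr; last lra.
  have : B * 1 <= B * L by rewrite ler_wpM2l.
  by lra.
lra.
Qed.

Variables (T : Type) (s : seq T) (q z : T -> R) (m N0 : nat) (eta : R).
Hypotheses (q0 : forall i, 0 <= q i) (q1 : \sum_(i <- s) q i = 1).
Hypotheses (m0 : (0 < m)%N) (eta0 : 0 <= eta).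
(** The free phase [c] absorbs the position [y] of the kernel in the window. *)
Hypothesis high : forall k c, (N0 <= k)%N -> (k < m ^ 2)%N ->
  `|\sum_(i <- s) q i * cos (k%:R * om * z i + c)| <= eta.

(** The low frequencies are [k * om <= 2 * N0], as [om = pi / (2 L) <= 2]. *)
Let low := expR (2 * L) / tau * (2 + 2 * N0%:R).
Let freq (k : nat) y : R := \sum_(i <- s) q i * cos (k%:R * (om * (z i - y))).

Lemma low_ge0 : 0 <= low.
Proof. by rewrite mulr_ge0 ?divr_ge0 ?expR_ge0 ?addr_ge0 ?mulr_ge0// ltW. Qed.

Lemma weighted_abs_le (P : pred T) (f : T -> R) (c : R) : 0 <= c -> (forall i, P i ->
  `|f i| <= c) ->
  `|\sum_(i <- s | P i) q i * f i| <= c.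
Proof.
move=> c0 fc; apply: le_trans (ler_norm_sum _ _ _) _.
apply: le_trans (_ : \sum_(i <- s) q i * c <= _); last by rewrite -mulr_suml q1 mul1r.
rewrite [leRHS](bigID P)/= -[leLHS]addr0 lerD//; last by rewrite sumr_ge0// => i _;
  exact: mulr_ge0.
by apply: ler_sum => i Pi; rewrite normrM ger0_norm// ler_wpM2l// fc.
Qed.

Lemma bmeas_freq k : bmeas D (freq k).
Proof. by apply: bmeas_sum => i; apply: bmeas_scale; exact: bmeas_cos_affine. Qed.

Lemma bmeas_phase_freq k : bmeas D (fun y => h y * freq k y).
Proof. by apply: bmeas_mul; [exact: bmeas_phase|exact: bmeas_freq]. Qed.

Lemma freq_coef_low k : (k <= N0)%N -> `|mean (fun y => h y * freq k y)| <= low.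
Proof.
move=> kN; have l1 := L1; have p2 := pi_ge2 R; have p4 := pihalf_lt2 R.
have om0 : 0 < om by rewrite divr_gt0//; lra.
have om2 : om <= 2.
  rewrite /om ler_pdivrMr; last lra.
  lra.
have -> : mean (fun y => h y * freq k y) =
    \sum_(i <- s) q i * mean (fun y => h y * cos (k%:R * (om * (z i - y)))).
  rewrite -[RHS](_ : \sum_(i <- s) mean (fun y => q i * (h y * cos (k%:R * (om * (z i - y)))))
    = _).
    rewrite -mean_sum; last first.
      move=> i; apply: bmeas_scale; apply: bmeas_mul;
        [exact: bmeas_phase|exact: bmeas_cos_affine].
    congr mean; apply/funext => y; rewrite /freq mulr_sumr; apply: eq_bigr => i _; ring.
  apply: eq_bigr => i _; rewrite mean_scale//.
  by apply: bmeas_mul; [exact: bmeas_phase|exact: bmeas_cos_affine].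
apply: weighted_abs_le; first exact: low_ge0.
move=> i _; have ko : 0 <= k%:R * om by rewrite mulr_ge0// ltW.
have := mean_low_frequency (z i) ko.
have -> : (fun y => h y * cos (k%:R * om * (z i - y))) = (fun y => h y * cos (k%:R * (om * (z i
  - y)))).
  by apply/funext => y; rewrite mulrA.
move=> /le_trans; apply; rewrite ler_wpM2l ?divr_ge0 ?expR_ge0 ?(ltW tau0)//.
rewrite lerD2l mulrC; apply: ler_pM => //; first exact: ltW.
by rewrite ler_nat.
Qed.

Lemma freq_coef_high k : (N0 <= k)%N -> (k < m ^ 2)%N -> `|mean (fun y => h y * freq k y)| <= eta.
Proof.
move=> Nk km; apply: mean_norm_le; first exact: bmeas_phase_freq.
move=> y Dy; rewrite normrM; apply: le_trans (_ : 1 * eta <= _); last by rewrite mul1r.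
apply: ler_pM => //; first exact: phase_le1.
have := high (- (k%:R * om * y)) Nk km; congr (_ <= _); congr `|_|.
by apply: eq_bigr => i _; congr (_ * cos _); ring.
Qed.

Lemma dirichlet_coef j : (j < m ^ 2)%N ->
  `|mean (fun y => h y * \sum_(i <- s) q i * dirichlet j (om * (z i - y)))|
  <= low * (1 + 2 * N0%:R) + 2 * (m ^ 2)%:R * eta.
Proof.
move=> jm; have lo0 := low_ge0.
have -> : (fun y => h y * \sum_(i <- s) q i * dirichlet j (om * (z i - y))) =
    (fun y => h y * freq 0 y + 2 * \sum_(1 <= k < j.+1) h y * freq k y).
  apply/funext => y; rewrite -mulr_sumr [in RHS]mulrCA -mulrDr; congr (_ * _).
  rewrite /freq exchange_big/= mulr_sumr -big_split/=; apply: eq_bigr => i _.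
  by rewrite mul0r cos0 mulr1 -mulr_sumr /dirichlet; ring.
have bS : bmeas D (fun y => \sum_(1 <= k < j.+1) h y * freq k y).
  by apply: bmeas_sum => k; exact: bmeas_phase_freq.
rewrite mean_add; [|exact: bmeas_phase_freq|exact: bmeas_scale].
rewrite mean_scale// mean_sum; last by move=> k; exact: bmeas_phase_freq.
apply: le_trans (ler_normD _ _) _; rewrite [X in _ + X <= _]normrM normr_nat.
have h1 := freq_coef_low (leq0n N0).
suff h2 : `|\sum_(1 <= k < j.+1) mean (fun y => h y * freq k y)| <=
  N0%:R * low + (m ^ 2)%:R * eta by lra.
apply: le_trans (ler_norm_sum _ _ _) _.
apply: le_trans (_ : \sum_(1 <= k < j.+1) ((if (k <= N0)%N then low else 0) + eta) <= _).
  rewrite big_nat [leRHS]big_nat; apply: ler_sum => k /andP[k1 kj].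
  case: leqP => kN; first by rewrite -[leLHS]addr0 lerD// freq_coef_low.
  by rewrite add0r freq_coef_high// ?(ltnW kN)// (leq_trans kj).
rewrite big_split/=; apply: lerD.
  apply: le_trans (_ : (minn j N0)%:R * low <= _); last by rewrite ler_wpM2r// ler_nat geq_minr.
  elim: (j) => [|i IH]; first by rewrite big_geq// mulr_ge0.
  rewrite big_nat_recr//=; case: leqP => iN.
    by rewrite addr0 (minn_idPr (leqW iN)); apply: le_trans IH _;
      rewrite ler_wpM2r// ler_nat geq_minr.
  rewrite (minn_idPl iN) -natr1 mulrDl mul1r lerD2r; apply: le_trans IH _.
  by rewrite ler_wpM2r// ler_nat geq_minl.
rewrite sumr_const_nat -[leLHS]mulr_natl ler_wpM2r// ler_nat subn1/=; exact: ltnW.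
Qed.

(* [cos (tau * expR z)] is replaced on the window by its Fejer mean of order
   [m ^ 2]: the coefficients of frequency below [N0] are small because [h]
   oscillates fast, the others are paired with [high]. *)
Lemma oscillatory_sum :
  `|\sum_(i <- s) q i * cos (tau * expR (z i))| <=
    2 * \sum_(i <- s | L < `|z i|) q i + 289 * tau * expR (2 * L) * L / m%:R
    + 2 * (m ^ 2)%:R * eta + 4 * (N0.+1)%:R ^+ 2 * expR (2 * L) / tau.
Proof.
have n0 : (0 < m ^ 2)%N by rewrite expn_gt0 m0.
have nR : 0 < (m ^ 2)%:R :> R by rewrite ltr0n.
have l1 := L1; have lo0 := low_ge0.
have h1 : `|\sum_(i <- s) q i * conv (m ^ 2) (z i)| <=
  low * (1 + 2 * N0%:R) + 2 * (m ^ 2)%:R * eta.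
  have -> : \sum_(i <- s) q i * conv (m ^ 2) (z i) = (m ^ 2)%:R^-1 * \sum_(0 <= j < m ^ 2)
      mean (fun y => h y * \sum_(i <- s) q i * dirichlet j (om * (z i - y))).
    have bH j : bmeas D (fun y => h y * \sum_(i <- s) q i * dirichlet j (om * (z i - y))).
      apply: bmeas_mul; first exact: bmeas_phase.
      by apply: bmeas_sum => i; apply: bmeas_scale; exact: bmeas_dirichlet.
    rewrite -mean_sum// -mean_scale; last exact: bmeas_sum.
    rewrite -[LHS](_ : \sum_(i <- s) mean (fun y => q i * (h y * fejer (m ^ 2) (om * (z i -
      y)))) = _); last first.
      by apply: eq_bigr => i _; rewrite mean_scale//; exact: bmeas_conv.
    rewrite -mean_sum; last by move=> i; apply: bmeas_scale; exact: bmeas_conv.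
    congr mean; apply/funext => y; rewrite -mulr_sumr exchange_big/= mulrCA mulr_sumr mulr_sumr.
    by apply: eq_bigr => i _; rewrite -mulr_sumr /fejer; ring.
  rewrite normrM gtr0_norm ?invr_gt0// mulrC ler_pdivrMr//.
  apply: le_trans (ler_norm_sum _ _ _) _.
  apply: le_trans (_ : \sum_(0 <= j < m ^ 2) (low * (1 + 2 * N0%:R) + 2 * (m ^ 2)%:R * eta) <= _).
    by rewrite big_nat [leRHS]big_nat; apply: ler_sum => j /andP[_ jm]; exact: dirichlet_coef.
  by rewrite sumr_const_nat subn0 -[leLHS]mulr_natr.
have h2 : low * (1 + 2 * N0%:R) <= 4 * (N0.+1)%:R ^+ 2 * expR (2 * L) / tau.
  rewrite /low -addn1 natrD; set B := expR (2 * L) / tau.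
  have B0 : 0 <= B by rewrite divr_ge0 ?expR_ge0// ltW.
  rewrite -[leRHS]mulrA -/B mulrC -[leRHS]mulrC -mulrCA ler_wpM2l//.
  have : 0 <= N0%:R :> R by []; nra.
have h3 : `|\sum_(i <- s) q i * (h (z i) - conv (m ^ 2) (z i))| <=
    2 * \sum_(i <- s | L < `|z i|) q i + 289 * tau * expR (2 * L) * L / m%:R.
  rewrite (bigID (fun i => L < `|z i|))/=; apply: le_trans (ler_normD _ _) _; apply: lerD.
    apply: le_trans (ler_norm_sum _ _ _) _; rewrite mulr_sumr; apply: ler_sum => i _.
    rewrite normrM ger0_norm// mulrC ler_wpM2r//; apply: le_trans (ler_normB _ _) _.
    by have := phase_le1 (z i); have := conv_le1 (z i) n0; lra.
  apply: weighted_abs_le.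
    exact: divr_ge0 (mulr_ge0 (mulr_ge0 (mulr_ge0 (ler0n _ 289) (ltW tau0)) (expR_ge0 _))
      (le_trans ler01 l1)) (ler0n _ _).
  by move=> i; rewrite -leNgt => /(conv_close m0) /le_trans; apply; rewrite -[289 * tau * _]mulrA.
have -> : \sum_(i <- s) q i * cos (tau * expR (z i)) =
  \sum_(i <- s) q i * (h (z i) - conv (m ^ 2) (z i)) + \sum_(i <- s) q i * conv (m ^ 2) (z i).
  by rewrite -big_split/=; apply: eq_bigr => i _; rewrite -mulrDr subrK.
apply: le_trans (ler_normD _ _) _; lra.
Qed.

End Interval.
End OscillatorySum.

(** * Decay of the Fourier transform *)
Section FourierBound.
Variables (R : realType) (A : finType) (phi : A -> R -> R) (p : A -> R)
  (mu : probability R R) (kap lam Cu Cl M : R).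
Hypothesis G : regular_ifs phi p mu kap lam Cu Cl M.

Local Notation I := (@I01 R).
Local Notation phiw := (compose phi).
Local Notation E := (Emu mu).
Local Notation nc := (@Normc.normc R).
Local Notation pr := (pw p).
Implicit Types (w u v : seq A) (f : R -> R).

Lemma bmeas_wave f (c t : R) : bmeas I f -> bmeas I (fun x => cos (c + t * f x)).
Proof. by move=> [mf _]; apply: bmeas_cos; apply: measurable_funD => //;
  exact: measurable_funM. Qed.

Lemma bmeas_cos_scale f (t : R) : bmeas I f -> bmeas I (fun x => cos (t * f x)).
Proof. by move=> [mf _]; apply: bmeas_cos; exact: measurable_funM. Qed.

Lemma bmeas_sin_scale f (t : R) : bmeas I f -> bmeas I (fun x => sin (t * f x)).
Proof. by move=> [mf _]; apply: bmeas_sin; exact: measurable_funM. Qed.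

Lemma correlationE f (t x : R) : bmeas I f -> E (fun y => cos (t * (f x - f y))) =
  cos (t * f x) * E (fun y => cos (t * f y)) + sin (t * f x) * E (fun y => sin (t * f y)).
Proof.
move=> bf; rewrite -!(E_scale G); [|exact: bmeas_sin_scale|exact: bmeas_cos_scale].
rewrite -(E_add G); [|exact/bmeas_scale/bmeas_cos_scale|exact/bmeas_scale/bmeas_sin_scale].
by apply: E_eq => y _; rewrite mulrBr cosB.
Qed.

Lemma bmeas_correlation f (t : R) : bmeas I f ->
  bmeas I (fun x => E (fun y => cos (t * (f x - f y)))).
Proof.
move=> bf; under eq_fun do rewrite correlationE//.
by apply: bmeas_add; apply: bmeas_mul; try exact: bmeas_cst;
  [exact: bmeas_cos_scale|exact: bmeas_sin_scale].
Qed.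

(* The squared modulus of [E (expi (t * f))] as a double expectation; expanding
   the cosine of a difference makes Fubini's theorem unnecessary. *)
Lemma sqr_E_cos f (c t : R) : bmeas I f -> E (fun x => cos (c + t * f x)) ^+ 2 <=
  E (fun x => E (fun y => cos (t * (f x - f y)))).
Proof.
move=> bf; have bc := bmeas_cos_scale t bf; have bs := bmeas_sin_scale t bf.
set a := E (fun y => cos (t * f y)); set b := E (fun y => sin (t * f y)).
have -> : E (fun x => E (fun y => cos (t * (f x - f y)))) = a ^+ 2 + b ^+ 2.
  under [LHS]E_eq => x _ do rewrite correlationE// -/a -/b mulrC [X in _ + X]mulrC.
  by rewrite (E_add G) ?(E_scale G)//; exact: bmeas_scale.
have -> : E (fun x => cos (c + t * f x)) = cos c * a - sin c * b.
  rewrite -mulNr -!(E_scale G)// -(E_add G); try exact: bmeas_scale.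
  by apply: E_eq => x _; rewrite cosD mulNr.
have : (cos c * a - sin c * b) ^+ 2 + (cos c * b + sin c * a) ^+ 2 = a ^+ 2 + b ^+ 2.
  have := cos2Dsin2 c; move: (cos c) (sin c) => u v uv.
  have -> : (u * a - v * b) ^+ 2 + (u * b + v * a) ^+ 2 = (u ^+ 2 + v ^+ 2) * (a ^+ 2 + b ^+ 2).
    by ring.
  by rewrite uv mul1r.
have := sqr_ge0 (cos c * b + sin c * a); lra.
Qed.

(** The error has the exponent 3 because [phi_u] has derivative [Cu * r] and is linearised over an
    image of [phi_v] of diameter [r]. Jensen's inequality is used twice, over [v] and over [u]; the
    sum over [u] is then moved inside the double integral, where its terms cancel. The bound [B] is
    asked for each [x], so that only [y] is averaged. *)
Lemma E_cos_bound (S c r B : R) (U V : seq (seq A)) :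
  stationary phi p mu U -> stationary phi p mu V -> 0 <= r -> 0 <= B ->
  (forall u x, u \in U -> I x -> `|der phi u x| <= Cu * r) ->
  (forall v x, v \in V -> I x -> `|der phi v x| <= r) ->
  (forall v x, v \in V -> I x -> E (fun y => \sum_(u <- U)
     pr u * cos (S * der phi u (phiw v 0) * (phiw v x - phiw v y))) <= B) ->
  `|E (fun x => cos (c + S * x))| <= `|S| * (M * Cu * r ^+ 3) + Num.sqrt B.
Proof.
move=> sU sV r0 B0 dU dV HB; have I01_0 := @I01_0 R; have M0 := rg_M0 G; have Cu0 := rg_Cu0 G.
have bid : bmeas I (fun x => x) by exact: contI_bmeas (rg_cont (w:=[::]) G).
have bphi v : bmeas I (phiw v) by exact: contI_bmeas (rg_cont (w:=v) G).
pose s u v := S * der phi u (phiw v 0).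
(* [al + s * phi_v x] is the linearisation of [c + S * phi_u (phi_v x)] at the point [phi_v 0]. *)
pose al u v := c + S * phiw u (phiw v 0) - s u v * phiw v 0.
pose g u v := E (fun x => cos (al u v + s u v * phiw v x)).
pose d := `|S| * (M * Cu * r ^+ 3).
have d0 : 0 <= d by rewrite !mulr_ge0 ?exprn_ge0// ltW.
have close u v : u \in U -> v \in V -> `|E (fun x => cos (c + S * phiw (u ++ v) x)) - g u v| <= d.
  move=> uU vV.
  have b1 : bmeas I (fun x => cos (c + S * phiw (u ++ v) x)) by exact: bmeas_wave.
  have b2 : bmeas I (fun x => cos (al u v + s u v * phiw v x)) by exact: bmeas_wave.
  have b3 := bmeas_sub b1 b2.
  have -> : E (fun x => cos (c + S * phiw (u ++ v) x)) - g u v =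
      E (fun x => cos (c + S * phiw (u ++ v) x) - cos (al u v + s u v * phiw v x)).
    by apply/esym/(intB_sub (@measurable_I R) (mu_I01_fin (rg_sc G)) b1 b2).
  apply: le_trans (intB_norm (@measurable_I R) (mu_I01_fin (rg_sc G)) b3) _.
  rewrite -[leRHS](E_cst G d); apply: (E_le G); [exact: bmeas_norm|exact: bmeas_cst|move=> x Ix].
  apply: le_trans (cos_lip _ _) _; rewrite compose_cat.
  have Iv := rg_I G v I01_0; have Ivx := rg_I G v Ix.
  have -> : c + S * phiw u (phiw v x) - (al u v + s u v * phiw v x) =
    S * (phiw u (phiw v x) - phiw u (phiw v 0) - der phi u (phiw v 0) * (phiw v x - phiw v 0)).
    by rewrite /al /s; ring.
  rewrite normrM ler_wpM2l//.
  apply: le_trans (rg_lin G (fun x => dU u x uU) Iv Ivx) _.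
  have -> : M * Cu * r ^+ 3 = M * (Cu * r) * r ^+ 2 by ring.
  have h : `|phiw v x - phiw v 0| <= r.
    apply: le_trans (compose_dist G (fun x => dV v x vV) I01_0 Ix) _.
    by rewrite ler_piMr// I01_dist.
  by rewrite ler_wpM2l ?lerXn2r ?nnegrE// !mulr_ge0// ltW.
have pU := stationary_sum1 G sU; have pV := stationary_sum1 G sV.
have p0 w : 0 <= pr w by exact: (rg_pw_ge0 G).
have main : `|\sum_(v <- V) pr v * \sum_(u <- U) pr u * g u v| <= Num.sqrt B.
  rewrite -sqrtr_sqr ler_wsqrtr//; apply: le_trans (weighted_jensen _ p0 pV) _.
  rewrite -[leRHS]mul1r -pV mulr_suml big_seq [leRHS]big_seq; apply: ler_sum => v vV.
  rewrite ler_wpM2l//; apply: le_trans (weighted_jensen _ p0 pU) _.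
  have bc u : bmeas I (fun x => E (fun y => cos (s u v * (phiw v x - phiw v y)))).
    exact: bmeas_correlation.
  apply: (@le_trans _ _ (\sum_(u <- U) pr u * E (fun x => E (fun y => cos (s u v * (phiw v x -
    phiw v y)))))).
    by apply: ler_sum => u _; rewrite ler_wpM2l// sqr_E_cos.
  rewrite -[leRHS](E_cst G B); under eq_bigr do rewrite -(E_scale G _ (bc _)).
  rewrite -(E_sum G); last by move=> u; exact: bmeas_scale.
  apply: (E_le G) => [||x Ix]; [by apply: bmeas_sum => u; exact: bmeas_scale|exact: bmeas_cst|].
  apply: le_trans (HB v x vV Ix).
  have b4 u : bmeas I (fun y => cos (s u v * (phiw v x - phiw v y))).
    have [mv _] := bphi v; apply: bmeas_cos; apply: measurable_funM => //.
    by apply: measurable_funB.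
  under eq_bigr do rewrite -(E_scale G _ (b4 _)).
  by rewrite -(E_sum G)// => u; exact: bmeas_scale.
have -> : E (fun x => cos (c + S * x)) = \sum_(u <- U) \sum_(v <- V) pr u * pr v *
    E (fun x => cos (c + S * phiw (u ++ v) x)).
  rewrite (stationary_cat G sU sV (bmeas_wave _ _ bid)) big_allpairs_dep/=.
  by apply: eq_bigr => u _; apply: eq_bigr => v _; rewrite pw_cat.
have -> : \sum_(u <- U) \sum_(v <- V) pr u * pr v * E (fun x => cos (c + S * phiw (u ++ v) x)) =
  \sum_(u <- U) \sum_(v <- V) pr u * pr v * (E (fun x => cos (c + S * phiw (u ++ v) x)) - g u v)
  + \sum_(v <- V) pr v * \sum_(u <- U) pr u * g u v.
  under [X in _ = _ + X]eq_bigr do rewrite mulr_sumr.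
  rewrite [X in _ = _ + X]exchange_big/= -big_split/=; apply: eq_bigr => u _.
  by rewrite -big_split/=; apply: eq_bigr => v _; ring.
apply: le_trans (ler_normD _ _) _; apply: lerD => //.
rewrite -/d -[leRHS]mul1r -pU mulr_suml; apply: le_trans (ler_norm_sum _ _ _) _.
rewrite big_seq [leRHS]big_seq; apply: ler_sum => u uU.
rewrite -[d]mul1r -pV mulr_suml mulr_sumr; apply: le_trans (ler_norm_sum _ _ _) _.
rewrite big_seq [leRHS]big_seq; apply: ler_sum => v vV.
by rewrite normrM (ger0_norm (mulr_ge0 (p0 u) (p0 v))) -mulrA ler_wpM2l// ler_wpM2l// close.
Qed.

Lemma E_near_far (F : R -> R) (x L Q : R) : bmeas I F -> 0 <= Q ->
  (forall y, I y -> F y <= 1) ->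
  (forall y, I y -> expR (- L) <= `|y - x| -> F y <= Q) ->
  E F <= Q + E (\1_(cball x (expR (- L))) : R -> R).
Proof.
move=> bF Q0 F1 FQ; have bi := bmeas_cball x (expR (- L)).
rewrite -[X in X + _](E_cst G Q) -(E_add G)//; last exact: bmeas_cst.
apply: (E_le G) => // [|y Iy]; first by apply: bmeas_add => //; exact: bmeas_cst.
rewrite indicE; have [near|far] := boolP (y \in cball x (expR (- L))).
  by have := F1 y Iy; rewrite mulr1n; lra.
rewrite addr0 FQ// ltW// ltNge; apply: contraNN far => /cballE; exact: mem_set.
Qed.

Lemma Re_sum_expi (s : seq (seq A)) (q : seq A -> R) (th : seq A -> R) (c : R) :
  (forall u, 0 <= q u) ->
  `|\sum_(u <- s) q u * cos (th u + c)| <= nc (\sum_(u <- s) (q u)%:C * expi (th u)).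
Proof.
move=> q0; set Z := \sum_(u <- s) _%:C * _.
have [eR eI] : complex.Re Z = \sum_(u <- s) q u * cos (th u) /\
    complex.Im Z = \sum_(u <- s) q u * sin (th u).
  rewrite /Z; elim: s {Z} => [|a s [IHr IHi]]; first by rewrite !big_nil.
  by rewrite !big_cons -IHr -IHi; case: (\sum_(_ <- s) _) => x y /=; split; ring.
have -> : \sum_(u <- s) q u * cos (th u + c) = cos c * complex.Re Z - sin c * complex.Im Z.
  rewrite eR eI !mulr_sumr -sumrB; apply: eq_bigr => u _; rewrite cosD; ring.
apply: le_of_sqr; first exact: normc_ge0.
rewrite sqr_normc real_normK ?num_real//.
have := sqr_ge0 (cos c * complex.Im Z + sin c * complex.Re Z).
have := cos2Dsin2 c; move: (cos c) (sin c) (complex.Re Z) (complex.Im Z) => u v a b uv.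
have : (u * a - v * b) ^+ 2 + (u * b + v * a) ^+ 2 = (u ^+ 2 + v ^+ 2) * (a ^+ 2 + b ^+ 2) by
  ring.
rewrite uv; lra.
Qed.

Variables (n : nat) (r : R) (W : seq (seq A)).
Hypotheses (r01 : 0 < r < 1) (sW : stationary phi p mu W).
Hypothesis HW : forall v x, v \in W -> I x -> cut_const lam Cl M * r <= `|der phi v x| <= r.
Let U := [seq w ++ u | w <- words A n, u <- W].
Let K1 := M + `|ln (cut_const lam Cl M)|.

Lemma cut_const_gt0 : 0 < cut_const lam Cl M.
Proof. by rewrite !mulr_gt0 ?expR_gt0 ?(rg_Cl0 G) ?(rg_lam0 G). Qed.

Lemma stationary_concat : stationary phi p mu U.
Proof. by apply: (stationary_cat G) => //; exact: (stationary_words G). Qed.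

Lemma der_concat_le u x : u \in U -> I x -> `|der phi u x| <= Cu * r.
Proof.
move=> /allpairsP[[w v] /= [_ vW ->]] Ix; rewrite -(rg_expR G)// (rg_cat G)// expRD.
have Iv := rg_I G v Ix; rewrite !(rg_expR G)//; apply: ler_pM => //.
  apply: le_trans (normder_le G w Iv) _; rewrite ler_piMr ?(ltW (rg_Cu0 G))//.
  by rewrite exprn_ile1 ?ltW ?(rg_kap0 G) ?(rg_kap1 G).
by have /andP[] := HW vW Ix.
Qed.

Lemma theta_concat_close w v y c0 : v \in W -> I y ->
  `|theta phi (w ++ v) y - c0| <= `|theta phi w 0 - (c0 - ln r)| + K1.
Proof.
move=> vW Iy; rewrite (rg_cat G)//; have I01_0 := @I01_0 R; have Iv := rg_I G v Iy.
have /andP[r0 r1] := r01; have cc := cut_const_gt0.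
have h1 : `|theta phi w (phiw v y) - theta phi w 0| <= M.
  by apply: le_trans (rg_theta G w I01_0 Iv) _; rewrite ler_piMr ?I01_dist ?(ltW (rg_M0 G)).
have h2 : `|theta phi v y - ln r| <= `|ln (cut_const lam Cl M)|.
  have /andP[d1 d2] := HW vW Iy; rewrite -(rg_expR G)// in d1 d2.
  have t1 : theta phi v y <= ln r by rewrite -[leLHS]expRK ler_ln ?posrE ?expR_gt0.
  have t2 : ln (cut_const lam Cl M) + ln r <= theta phi v y.
    by rewrite -lnM ?posrE// -[leRHS]expRK ler_ln ?posrE ?expR_gt0// mulr_gt0.
  rewrite ler0_norm ?subr_le0//; apply: le_trans (_ : - ln (cut_const lam Cl M) <= _); first lra.
  by rewrite -normrN ler_norm.
rewrite /K1; apply: le_trans (_ : `|theta phi w 0 - (c0 - ln r)| +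
   (`|theta phi w (phiw v y) - theta phi w 0| + `|theta phi v y - ln r|) <= _); last lra.
rewrite (_ : _ - c0 = (theta phi w 0 - (c0 - ln r)) + ((theta phi w (phiw v y) - theta phi w 0)
  + (theta phi v y - ln r))); last by ring.
by apply: le_trans (ler_normD _ _) _; rewrite lerD2l ler_normD.
Qed.

Lemma tail_concat L y c0 : I y -> \sum_(u <- U | L < `|theta phi u y - c0|) pr u <=
  \sum_(w <- words A n | L - K1 < `|theta phi w 0 - (c0 - ln r)|) pr w.
Proof.
move=> Iy; rewrite big_mkcond /U big_allpairs_dep/= [leRHS]big_mkcond/=.
apply: ler_sum => w _; rewrite -[leRHS]mulr1 -(stationary_sum1 G sW) mulr_sumr.
rewrite big_seq [leRHS]big_seq; apply: ler_sum => v vW; rewrite pw_cat.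
have := theta_concat_close w c0 vW Iy; case: ifPn => [h1 h2|_ _].
  by rewrite ifT//; lra.
by case: ifPn => _; rewrite ?mul0r// mulr_ge0 ?(rg_pw_ge0 G).
Qed.

Variables (N J : nat) (rho b0 : R).
Hypothesis step : cone_contraction phi p mu M N rho b0.
Hypotheses (rho0 : 0 <= rho) (nNJ : n = (N * J)%N).

Lemma mellin_concat b y c : b0 <= b -> 0 <= b -> b * r <= 1 -> I y ->
  `|\sum_(u <- U) pr u * cos (b * theta phi u y + c)| <= expR (4 * M) * Num.sqrt (rho ^+ J).
Proof.
move=> bb bp br Iy; have M0 := rg_M0 G.
apply: le_trans (Re_sum_expi _ _ _ (rg_pw_ge0 G)) _.
apply: le_of_sqr; first by rewrite mulr_ge0 ?expR_ge0.
rewrite exprMn sqr_sqrtr ?exprn_ge0// -expRM_natl.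
have bn : `|b| = b by rewrite ger0_norm.
have := mellin_decay G step rho0 J (b := b) (r := r) (W := W) (x := y).
rewrite bn => /(_ bb sW (fun u x uW Ix => proj2 (andP (HW uW Ix))) Iy).
rewrite -nNJ => H; rewrite /U big_allpairs_dep/=.
under eq_bigr => w _ do under eq_bigr => v _ do rewrite pw_cat.
apply: le_trans H _; rewrite ler_wpM2r ?exprn_ge0// ler_expR.
have : M * (b * r) <= M * 1 by rewrite ler_wpM2l// ltW.
lra.
Qed.

(** For far pairs the distance of [phi_v x] and [phi_v y] lies between [cut_const * r * expR (- L)]
    and [r], so the normalisation to [expR (5 L)] puts [tau] between [cut_const * expR (4 L)] and
    [expR (5 L)]. The lower end beats the loss [expR (2 L)] at low frequencies, the upper end limits
    the Lipschitz constant of the phase to [expR (7 L)]. As frequencies are at most [2 m^2], the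
    bound on [m ^ 2 * r] gives [b * r <= 1]. *)
Lemma phase_sum_far (S c0 L x y : R) (v : seq A) (m N0 : nat) (dev : R) : 1 <= L ->
  v \in W -> I x -> I y -> S != 0 -> (0 < m)%N ->
  b0 <= N0%:R * (pi / (2 * L)) ->
  2 * (m ^ 2)%:R * r <= 1 ->
  `|S| * r * expR c0 = expR (5 * L) ->
  \sum_(w <- words A n | L - K1 < `|theta phi w 0 - (c0 - ln r)|) pr w <= dev ->
  expR (- L) <= `|y - x| ->
  \sum_(u <- U) pr u * cos (S * der phi u (phiw v 0) * (phiw v x - phiw v y)) <=
  2 * dev + 289 * expR (7 * L) * L / m%:R +
  2 * (m ^ 2)%:R * (expR (4 * M) * Num.sqrt (rho ^+ J)) +
  4 * (N0.+1)%:R ^+ 2 * expR (- (2 * L)) / cut_const lam Cl M.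
Proof.
move=> L1 vW Ix Iy S0 m0 bN mr scale Hdev far.
have I01_0 := @I01_0 R; have Iv := rg_I G v I01_0; have /andP[r0 r1] := r01;
  have cc := cut_const_gt0.
set d := `|phiw v x - phiw v y|.
have [c Ic dE] := rg_mvt G v Iy Ix.
have /andP[dc1 dc2] := HW vW Ic.
have d1 : d <= r by rewrite /d dE -[leRHS]mulr1; apply: ler_pM => //; exact: I01_dist.
have d2 : cut_const lam Cl M * r * expR (- L) <= d.
  rewrite /d dE; apply: ler_pM; rewrite ?expR_ge0 ?(ltW cc)// 1?mulr_ge0 ?(ltW cc) ?(ltW r0)//.
  by rewrite distrC.
have d0 : 0 < d by apply: lt_le_trans d2; exact: mulr_gt0 (mulr_gt0 cc r0) (expR_gt0 _).
have Sn : 0 < `|S| by rewrite normr_gt0.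
pose tau := `|S| * d * expR c0; have tau0 : 0 < tau by rewrite !mulr_gt0 ?expR_gt0.
pose z u := theta phi u (phiw v 0) - c0.
(* The cosine is even, so the signs of [S], of [der phi u] and of the difference drop out. *)
have -> : \sum_(u <- U) pr u * cos (S * der phi u (phiw v 0) * (phiw v x - phiw v y)) =
    \sum_(u <- U) pr u * cos (tau * expR (z u)).
  apply: eq_bigr => u _; congr (_ * _); rewrite -cos_norm !normrM -/d /tau /z expRB.
  rewrite -(rg_expR G)//; congr cos; field; by rewrite gt_eqF ?expR_gt0.
apply: le_trans (ler_norm _) _.
have high k c' : (N0 <= k)%N -> (k < m ^ 2)%N ->
    `|\sum_(u <- U) pr u * cos (k%:R * (pi / (2 * L)) * z u + c')| <=
    expR (4 * M) * Num.sqrt (rho ^+ J).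
  move=> Nk km; have p2 := pi_ge2 R; have p4 := pihalf_lt2 R.
  have om0 : 0 < pi / (2 * L) by rewrite divr_gt0//; lra.
  have om2 : pi / (2 * L) <= 2 by rewrite ler_pdivrMr; lra.
  set b := k%:R * (pi / (2 * L)).
  have -> : \sum_(u <- U) pr u * cos (b * z u + c') =
     \sum_(u <- U) pr u * cos (b * theta phi u (phiw v 0) + (c' - b * c0)).
    by apply: eq_bigr => u _; congr (_ * cos _); rewrite /z; ring.
  have kR : k%:R <= (m ^ 2)%:R :> R by rewrite ler_nat ltnW.
  have k0 : 0 <= k%:R :> R by [].
  have b2 : b <= (m ^ 2)%:R * 2 by apply: ler_pM => //; exact: ltW.
  apply: mellin_concat => //.
  - by apply: le_trans bN _; rewrite ler_wpM2r ?ler_nat// ltW.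
  - by rewrite mulr_ge0// ltW.
  - apply: le_trans (_ : (m ^ 2)%:R * 2 * r <= _); first by rewrite ler_wpM2r// ltW.
    by rewrite -mulrA mulrCA mulrA.
have eta0 : 0 <= expR (4 * M) * Num.sqrt (rho ^+ J) by rewrite mulr_ge0 ?expR_ge0.
apply: le_trans (oscillatory_sum L1 tau0 (rg_pw_ge0 G) (stationary_sum1 G stationary_concat) m0
  eta0 high) _.
have mR : 0 < m%:R :> R by rewrite ltr0n.
have tauU : tau <= expR (5 * L).
  rewrite -scale /tau ler_wpM2r ?expR_ge0// ler_wpM2l//.
have tauL : cut_const lam Cl M * expR (4 * L) <= tau.
  apply: le_trans (_ : cut_const lam Cl M * (expR (- L) * (`|S| * r * expR c0)) <= _).
    rewrite ler_wpM2l ?(ltW cc)// scale -expRD ler_expR; lra.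
  rewrite /tau (_ : _ * (_ * _) = `|S| * (cut_const lam Cl M * r * expR (- L)) * expR c0);
    last by ring.
  by rewrite ler_wpM2r ?expR_ge0// ler_wpM2l.
apply: lerD; [apply: lerD => //; apply: lerD|].
- by rewrite ler_wpM2l//; apply: le_trans (tail_concat L c0 Iv) Hdev.
- rewrite ler_pM2r ?invr_gt0// ler_pM2r; last lra.
  rewrite (_ : 7 * L = 5 * L + 2 * L) ?expRD; last by ring.
  by rewrite -!(mulrA 289) ler_pM2l// ler_pM2r ?expR_gt0.
- have h : expR (2 * L) * cut_const lam Cl M <= expR (- (2 * L)) * tau.
    apply: le_trans (_ : expR (- (2 * L)) * (cut_const lam Cl M * expR (4 * L)) <= _).
      by rewrite [leRHS]mulrCA -expRD [leRHS]mulrC (_ : - (2 * L) + 4 * L = 2 * L)//; ring.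
    by rewrite ler_wpM2l ?expR_ge0.
  have a0 : 0 <= 4 * N0.+1%:R ^+ 2 :> R by rewrite mulr_ge0// sqr_ge0.
  move: (4 * _ ^+ 2) a0 => a a0.
  by rewrite ler_pdivrMr// [leRHS]mulrAC ler_pdivlMr// -mulrA -[leRHS]mulrA ler_wpM2l.
Qed.

Lemma E_cos_estimate (S c c0 L : R) (m N0 : nat) (dev Fr : R) : 1 <= L ->
  S != 0 -> (0 < m)%N -> b0 <= N0%:R * (pi / (2 * L)) ->
  2 * (m ^ 2)%:R * r <= 1 -> `|S| * r * expR c0 = expR (5 * L) ->
  \sum_(w <- words A n | L - K1 < `|theta phi w 0 - (c0 - ln r)|) pr w <= dev ->
  (forall x, E (\1_(cball x (expR (- L))) : R -> R) <= Fr) ->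
  `|E (fun x => cos (c + S * x))| <= `|S| * (M * Cu * r ^+ 3) + Num.sqrt
    (2 * dev + 289 * expR (7 * L) * L / m%:R +
     2 * (m ^ 2)%:R * (expR (4 * M) * Num.sqrt (rho ^+ J)) +
     4 * (N0.+1)%:R ^+ 2 * expR (- (2 * L)) / cut_const lam Cl M + Fr).
Proof.
move=> L1 S0 m0 bN mr scale Hdev HFr; have /andP[r0 r1] := r01; have cc := cut_const_gt0.
set Q := 2 * dev + _ + _ + _.
have dev0 : 0 <= dev by apply: le_trans Hdev; apply: sumr_ge0 => w _; exact: rg_pw_ge0 G _.
have L0 : 0 <= L by lra.
have Q0 : 0 <= Q.
  have q1 : 0 <= 289 * expR (7 * L) * L / m%:R.
    exact: divr_ge0 (mulr_ge0 (mulr_ge0 (ler0n _ 289) (expR_ge0 _)) L0) (ler0n _ _).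
  have q2 : 0 <= 2 * (m ^ 2)%:R * (expR (4 * M) * Num.sqrt (rho ^+ J)).
    by apply: mulr_ge0; [exact: mulr_ge0|rewrite mulr_ge0 ?expR_ge0 ?sqrtr_ge0].
  have q3 : 0 <= 4 * N0.+1%:R ^+ 2 * expR (- (2 * L)) / cut_const lam Cl M.
    by apply: divr_ge0 (ltW cc); rewrite mulr_ge0 ?expR_ge0// mulr_ge0// exprn_ge0.
  by rewrite /Q; apply: addr_ge0 q3; apply: addr_ge0 q2; apply: addr_ge0 q1; exact: mulr_ge0.
have Fr0 : 0 <= Fr by apply: le_trans (HFr 0); apply: E_ge0 => x _; rewrite indicE.
apply: (@E_cos_bound S c r (Q + Fr) U W stationary_concat sW (ltW r0) (addr_ge0 Q0 Fr0)
  der_concat_le).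
  by move=> v x vW Ix; have /andP[] := HW vW Ix.
move=> v x vW Ix; pose F y := \sum_(u <- U) pr u *
  cos (S * der phi u (phiw v 0) * (phiw v x - phiw v y)).
have bphi : bmeas I (phiw v) by exact: contI_bmeas (rg_cont (w:=v) G).
have bF : bmeas I F.
  apply: bmeas_sum => u; apply: bmeas_scale; have [mv _] := bphi.
  by apply: bmeas_cos; apply: measurable_funM => //; exact: measurable_funB.
apply: le_trans (_ : Q + E (\1_(cball x (expR (- L))) : R -> R) <= _); last by rewrite lerD2l.
apply: E_near_far bF Q0 _ _ => y Iy.
  rewrite -(stationary_sum1 G stationary_concat); apply: ler_sum => u _.
  by rewrite ler_piMr ?(rg_pw_ge0 G)// cos_le1.
exact: (phase_sum_far L1 vW Ix Iy S0 m0 bN mr scale Hdev).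
Qed.

End FourierBound.

(** * Choice of parameters and power decay *)

Section PowerDecay.
Variables (R : realType) (A : finType) (phi : A -> R -> R) (p : A -> R)
  (mu : probability R R) (kap lam Cu Cl M : R).
Hypothesis G : regular_ifs phi p mu kap lam Cu Cl M.

Local Notation I := (@I01 R).
Local Notation E := (Emu mu).

Lemma truncn_ceil (x : R) : 0 <= x -> exists n : nat, x <= n.+1%:R <= x + 1.
Proof.
move=> x0; exists (Num.truncn x); have /andP[h1 h2] := truncn_itv x0.
by rewrite (ltW h2) -natr1 lerD2r.
Qed.

Lemma E_cos_le1 S c : `|E (fun x => cos (c + S * x))| <= 1.
Proof.
have b : bmeas I (fun x => cos (c + S * x)).
  by apply: bmeas_wave; exact: contI_bmeas (rg_cont (w:=[::]) G).
apply: le_trans (intB_norm (@measurable_I R) (mu_I01_fin (rg_sc G)) b) _.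
rewrite -[leRHS](E_cst G 1); apply: (E_le G); [exact: bmeas_norm|exact: bmeas_cst|].
by move=> x _; exact: cos_max.
Qed.

(** [mm] of order [expR (9 L)] is large enough to beat [expR (7 L) * L], and its square, at most
    [4 * expR (18 L)], is still beaten by [expR (- (20 L))]. The number [n] of low frequencies is
    only linear in [L]. *)
Lemma error_terms (L t s u mm n b0 cut Cf e : R) : 1 <= L -> t <= 1 -> t <= s ->
  t * L <= u -> 0 <= Cf -> 0 < cut -> 0 <= e -> 0 <= b0 -> expR (9 * L) <= mm ->
  mm ^+ 2 <= 4 * expR (18 * L) -> 0 <= n <= b0 * L + 2 ->
  2 * (2 * expR (- u)) + 289 * expR (7 * L) * L / mm + 2 * mm ^+ 2 * (e * expR (- (20 * L))) +
  4 * n ^+ 2 * expR (- (2 * L)) / cut + Cf * expR (- (s * L)) <=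
  (4 + 289 + 8 * e + 16 * (b0 + 3) ^+ 2 / cut + Cf) * expR (- (t * L)).
Proof.
move=> L1 t1 ts tu Cf0 cut0 e0 b00 mm1 mm2 /andP[n0 n1].
have L0 : 0 <= L by lra.
have mm0 : 0 < mm by apply: lt_le_trans mm1; exact: expR_gt0.
have eL : expR (- L) <= expR (- (t * L)) by rewrite ler_expR lerN2 ler_piMl.
have LE : L <= expR L by have := expR_ge1Dx L; lra.
have LE2 : L ^+ 2 <= 4 * expR L.
  have -> : 4 * expR L = (2 * expR (L / 2)) ^+ 2.
    rewrite exprMn -expRM_natl (_ : 2%:R * (L / 2) = L); first by ring.
    by field.
  by rewrite lerXn2r ?nnegrE ?mulr_ge0 ?expR_ge0//; have := expR_ge1Dx (L / 2); lra.
have h1 : expR (- u) <= expR (- (t * L)) by rewrite ler_expR lerN2.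
have h2 : expR (7 * L) * L / mm <= expR (- (t * L)).
  rewrite ler_pdivrMr//; apply: le_trans (_ : expR (- L) * expR (9 * L) <= _); last first.
    by apply: ler_pM; rewrite ?expR_ge0.
  apply: le_trans (_ : expR (7 * L) * expR L <= _); first by rewrite ler_wpM2l ?expR_ge0.
  by rewrite -!expRD ler_expR; lra.
have h3 : mm ^+ 2 * expR (- (20 * L)) <= 4 * expR (- (t * L)).
  apply: le_trans (_ : 4 * expR (18 * L) * expR (- (20 * L)) <= _).
    by rewrite ler_wpM2r ?expR_ge0.
  rewrite -mulrA ler_wpM2l//; apply: le_trans eL; rewrite -expRD ler_expR; lra.
have h4 : n ^+ 2 * expR (- (2 * L)) <= 4 * (b0 + 3) ^+ 2 * expR (- (t * L)).
  apply: le_trans (_ : ((b0 + 3) * L) ^+ 2 * expR (- (2 * L)) <= _).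
    rewrite ler_wpM2r ?expR_ge0// lerXn2r ?nnegrE//; first by rewrite mulr_ge0//; lra.
    by lra.
  rewrite exprMn; apply: le_trans (_ : (b0 + 3) ^+ 2 * (4 * expR L) * expR (- (2 * L)) <= _).
    by rewrite ler_wpM2r ?expR_ge0// ler_wpM2l// sqr_ge0.
  rewrite (_ : _ * (4 * _) * _ = 4 * (b0 + 3) ^+ 2 * (expR L * expR (- (2 * L)))); last by ring.
  rewrite ler_wpM2l//; first by apply: mulr_ge0 => //; exact: sqr_ge0.
  by apply: le_trans eL; rewrite -expRD ler_expR; lra.
have h5 : Cf * expR (- (s * L)) <= Cf * expR (- (t * L)).
  by rewrite ler_wpM2l// ler_expR lerN2 ler_wpM2r.
have h3' := ler_wpM2l e0 h3.
have ic : 0 <= cut^-1 by rewrite invr_ge0 ltW.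
have h4' := ler_wpM2r ic h4.
move: (expR (- (t * L))) (expR (- u)) h1 h2 h3' h4' h5 => x y h1 h2 h3' h4' h5.
lra.
Qed.

Lemma E_cos_scale (K : set R) : attractor phi K -> ~ (exists x, K = [set x]) ->
  phase_separation phi K ->
  exists t A0 C, [/\ 0 < t, 0 < A0, 0 < C & forall (j : nat) (S c : R), S != 0 ->
    A0 * j%:R <= ln `|S| -> `|E (fun x => cos (c + S * x))| <= C * expR (- (t * j%:R))].
Proof.
move=> Katt Kn uni.
have [N [rho [b0 [N0 /andP[rho0 rho1] b00 step]]]] := dolgopyat_step G Katt Kn uni.
have [s s0 [Cf Cf0 HF]] := frostman G Katt Kn.
have M0 := rg_M0 G; have Cu0 := rg_Cu0 G; have cc := cut_const_gt0 G.
have NR : 0 < N%:R :> R by rewrite ltr0n.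
pose sig : R := - ln rho; have sig0 : 0 < sig by rewrite oppr_gt0 ln_lt0// rho0.
(* With this [eps], [rho ^+ (k * j) = expR (- (40 * L))] beats the factor
   [expR (18 * L)] coming from the [m ^ 2] frequencies of the Fejer mean. *)
pose eps : R := sig / (80 * N%:R); have eps0 : 0 < eps by rewrite divr_gt0// mulr_gt0.
have [k' /andP[hk _]] := @truncn_ceil (4 * M / (eps * N%:R)) ltac:(by rewrite divr_ge0
  ?mulr_ge0// ltW).
pose k := k'.+1; pose q := (N * k)%N.
have q0 : (0 < q)%N by rewrite muln_gt0 N0.
have qR : 0 < q%:R :> R by rewrite ltr0n.
have Mq : M <= eps * q%:R / 4.
  move: hk; rewrite ler_pdivrMr; last exact: mulr_gt0.
  rewrite /q /k natrM; lra.
have [m [cd [mb cd0 Hdev]]] := theta_deviation G eps0 q0 Mq.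
pose ell : R := 2 * eps * q%:R; have ell0 : 0 < ell by apply: mulr_gt0 => //; exact: mulr_gt0.
have ellk : sig * k%:R = 40 * ell by rewrite /ell /eps /q natrM; field; rewrite gt_eqF.
pose Th : R := theta_rate lam Cu Cl * q%:R.
have Th0 : 0 < Th by rewrite mulr_gt0// (theta_rate_gt0 G).
pose cut : R := cut_const lam Cl M.
pose K1 : R := M + `|ln cut|; have K10 : 0 < K1 by rewrite ltr_wpDr.
(* Three rates compete: that of the oscillatory errors, that of large deviations per block, and the
   Frostman exponent. The square root in [E_cos_estimate] leaves [t / 2]. *)
pose t : R := Num.min 1 (Num.min (cd / ell) s).
have t0 : 0 < t by rewrite !lt_min ltr01 s0 divr_gt0.
have t1 : t <= 1 by rewrite ge_min lexx.
have ts : t <= s by rewrite !ge_min lexx !orbT.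
have tc : t * ell <= cd by rewrite -ler_pdivlMr// !ge_min lexx !orbT.
pose C1 : R := 4 + 289 + 8 * expR (4 * M) + 16 * (b0 + 3) ^+ 2 / cut + Cf.
pose C0 : R := M * Cu + Num.sqrt C1 + expR (t / 2 * (1 + 2 * K1)).
(* The constants 57 and 3 are made for [lr <= - (26 L) - Th j] below. The part [26 L] handles
   frequencies of order [expR (18 L)], and [Th j] compensates [- m j] in
   [ln |S| + 3 lr = 5 L - m j + lr]. *)
exists (t / 2 * ell), (57 * ell + 3 * Th), C0; split.
- by rewrite mulr_gt0// divr_gt0.
- by rewrite addr_gt0// mulr_gt0.
- by rewrite ltr_wpDl ?expR_gt0// addr_ge0 ?sqrtr_ge0// ltW// mulr_gt0.
move=> j S c S0 HS; pose L : R := ell * j%:R.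
have L0 : 0 <= L by rewrite mulr_ge0// ltW.
rewrite (_ : t / 2 * ell * j%:R = t / 2 * L); last by rewrite /L mulrA.
(* Small [L] is covered by the trivial bound, through the last summand of [C0]. Otherwise
   [L - K1 >= L / 2 = eps * q * j], the deviation controlled by [theta_deviation]. *)
have [Lsmall|Lbig] := ltP L (1 + 2 * K1).
  apply: le_trans (E_cos_le1 _ _) _.
  apply: le_trans (_ : expR (t / 2 * (1 + 2 * K1)) * expR (- (t / 2 * L)) <= _).
    rewrite -expRD -[leLHS]expR0 ler_expR -mulrBr mulr_ge0 ?divr_ge0// ?(ltW t0)//.
    by rewrite subr_ge0 ltW.
  by rewrite ler_wpM2r ?expR_ge0// /C0 lerDr addr_ge0 ?sqrtr_ge0// ltW// mulr_gt0.
have L1 : 1 <= L by move: K10 Lbig; clear -G; lra.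
have Sn : 0 < `|S| by rewrite normr_gt0.
pose lr : R := (5 * L - m * j%:R - ln `|S|) / 2; pose r : R := expR lr.
have mj : - (Th * j%:R) <= m * j%:R <= Th * j%:R.
  move: mb; rewrite ler_norml => /andP[m1 m2]; rewrite -mulNr.
  by apply/andP; split; rewrite ler_wpM2r.
have Tj : 0 <= Th * j%:R by rewrite mulr_ge0// ltW.
have lrb : lr <= - (26 * L) - Th * j%:R by rewrite /lr; move: HS mj; rewrite /L; clear -G; lra.
have r01 : 0 < r < 1 by rewrite expR_gt0 -expR0 ltr_expR; move: lrb L1 Tj; clear -G; lra.
have [W sW HW] := cut_set G r01.
pose n := (N * (k * j))%N.
have nq : n = (q * j)%N by rewrite /n /q mulnA.
have [m' /andP[mm1 mm2]] := truncn_ceil (expR_ge0 (9 * L)).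
pose mm := m'.+1.
have e9 : 1 <= expR (9 * L) by rewrite -[leLHS]expR0 ler_expR; move: L1; clear -G; lra.
have mm3 : mm%:R <= 2 * expR (9 * L) by rewrite /mm; move: mm2 e9; clear -G; lra.
have mmsq : (mm ^ 2)%:R <= 4 * expR (18 * L) :> R.
  rewrite natrX (_ : 18 * L = 9 * L + 9 * L); last by ring.
  rewrite expRD (_ : 4 * _ = (2 * expR (9 * L)) ^+ 2); last by ring.
  by rewrite lerXn2r ?nnegrE ?mulr_ge0 ?expR_ge0.
have [N1 /andP[N1a N1b]] := truncn_ceil (mulr_ge0 (ltW b00) L0).
have mr : 2 * (mm ^ 2)%:R * r <= 1.
  apply: le_trans (_ : expR (8 * L) * expR (18 * L) * r <= _); last first.
    by rewrite -!expRD -[leRHS]expR0 ler_expR; move: lrb L1 Tj; clear -G; lra.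
  rewrite ler_wpM2r ?expR_ge0//; apply: le_trans (_ : 8 * expR (18 * L) <= _).
    by move: mmsq; clear -G; lra.
  by rewrite ler_wpM2r ?expR_ge0//; have := expR_ge1Dx (8 * L); move: L1; clear -G; lra.
have rho_sqrt : Num.sqrt (rho ^+ (k * j)) = expR (- (20 * L)).
  have -> : rho = expR (- sig) by rewrite opprK lnK.
  have -> : expR (- sig) ^+ (k * j) = expR (- (20 * L)) ^+ 2.
    rewrite -!expRM_natl natrM; congr expR.
    rewrite (_ : k%:R * j%:R * - sig = - (sig * k%:R * j%:R)); last by ring.
    by rewrite ellk /L; ring.
  by rewrite sqrtr_sqr ger0_norm ?expR_ge0.
have scale : `|S| * r * expR (m * j%:R + lr) = expR (5 * L).
  rewrite -{1}[`|S|]lnK ?posrE// -!expRD; congr expR; rewrite /lr; by field.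
have dev1 : \sum_(w <- words A n | L - K1 < `|theta phi w 0 - (m * j%:R + lr - ln r)|) pw p w
    <= 2 * expR (- (cd * j%:R)).
  apply: le_trans (Hdev j); rewrite -nq /r expRK addrK.
  rewrite big_mkcond [leRHS]big_mkcond/=; apply: ler_sum => w _.
  case: ifPn => h1; last by case: ifP => _ //; exact: rg_pw_ge0 G _.
  by rewrite ifT//; apply: le_lt_trans h1; move: Lbig; rewrite /L /ell; clear -G; lra.
have bN : b0 <= N1.+1%:R * (pi / (2 * L)).
  have p2 := pi_ge2 R; rewrite mulrA ler_pdivlMr; last by move: L1; clear -G; lra.
  have : b0 * L * 2 <= N1.+1%:R * pi by apply: ler_pM => //; exact: mulr_ge0 (ltW b00) L0.
  by clear -G; lra.
apply: le_trans (E_cos_estimate G r01 sW HW step (ltW rho0) (erefl n) c L1 S0 (ltn0Sn m') bN mr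
  scale dev1
  (fun x => HF x L)) _.
rewrite -/mm rho_sqrt.
have eL : expR (- L) <= expR (- (t * L)).
  by rewrite ler_expR lerN2 ler_piMl.
have eL2 : expR (- L) <= expR (- (t / 2 * L)).
  by rewrite ler_expR lerN2 ler_piMl//; move: t1; clear -G; lra.
have p1 : `|S| * (M * Cu * r ^+ 3) <= M * Cu * expR (- (t / 2 * L)).
  have -> : `|S| * (M * Cu * r ^+ 3) = M * Cu * (`|S| * r * r * r) by ring.
  rewrite ler_wpM2l//; first by rewrite mulr_ge0// ltW.
  apply: le_trans eL2; rewrite -{1}[`|S|]lnK ?posrE// -!expRD ler_expR.
  by move: mj lrb L1 Tj; rewrite /lr; clear -G; lra.
have p2 : 2 * (2 * expR (- (cd * j%:R))) + 289 * expR (7 * L) * L / mm%:R +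
    2 * (mm ^ 2)%:R * (expR (4 * M) * expR (- (20 * L))) +
    4 * N1.+2%:R ^+ 2 * expR (- (2 * L)) / cut + Cf * expR (- (s * L)) <= C1 * expR (- (t * L)).
  rewrite natrX in mmsq *; apply: error_terms => //; try exact: ltW.
  - by rewrite /L mulrA ler_wpM2r.
  - by rewrite ler0n/= -natr1; move: N1b; clear -G; lra.
have p3 : Num.sqrt (C1 * expR (- (t * L))) = Num.sqrt C1 * expR (- (t / 2 * L)).
  have -> : expR (- (t * L)) = expR (- (t / 2 * L)) ^+ 2.
    by rewrite -expRM_natl; congr expR; field.
  have C10 : 0 <= C1.
    have x1 := expR_ge0 (4 * M).
    have x2 : 0 <= 16 * (b0 + 3) ^+ 2 / cut.
      by apply: divr_ge0 (ltW cc); apply: mulr_ge0 => //; exact: sqr_ge0.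
    by rewrite /C1; move: x1 x2 Cf0; clear -G; lra.
  by rewrite sqrtrM// sqrtr_sqr ger0_norm ?expR_ge0.
apply: le_trans (_ : M * Cu * expR (- (t / 2 * L)) + Num.sqrt C1 * expR (- (t / 2 * L)) <= _).
  by rewrite -p3; apply: lerD => //; exact: ler_wsqrtr.
by rewrite /C0 -mulrDl ler_wpM2r ?expR_ge0// lerDl expR_ge0.
Qed.

(** The number of blocks is the largest [j] with [A0 * j <= ln |S|]; rounding it down costs the
    factor [expR t]. *)
Lemma E_cos_decay (K : set R) : attractor phi K -> ~ (exists x, K = [set x]) ->
  phase_separation phi K ->
  exists2 alpha, 0 < alpha & exists2 C, 0 < C & forall S c : R, 1 < `|S| ->
    `|E (fun x => cos (c + S * x))| <= C * `|S| `^ (- alpha).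
Proof.
move=> Katt Kn uni; have [t [A0 [C [t0 A00 C0 H]]]] := E_cos_scale Katt Kn uni.
exists (t / A0); first exact: divr_gt0.
exists (C * expR t); first by rewrite mulr_gt0 ?expR_gt0.
move=> S c S1; have Sn : 0 < `|S| by apply: lt_trans S1.
have l0 : 0 <= ln `|S| by rewrite ln_ge0 ?ltW.
have /andP[j1 j2] := truncn_itv (divr_ge0 l0 (ltW A00)).
set j := Num.truncn _ in j1 j2.
apply: le_trans (H j S c _ _) _.
- by rewrite -normr_gt0.
- by move: j1; rewrite ler_pdivlMr// mulrC.
rewrite -mulrA ler_wpM2l ?(ltW C0)// /powR gt_eqF// -expRD ler_expR.
have : t * (ln `|S| / A0) <= t * (j%:R + 1) by rewrite ler_wpM2l ?(ltW t0)// natr1 ltW.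
lra.
Qed.

End PowerDecay.

Lemma Rintegral_full (R : realType) (A : finType) (phi : A -> R -> R) (p : A -> R)
    (mu : probability R R) (f : R -> R) : self_conformal phi p mu ->
  measurable_fun setT f -> (exists M, forall x, `|f x| <= M) -> \int[mu]_x f x = Emu mu f.
Proof.
move=> sc mf [M HM].
have If : mu.-integrable setT (EFin \o f).
  apply: measurable_bounded_integrable => //.
    by apply: le_lt_trans (probability_le1 _ _) (ltry _).
  by exists M; split; rewrite ?num_real // => y My x _ /=; apply: le_trans (HM x) _; exact: ltW.
rewrite /Emu /Rintegral (negligible_integral _ _ If (mu_setC_I01 sc))//.
  by rewrite setTD setCK.
by apply: measurableC; exact: measurable_I.
Qed.

Theorem theorem1p4 (R : realType) (A : finType) (phi : A -> R -> R) (K : set R)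
    (p : A -> R) (mu : probability R R)
    (phi_C2 : C2_IFS phi)
    (K_attractor : attractor phi K)
    (phi_contracting : uniformly_contracting phi)
    (phi_distortion : bounded_distortion phi)
    (K_nontrivial : ~ (exists x : R, K = [set x]))
    (phi_UNI : UNI phi K)
    (p_prob : probability_vector p)
    (mu_self_conformal : self_conformal phi p mu)
    (mu_non_atomic : non_atomic mu) :
  exists2 alpha : R, 0 < alpha &
  exists2 C : R, 0 < C &
  forall xi : R, 1 < `|xi| ->
    `|fourier mu xi| <= (C * `|xi| `^ (- alpha))%:C.
Proof.
have [kap [lam [Cu [Cl [M G]]]]] :=
  regular_of_contracting phi_C2 phi_contracting p_prob mu_self_conformal.
have [KI _ _ _] := K_attractor.
have [g [g1 [g_gt1 g_lt [Cu' [Cl' [Cu0' Cl0' H]]]]]] := phi_contracting.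
have uni := UNI_phase_separation phi_C2 g_gt1 g_lt Cl0' H KI phi_UNI.
have [al al0 [C C0 HC]] := E_cos_decay G K_attractor K_nontrivial uni.
exists al => //; exists (2 * C); first exact: mulr_gt0.
move=> xi xi1; pose S := - (2 * pi * xi).
have p2 := pi_ge2 R; have xi0 : 0 < `|xi| by lra.
have SE : `|S| = 2 * pi * `|xi|.
  by rewrite normrN !normrM (ger0_norm (pi_ge0 R)) ger0_norm.
have Sxi : `|xi| <= `|S| by rewrite SE ler_peMl//; lra.
have S1 : 1 < `|S| by apply: lt_le_trans Sxi.
have pw : `|S| `^ (- al) <= `|xi| `^ (- al).
  rewrite /powR !gt_eqF//; last by apply: lt_le_trans Sxi.
  rewrite ler_expR !mulNr lerN2 ler_wpM2l ?(ltW al0)// ler_ln ?posrE//.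
  by apply: lt_le_trans Sxi.
(* Real and imaginary parts are both cosines, with phases 0 and [- (pi / 2)], so one bound uniform
   in the phase serves for both. *)
have bound c : `|\int[mu]_x cos (c + S * x)| <= C * `|xi| `^ (- al).
  rewrite (Rintegral_full mu_self_conformal).
  - by apply: le_trans (HC S c S1) _; rewrite ler_wpM2l// ltW.
  - apply: measurableT_comp; first by apply: continuous_measurable_fun; exact: continuous_cos.
    by apply: measurable_funD => //; exact: measurable_funM.
  - by exists 1 => x; exact: cos_max.
have Re : \int[mu]_x complex.Re (expi (- (2 * pi * xi * x))) = \int[mu]_x cos (0 + S * x).
  by apply: eq_Rintegral => x _ /=; rewrite add0r /S mulNr.
have Im : \int[mu]_x complex.Im (expi (- (2 * pi * xi * x))) = \int[mu]_x cos (- (pi / 2) + S *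
  x).
  apply: eq_Rintegral => x _ /=; rewrite addrC cosB cos_pihalf sin_pihalf /S mulNr.
  by rewrite mulr0 add0r mulr1.
rewrite normc_def /fourier /Cintegral lecR /= Re Im.
have := bound 0; have := bound (- (pi / 2)).
set a := \int[mu]_x cos (0 + _); set b := \int[mu]_x cos (_ + _) => hb ha.
apply: le_trans (_ : `|a| + `|b| <= _); last by rewrite -mulrA mulr_natl mulr2n lerD.
apply: le_of_sqr; first by rewrite addr_ge0.
rewrite sqr_sqrtr ?addr_ge0 ?sqr_ge0// sqrrD !real_normK ?num_real//.
by rewrite addrAC lerDl mulrn_wge0// mulr_ge0.
Qed.
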